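(* Let $\boldsymbol H_e\in H^1(0,T;H(\mathrm{div}))$ be given. Then the semi-discrete scheme (SD) described in the context has at least one solution $(\boldsymbol u_h,\tilde p_h,\boldsymbol m_h,\boldsymbol z_h,\boldsymbol k_h,\boldsymbol H_h,\varphi_h)$. Furthermore, assume that there exist constants $h_0>0$ and $M_0>0$ such that for any $0<h\le h_0$ and any solution $(\boldsymbol u_h,\boldsymbol m_h)$ of the auxiliary problem (AUX) described in the context there holds $$\max\{\|\boldsymbol u_h\|_{L^\infty},\ \|\boldsymbol m_h\|_{L^\infty},\ \|\mathrm{curl}_h\boldsymbol m_h\|_{L^\infty},\ \|\mathrm{div}\,\boldsymbol m_h\|_{L^\infty}\}\le M_0 .$$ Then the semi-discrete scheme (SD) admits a unique solution.
   Context: $\Omega\subset\mathbb R^3$ is a bounded, simply connected, convex domain with Lipschitz boundary and outward unit normal $\boldsymbol n$; $T>0$; $(\cdot,\cdot)$, $\|\cdot\|$ are the $L^2(\Omega)$ inner product and norm, $\|\cdot\|_1$ is the $H^1(\Omega)$ norm. $H(\mathrm{curl})$, $H(\mathrm{div})$ are the spaces of $L^2(\Omega)^3$ fields with curl in $L^2(\Omega)^3$, respectively divergence in $L^2(\Omega)$; $\boldsymbol S=H_0^1(\Omega)^3$, $\boldsymbol U=H_0(\mathrm{curl})$ (zero tangential trace $\boldsymbol v\times\boldsymbol n$), $\boldsymbol V=H_0(\mathrm{div})$ (zero normal trace $\boldsymbol v\cdot\boldsymbol n$), $W=L_0^2(\Omega)$ (zero mean). The constants $\eta,\mu_0,\sigma,\tau,\chi_0,\beta$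 are positive, and $\boldsymbol H_e\cdot\boldsymbol n=0$ on $\partial\Omega\times(0,T]$. $\boldsymbol u_0,\boldsymbol m_0$ are given initial data. $b(\boldsymbol v;\boldsymbol m,\boldsymbol F):=\frac12(\boldsymbol v\cdot\boldsymbol F,\mathrm{div}\,\boldsymbol m)-\frac12(\boldsymbol v\cdot\boldsymbol m,\mathrm{div}\,\boldsymbol F)$. Finite element spaces. $\mathcal T_h$ is a quasi-uniform shape-regular tetrahedral triangulation of $\Omega$ of mesh size $h$; $l\ge0$ is an integer; $\mathbb P_l(K)$ denotes polynomials of degree at most $l$ on $K\in\mathcal T_h$. $\boldsymbol S_h=(S_h)^3\subset\boldsymbol S$ with $S_h$ a Lagrange element space, $S_h|_K\supset\mathbb P_{l+1}(K)$; $\Sigma_h\subset H_0^1(\Omega)$ a Lagrange element space with $\Sigma_h|_K\supset\mathbb P_l(K)$ ($\Sigma_h$ may be the same as $S_h$); $\boldsymbol U_h\subset\boldsymbol U$ a (Nédélec) edge element space with $\boldsymbol U_h|_K\supset\mathbb P_l(K)^3$; $\boldsymbol V_h\subset\boldsymbol V$ a face element space with $\boldsymbol V_h|_K\supset\mathbb P_l(K)^3$; $W_h,L_h\subset W$ piecewise polynomial spaces whose restrictions to $K$ contain $\mathbb P_l(K)$. Standing assumptions: (A1) the sequences $H_0^1\xrightarrow{\mathrm{grad}}\boldsymbol U\xrightarrow{\mathrm{curl}}\boldsymbol V\xrightarrow{\mathrm{div}}W$ and $\Sigma_h\xrightarrow{\mathrm{grad}}\boldsymbol U_h\xrightarrow{\mathrm{curl}}\boldsymbol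 V_h\xrightarrow{\mathrm{div}}W_h$ are exact (kernel of curl = image of grad, kernel of div = image of curl, $\mathrm{div}\,\boldsymbol V_h=W_h$) and commute with the classical interpolation operators $\pi_h:H_0^1\to\Sigma_h$, $\pi_h^c:\boldsymbol U\to\boldsymbol U_h$, $\pi_h^d:\boldsymbol V\to\boldsymbol V_h$ and the $L^2$ projection $Q_h:W\to W_h$; (A2) $\sup_{\boldsymbol v_h\in\boldsymbol S_h}(q_h,\mathrm{div}\,\boldsymbol v_h)/\|\boldsymbol v_h\|_1\ge c\|q_h\|$ for all $q_h\in L_h$, with $c>0$ independent of $h$. Discrete operators. $\mathrm{div}_h:\boldsymbol U_h\to\Sigma_h$ and $\mathrm{curl}_h:\boldsymbol V_h\to\boldsymbol U_h$ are defined by $(\mathrm{div}_h\boldsymbol u_h,s_h)=-(\boldsymbol u_h,\mathrm{grad}\,s_h)$ for all $s_h\in\Sigma_h$ and $(\mathrm{curl}_h\boldsymbol v_h,\boldsymbol u_h)=(\boldsymbol v_h,\mathrm{curl}\,\boldsymbol u_h)$ for all $\boldsymbol u_h\in\boldsymbol U_h$. Let $\mathfrak K_h^c=\boldsymbol U_h\cap\ker(\mathrm{div}_h)$, $\mathfrak K_h^d=\boldsymbol V_h\cap\ker(\mathrm{curl}_h)$, $\mathfrak K^c=\boldsymbol U\cap(\boldsymbol U\cap\ker\mathrm{curl})^\perp$, $\mathfrak K^d=\boldsymbol V\cap(\boldsymbol V\cap\ker\mathrm{div})^\perp$ ($L^2$-orthogonality). $P_h^c\boldsymbol u\in\mathfrak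 K_h^c$ and $P_h^d\boldsymbol v\in\mathfrak K_h^d$ are defined by $(\mathrm{curl}P_h^c\boldsymbol u,\mathrm{curl}\boldsymbol\phi_h)=(\mathrm{curl}\boldsymbol u,\mathrm{curl}\boldsymbol\phi_h)$ for all $\boldsymbol\phi_h\in\mathfrak K_h^c$ and $(\mathrm{div}P_h^d\boldsymbol v,\mathrm{div}\boldsymbol\psi_h)=(\mathrm{div}\boldsymbol v,\mathrm{div}\boldsymbol\psi_h)$ for all $\boldsymbol\psi_h\in\mathfrak K_h^d$. For $\boldsymbol v\in\boldsymbol V$, written as the $L^2$-orthogonal sum $\boldsymbol v=\mathrm{curl}\,\boldsymbol v_1+\boldsymbol v_2$ with $\boldsymbol v_1\in\mathfrak K^c$, $\boldsymbol v_2\in\mathfrak K^d$, set $I_h^d\boldsymbol v=\mathrm{curl}P_h^c\boldsymbol v_1+P_h^d\boldsymbol v_2$. Semi-discrete scheme (SD): find $\boldsymbol u_h\in C^1([0,T];\boldsymbol S_h)$, $\tilde p_h\in C^0([0,T];L_h)$, $\boldsymbol m_h\in C^1([0,T];\boldsymbol V_h)$, $\boldsymbol z_h,\boldsymbol k_h\in C^0([0,T];\boldsymbol U_h)$, $\boldsymbol H_h\in C^0([0,T];\boldsymbol V_h)$, $\varphi_h\in C^0([0,T];W_h)$ such that for all $\boldsymbol v_h\in\boldsymbol S_h$, $q_h\in L_h$, $\boldsymbol F_h\in\boldsymbol V_h$, $\boldsymbol\zeta_h,\boldsymbol\kappa_h\in\boldsymbol U_h$, $\boldsymbol G_h\in\boldsymbol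 V_h$, $r_h\in W_h$: $$(\partial_t\boldsymbol u_h,\boldsymbol v_h)-(\boldsymbol u_h\times\mathrm{curl}\boldsymbol u_h,\boldsymbol v_h)+\eta(\nabla\boldsymbol u_h,\nabla\boldsymbol v_h)-(\tilde p_h,\mathrm{div}\boldsymbol v_h)-\mu_0b(\boldsymbol v_h;\boldsymbol H_h,\boldsymbol m_h)-\tfrac{\mu_0}2(\boldsymbol v_h\times\boldsymbol k_h,\boldsymbol H_h)=0,$$ $$(\mathrm{div}\boldsymbol u_h,q_h)=0,$$ $$(\partial_t\boldsymbol m_h,\boldsymbol F_h)+b(\boldsymbol u_h;\boldsymbol m_h,\boldsymbol F_h)+\tfrac12(\boldsymbol u_h\times\boldsymbol F_h,\boldsymbol k_h)-\tfrac12(\mathrm{curl}\boldsymbol z_h,\boldsymbol F_h)+\sigma(\mathrm{curl}\boldsymbol k_h,\boldsymbol F_h)+\sigma(\mathrm{div}\boldsymbol m_h,\mathrm{div}\boldsymbol F_h)+\tfrac1\tau(\boldsymbol m_h,\boldsymbol F_h)-\tfrac{\chi_0}\tau(\boldsymbol H_h,\boldsymbol F_h)+\beta(\boldsymbol m_h\times(\boldsymbol m_h\times\boldsymbol H_h),\boldsymbol F_h)=0,$$ $$(\boldsymbol z_h,\boldsymbol\zeta_h)-(\boldsymbol u_h\times\boldsymbol m_h,\boldsymbol\zeta_h)=0,\quad(\boldsymbol k_h,\boldsymbol\kappa_h)-(\boldsymbol m_h,\mathrm{curl}\boldsymbol\kappa_h)=0,$$ $$(\boldsymbol H_h,\boldsymbol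 G_h)+(\varphi_h,\mathrm{div}\boldsymbol G_h)=0,\quad(\mathrm{div}\boldsymbol H_h+\mathrm{div}\boldsymbol m_h,r_h)+(\mathrm{div}\boldsymbol H_e,r_h)=0,$$ with initial data $\boldsymbol u_h(\cdot,0)=\pi_h\boldsymbol u_0$ (Lagrange interpolation into $\boldsymbol S_h$, componentwise), $\boldsymbol m_h(\cdot,0)=I_h^d\boldsymbol m_0$. Auxiliary problem (AUX). Let $\mathfrak K_h^s=\{\boldsymbol v_h\in\boldsymbol S_h:(\mathrm{div}\boldsymbol v_h,q_h)=0\ \forall q_h\in L_h\}$. For given $\boldsymbol m_h\in\boldsymbol V_h$ let $(\boldsymbol H_h(\boldsymbol m_h),\varphi_h(\boldsymbol m_h))\in\boldsymbol V_h\times W_h$ be the unique solution of the last two equations of (SD). Find $\boldsymbol u_h\in C^1([0,T];\mathfrak K_h^s)$, $\boldsymbol m_h\in C^1([0,T];\boldsymbol V_h)$, with the same initial data, such that for all $\boldsymbol v_h\in\mathfrak K_h^s$, $\boldsymbol F_h\in\boldsymbol V_h$: $$(\partial_t\boldsymbol u_h,\boldsymbol v_h)-(\boldsymbol u_h\times\mathrm{curl}\boldsymbol u_h,\boldsymbol v_h)+\eta(\nabla\boldsymbol u_h,\nabla\boldsymbol v_h)-\mu_0b(\boldsymbol v_h;\boldsymbol H_h(\boldsymbol m_h),\boldsymbol m_h)-\tfrac{\mu_0}2(\boldsymbol v_h\times\mathrm{curl}_h\boldsymbol m_h,\boldsymbol H_h(\boldsymbol m_h))=0,$$ $$(\partial_t\boldsymbol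 m_h,\boldsymbol F_h)+b(\boldsymbol u_h;\boldsymbol m_h,\boldsymbol F_h)+\tfrac12(\boldsymbol u_h\times\boldsymbol F_h,\mathrm{curl}_h\boldsymbol m_h)+\tfrac1\tau(\boldsymbol m_h,\boldsymbol F_h)-\tfrac12(\boldsymbol u_h\times\boldsymbol m_h,\mathrm{curl}_h\boldsymbol F_h)+\sigma(\mathrm{curl}_h\boldsymbol m_h,\mathrm{curl}_h\boldsymbol F_h)+\sigma(\mathrm{div}\boldsymbol m_h,\mathrm{div}\boldsymbol F_h)-\tfrac{\chi_0}\tau(\boldsymbol H_h(\boldsymbol m_h),\boldsymbol F_h)+\beta(\boldsymbol m_h\times(\boldsymbol m_h\times\boldsymbol H_h(\boldsymbol m_h)),\boldsymbol F_h)=0.$$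
   Formalization: Added hypothesis: the interpolant π_h u_0 satisfies (div π_h u_0, q_h)=0 for all q_h in L_h; (SD) at t=0 forces this, and without it no solution exists. Also u_0 in S continuous on the closure of Ω and m_0 in V, so that the initial data are defined. *)

(* Defs.v *)
From HB Require Import structures.
From mathcomp Require Import all_boot all_order all_algebra.
From mathcomp Require Import all_classical all_reals all_analysis.
From mathcomp Require Import ess_sup_inf.
Set Implicit Arguments. Unset Strict Implicit. Unset Printing Implicit Defensive.
Import Order.TTheory GRing.Theory Num.Theory numFieldNormedType.Exports.
Local Open Scope classical_set_scope.
Local Open Scope ring_scope.

(* Points and vectors of R^3 are triples (the library puts the product
   measure on pairs); [co i] is the i-th coordinate and [ev i] the i-th unit
   vector, for i = 0, 1, 2.  Spaces of (classes of) functions on a domain [Om]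
   are sets of total functions on R^3: only the values on [Om] matter, and
   equality is equality almost everywhere on [Om]. *)
Notation "'pt' R" := (R * R * R)%type (at level 10, R at level 9, only parsing).

Section Euclid.
Variable R : realType.

Definition co (i : nat) (x : pt R) : R := nth 0 [:: x.1.1; x.1.2; x.2] i.
Definition ev (i : nat) : pt R :=
  ((i == 0%N)%:R, (i == 1%N)%:R, (i == 2%N)%:R).

Definition dot (x y : pt R) : R := \sum_(i < 3) co i x * co i y.
Definition cross (x y : pt R) : pt R :=
  (co 1 x * co 2 y - co 2 x * co 1 y,
   co 2 x * co 0 y - co 0 x * co 2 y,
   co 0 x * co 1 y - co 1 x * co 0 y).
Definition enorm (x : pt R) : R := Num.sqrt (dot x x).

Definition mu3 := ((@lebesgue_measure R \x @lebesgue_measure R)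
                   \x @lebesgue_measure R)%E.

Definition pd (i : nat) (f : pt R -> R) : pt R -> R := fun x => 'D_(ev i) f x.
Definition smooth (f : pt R -> R) :=
  forall (s : seq 'I_3) (x : pt R), differentiable (foldr (fun i : 'I_3 => pd i) f s) x.
Definition vsmooth (v : pt R -> pt R) := forall i : 'I_3, smooth (co i \o v).

Definition cgrad (f : pt R -> R) : pt R -> pt R :=
  fun x => (pd 0 f x, pd 1 f x, pd 2 f x).
Definition ccurl (v : pt R -> pt R) : pt R -> pt R := fun x =>
  (pd 1 (co 2 \o v) x - pd 2 (co 1 \o v) x,
   pd 2 (co 0 \o v) x - pd 0 (co 2 \o v) x,
   pd 0 (co 1 \o v) x - pd 1 (co 0 \o v) x).
Definition cdiv (v : pt R -> pt R) : pt R -> R :=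
  fun x => \sum_(i < 3) pd i (co i \o v) x.

End Euclid.
Arguments mu3 : clear implicits.

Section Domain.
Variables (R : realType) (Om : set (pt R)).

Definition boundary : set (pt R) := closure Om `\` interior Om.

Definition convex3 := forall (x y : pt R) (a : R),
  Om x -> Om y -> 0 <= a <= 1 -> Om (a *: x + (1 - a) *: y).

Definition path_connected := forall x y : pt R, Om x -> Om y ->
  exists c : R -> pt R, [/\ {within `[0, 1], continuous c},
    forall t, 0 <= t <= 1 -> Om (c t), c 0 = x & c 1 = y].

Definition simply_connected := path_connected /\
  forall c : R -> pt R, {within `[0, 1], continuous c} ->
    (forall t, 0 <= t <= 1 -> Om (c t)) -> c 0 = c 1 ->
  exists F : R * R -> pt R,
    [/\ {within `[0, 1] `*` `[0, 1], continuous F},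
        forall s t, 0 <= s <= 1 -> 0 <= t <= 1 -> Om (F (s, t)),
        forall t, 0 <= t <= 1 -> F (0, t) = c t,
        forall t, 0 <= t <= 1 -> F (1, t) = c 0
      & forall s, 0 <= s <= 1 -> F (s, 0) = c 0 /\ F (s, 1) = c 0].

(* Near each boundary point, [Om] is the strict subgraph of a Lipschitz
   function in some orthonormal frame (n1, n2, n3). *)
Definition lipschitz_boundary := forall p, boundary p ->
  exists (n1 n2 n3 : pt R) (g : R -> R -> R) (L r : R),
    [/\ [/\ dot n1 n1 = 1, dot n2 n2 = 1 & dot n3 n3 = 1],
        [/\ dot n1 n2 = 0, dot n1 n3 = 0 & dot n2 n3 = 0],
        forall a b a' b', `|g a b - g a' b'| <= L * (`|a - a'| + `|b - b'|),
        0 < r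
      & forall x, enorm (x - p) < r ->
          (Om x <-> dot n3 x < g (dot n1 x) (dot n2 x))].

Record good_domain : Prop := GoodDomain {
  dom_open : open Om;
  dom_nonempty : Om !=set0;
  dom_bounded : exists r : R, forall x, Om x -> enorm x <= r;
  dom_convex : convex3;
  dom_simply_connected : simply_connected;
  dom_lipschitz : lipschitz_boundary }.

Definition aeq (V : Type) (f g : pt R -> V) :=
  {ae mu3 R, forall x, Om x -> f x = g x}.

Definition ip (f g : pt R -> R) : R := \int[mu3 R]_(x in Om) (f x * g x).
Definition vip (v w : pt R -> pt R) : R :=
  \int[mu3 R]_(x in Om) dot (v x) (w x).
Definition snorm f : R := Num.sqrt (ip f f).
Definition vnorm v : R := Num.sqrt (vip v v).

Definition L2 (f : pt R -> R) := measurable_fun Om f /\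
  (\int[mu3 R]_(x in Om) (f x ^+ 2)%:E < +oo)%E.
Definition L2v (v : pt R -> pt R) := forall i : 'I_3, L2 (co i \o v).
Definition L20 : set (pt R -> R) :=
  [set f | L2 f /\ \int[mu3 R]_(x in Om) f x = 0].

Definition Linf (f : pt R -> R) : \bar R :=
  ess_sup (mu3 R) (fun x => (((Num.norm \o f) \_ Om) x)%:E).
Definition Linfv (v : pt R -> pt R) : \bar R := Linf (@enorm R \o v).

Definition test (f : pt R -> R) := smooth f /\
  exists K : set (pt R), [/\ compact K, K `<=` Om & forall x, ~ K x -> f x = 0].
Definition vtest (v : pt R -> pt R) := forall i : 'I_3, test (co i \o v).

Definition weak_grad (f : pt R -> R) (g : pt R -> pt R) :=
  [/\ L2 f, L2v g & forall phi (i : 'I_3), test phi ->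
      ip f (pd i phi) = - ip (co i \o g) phi].
Definition weak_curl (v w : pt R -> pt R) :=
  [/\ L2v v, L2v w & forall Phi, vtest Phi -> vip v (ccurl Phi) = vip w Phi].
Definition weak_div (v : pt R -> pt R) (d : pt R -> R) :=
  [/\ L2v v, L2 d & forall phi, test phi -> vip v (cgrad phi) = - ip d phi].

(* A chosen representative of the weak derivative; 0 if there is none. *)
Definition wgrad f : pt R -> pt R := xget (fun=> 0) [set g | weak_grad f g].
Definition wcurl v : pt R -> pt R := xget (fun=> 0) [set w | weak_curl v w].
Definition wdiv v : pt R -> R := xget (fun=> 0) [set d | weak_div v d].

Definition gip (v w : pt R -> pt R) : R :=
  \sum_(i < 3) vip (wgrad (co i \o v)) (wgrad (co i \o w)).
Definition h1norm v : R := Num.sqrt (vip v v + gip v v).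

Definition Hdiv : set (pt R -> pt R) := [set v | exists d, weak_div v d].
Definition hdivnorm v : R := Num.sqrt (vip v v + ip (wdiv v) (wdiv v)).

(* Closure of the test functions in the H^1 norm. *)
Definition H01 : set (pt R -> R) := [set f | exists g, weak_grad f g /\
  forall e : R, 0 < e -> exists2 phi, test phi &
    snorm (f - phi) + vnorm (g - cgrad phi) < e].
Definition H01v : set (pt R -> pt R) := [set v | forall i : 'I_3, H01 (co i \o v)].

(* The traces v x n and v . n are the functionals on smooth fields up to the
   boundary given by Green's formula; they vanish iff no boundary term
   appears. *)
Definition H0curl : set (pt R -> pt R) := [set v | exists w, weak_curl v w /\
  forall Phi, vsmooth Phi -> vip v (ccurl Phi) = vip w Phi].
Definition H0div : set (pt R -> pt R) := [set v | exists d, weak_div v d /\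
  forall phi, smooth phi -> vip v (cgrad phi) = - ip d phi].

(* Exactness of Sg -grad-> U -curl-> V -div-> W, for spaces of L^2 classes. *)
Definition exact_seq (Sg : set (pt R -> R)) (U V : set (pt R -> pt R))
    (W : set (pt R -> R)) :=
  [/\ (forall s g, Sg s -> weak_grad s g -> U g /\ weak_curl g (fun=> 0))
      /\ (forall u, U u -> weak_curl u (fun=> 0) -> exists2 s, Sg s & weak_grad s u),
      (forall u w, U u -> weak_curl u w -> V w /\ weak_div w (fun=> 0))
      /\ (forall v, V v -> weak_div v (fun=> 0) -> exists2 u, U u & weak_curl u v)
    & (forall v d, V v -> weak_div v d -> W d)
      /\ (forall q, W q -> exists2 v, V v & weak_div v q)].

End Domain.

Section Polynomials.
Variable R : realType.

(* Polynomial functions of total degree < d (so P_l is [pol3 l.+1], and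
   [pol3 0] contains only 0). *)
Definition pol3 (d : nat) : set (pt R -> R) :=
  [set f | exists c : nat -> nat -> nat -> R, forall x, f x =
    \sum_(i < d) \sum_(j < d - i) \sum_(k < d - i - j)
      c i j k * co 0 x ^+ i * co 1 x ^+ j * co 2 x ^+ k].
Definition pol2 (d : nat) : set (R -> R -> R) :=
  [set f | exists c : nat -> nat -> R, forall s t, f s t =
    \sum_(i < d) \sum_(j < d - i) c i j * s ^+ i * t ^+ j].
Definition pol3v (d : nat) : set (pt R -> pt R) :=
  [set v | forall i : 'I_3, pol3 d (co i \o v)].

(* P_{d-1}^3 + x /\ P_{d-1}^3 and P_{d-1}^3 + x P_{d-1}: the Nedelec and
   Raviart-Thomas shape functions. *)
Definition nedelec (d : nat) : set (pt R -> pt R) :=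
  [set v | exists a b, [/\ pol3v d a, pol3v d b &
    forall x, v x = a x + cross x (b x)]].
Definition raviart_thomas (d : nat) : set (pt R -> pt R) :=
  [set v | exists a b, [/\ pol3v d a, pol3 d b &
    forall x, v x = a x + b x *: x]].

(* First kind: Nedelec 1980 edge elements and Raviart-Thomas-Nedelec face
   elements.  Second kind: full polynomial edge elements (Nedelec 1986) and
   Brezzi-Douglas-Marini face elements. *)
Inductive kind := FirstKind | SecondKind.

Definition edge_shape (k : kind) (r : nat) : set (pt R -> pt R) :=
  if k is FirstKind then nedelec r.+1 else pol3v r.+1.
Definition face_shape (k : kind) (r : nat) : set (pt R -> pt R) :=
  if k is FirstKind then raviart_thomas r.+1 else pol3v r.+1.

End Polynomials.

Section Mesh.
Variables (R : realType) (Om : set (pt R)).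

(* A tetrahedron is given by its four vertices. *)
Definition tet := 4.-tuple (pt R).

Definition hull (s : seq (pt R)) : set (pt R) :=
  [set x | exists a : pt R -> R, [/\ forall p, 0 <= a p,
     \sum_(p <- s) a p = 1 & x = \sum_(p <- s) a p *: p]].

Definition nondegenerate (K : tet) :=
  dot (tnth K 1 - tnth K 0)
      (cross (tnth K 2%:R - tnth K 0) (tnth K 3%:R - tnth K 0)) != 0.

Definition triangulation (Th : seq tet) :=
  [/\ forall K, K \in Th -> nondegenerate K,
      closure Om = [set x | exists2 K, K \in Th & hull K x]
    & forall K K', K \in Th -> K' \in Th ->
        hull K `&` hull K' = hull [seq p <- (K : seq _) | p \in (K' : seq _)]].

Definition diam (K : tet) : R :=
  sup [set enorm (x - y) | x in hull K & y in hull K].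
Definition mesh_size (Th : seq tet) : R := \big[Num.max/0]_(K <- Th) diam K.

Definition contains_ball (K : tet) (r : R) :=
  exists x, forall y, enorm (y - x) <= r -> hull K y.

Definition agree_on (K : tet) (V : Type) (f g : pt R -> V) :=
  {ae mu3 R, forall x, hull K x -> f x = g x}.

(* A space of L^2 classes of piecewise polynomials of bounded degree whose
   restriction to each cell contains P_l. *)
Record pw_poly_space (Th : seq tet) (l : nat) (X : set (pt R -> R)) : Prop := {
  pw_zero : X (fun=> 0);
  pw_lin : forall (a : R) f g, X f -> X g -> X (a *: f + g);
  pw_ext : forall f g, X f -> measurable_fun Om g -> aeq Om f g -> X g;
  pw_poly : exists N, forall f, X f -> L2 Om f /\
     forall K, K \in Th -> exists2 p, pol3 N p & agree_on K f p;
  pw_contains : forall K p, K \in Th -> pol3 l.+1 p ->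
     exists2 f, X f & agree_on K f p }.

Definition lagrange (Th : seq tet) (k : nat) : set (pt R -> R) :=
  [set f | [/\ H01 Om f, {within closure Om, continuous f} &
    forall K, K \in Th -> exists2 p, pol3 k.+1 p &
      forall x, hull K x -> f x = p x]].
Definition lagrangev (Th : seq tet) (k : nat) : set (pt R -> pt R) :=
  [set v | forall i : 'I_3, lagrange Th k (co i \o v)].
Definition edge_space (Th : seq tet) (k : kind) (r : nat) : set (pt R -> pt R) :=
  [set v | H0curl Om v /\ forall K, K \in Th ->
    exists2 p, edge_shape k r p & agree_on K v p].
Definition face_space (Th : seq tet) (k : kind) (r : nat) : set (pt R -> pt R) :=
  [set v | H0div Om v /\ forall K, K \in Th ->
    exists2 p, face_shape k r p & agree_on K v p].

Definition lagrange_nodes (k : nat) (K : tet) : set (pt R) :=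
  [set x | exists n : 'I_4 -> nat, (\sum_i n i = k)%N /\
     x = \sum_i ((n i)%:R / k%:R) *: tnth K i].
Definition lagrange_interp (Th : seq tet) (k : nat) (v : pt R -> pt R) :
    pt R -> pt R :=
  xget (fun=> 0) [set w | lagrangev Th k w /\
    forall K x, K \in Th -> lagrange_nodes k K x -> w x = v x].

(* Integrals over an edge [a, b] and a face [a, b, c], in affine parameters. *)
Definition on_edge (a b : pt R) (F : R -> pt R -> R) : R :=
  \int[@lebesgue_measure R]_(t in `[0, 1]) F t (a + t *: (b - a)).
Definition on_face (a b c : pt R) (F : R -> R -> pt R -> R) : R :=
  \int[(@lebesgue_measure R \x @lebesgue_measure R)%E]_(st in
       [set st : R * R | [/\ 0 <= st.1, 0 <= st.2 & st.1 + st.2 <= 1]])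
    F st.1 st.2 (a + st.1 *: (b - a) + st.2 *: (c - a)).
Definition on_cell (K : tet) (F : pt R -> R) : R :=
  \int[mu3 R]_(x in hull K) F x.

Definition edge_of (K : tet) (a b : pt R) :=
  [/\ a \in (K : seq _), b \in (K : seq _) & uniq [:: a; b]].
Definition face_of (K : tet) (a b c : pt R) :=
  [/\ a \in (K : seq _), b \in (K : seq _), c \in (K : seq _)
    & uniq [:: a; b; c]].

(* Equality of the degrees of freedom of the classical interpolation
   operators of the H^1, H(curl) and H(div) conforming elements (those for
   which the de Rham diagram commutes): vertex values and edge, face and cell
   moments, of tangential components for H(curl) and of normal components for
   H(div).  Truncated subtraction gives empty moment spaces in low degree. *)
Definition same_dofs_grad (k : nat) (K : tet) (f g : pt R -> R) :=
  [/\ forall a, a \in (K : seq _) -> f a = g a,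
      forall a b (q : {poly R}), edge_of K a b -> (size q <= k - 1)%N ->
        on_edge a b (fun t x => f x * q.[t]) = on_edge a b (fun t x => g x * q.[t]),
      forall a b c q, face_of K a b c -> pol2 (k - 2) q ->
        on_face a b c (fun s t x => f x * q s t) =
        on_face a b c (fun s t x => g x * q s t)
    & forall q, pol3 (k - 3) q ->
        on_cell K (fun x => f x * q x) = on_cell K (fun x => g x * q x)].

Definition edge_face_moment (k : kind) (r : nat) : set (R -> R -> R * R) :=
  if k is FirstKind
  then [set q | pol2 r (fun s t => (q s t).1) /\ pol2 r (fun s t => (q s t).2)]
  else [set q | exists q1 q2 q3,
         [/\ pol2 (r - 1) q1, pol2 (r - 1) q2, pol2 (r - 1) q3 &
         forall s t, q s t = (q1 s t + s * q3 s t, q2 s t + t * q3 s t)]].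
Definition edge_cell_moment (k : kind) (r : nat) : set (pt R -> pt R) :=
  if k is FirstKind then pol3v (r - 1) else raviart_thomas (r - 2).
Definition same_dofs_curl (k : kind) (r : nat) (K : tet) (v w : pt R -> pt R) :=
  [/\ forall a b (q : {poly R}), edge_of K a b -> (size q <= r.+1)%N ->
        on_edge a b (fun t x => dot (v x) (b - a) * q.[t]) =
        on_edge a b (fun t x => dot (w x) (b - a) * q.[t]),
      forall a b c q, face_of K a b c -> edge_face_moment k r q ->
        on_face a b c (fun s t x =>
          dot (v x) ((q s t).1 *: (b - a) + (q s t).2 *: (c - a))) =
        on_face a b c (fun s t x =>
          dot (w x) ((q s t).1 *: (b - a) + (q s t).2 *: (c - a)))
    & forall q, edge_cell_moment k r q ->
        on_cell K (fun x => dot (v x) (q x)) = on_cell K (fun x => dot (w x) (q x))].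

Definition face_cell_moment (k : kind) (r : nat) : set (pt R -> pt R) :=
  if k is FirstKind then pol3v r else nedelec (r - 1).
Definition same_dofs_div (k : kind) (r : nat) (K : tet) (v w : pt R -> pt R) :=
  (forall a b c q, face_of K a b c -> pol2 r.+1 q ->
     on_face a b c (fun s t x => dot (v x) (cross (b - a) (c - a)) * q s t) =
     on_face a b c (fun s t x => dot (w x) (cross (b - a) (c - a)) * q s t)) /\
  (forall q, face_cell_moment k r q ->
     on_cell K (fun x => dot (v x) (q x)) = on_cell K (fun x => dot (w x) (q x))).

Definition interp_grad (Th : seq tet) k (f : pt R -> R) : pt R -> R :=
  xget (fun=> 0) [set g | lagrange Th k g /\ forall K, K \in Th ->
    exists p, [/\ pol3 k.+1 p, agree_on K g p & same_dofs_grad k K f p]].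
Definition interp_curl (Th : seq tet) k r (v : pt R -> pt R) : pt R -> pt R :=
  xget (fun=> 0) [set w | edge_space Th k r w /\ forall K, K \in Th ->
    exists p, [/\ edge_shape k r p, agree_on K w p & same_dofs_curl k r K v p]].
Definition interp_div (Th : seq tet) k r (v : pt R -> pt R) : pt R -> pt R :=
  xget (fun=> 0) [set w | face_space Th k r w /\ forall K, K \in Th ->
    exists p, [/\ face_shape k r p, agree_on K w p & same_dofs_div k r K v p]].
Definition l2proj (W : set (pt R -> R)) (q : pt R -> R) : pt R -> R :=
  xget (fun=> 0) [set w | W w /\ forall r, W r -> ip Om w r = ip Om q r].

End Mesh.

(* The element families, common to all meshes: degrees of the Lagrange spaces
   S_h and Sigma_h, kinds and orders of the edge space U_h and face space V_h. *)
Record elements := Elements {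
  degS : nat; degSigma : nat;
  kindU : kind; ordU : nat;
  kindV : kind; ordV : nat }.

Definition admissible_elements (l : nat) (E : elements) :=
  [/\ (l.+1 <= degS E)%N, (maxn 1 l <= degSigma E)%N,
      (l <= ordU E)%N /\ (kindU E = SecondKind -> (1 <= ordU E)%N)
    & (l <= ordV E)%N /\ (kindV E = SecondKind -> (1 <= ordV E)%N)].

(* A mesh, with the piecewise polynomial spaces underlying L_h and W_h (before
   the zero mean constraint). *)
Record discretization (R : realType) := Discretization {
  cells : seq (tet R);
  pwL : set (pt R -> R);
  pwW : set (pt R -> R) }.

Record constants (R : realType) := Constants {
  eta : R; mu0 : R; sigma : R; tau : R; chi0 : R; beta : R }.

Definition positive_constants (R : realType) (c : constants R) :=
  [/\ 0 < eta c, 0 < mu0 c & 0 < sigma c] /\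
  [/\ 0 < tau c, 0 < chi0 c & 0 < beta c].

Section FESpaces.
Variables (R : realType) (Om : set (pt R)) (E : elements) (D : discretization R).

Definition Sh := lagrangev Om (cells D) (degS E).
Definition Sigmah := lagrange Om (cells D) (degSigma E).
Definition Uh := edge_space Om (cells D) (kindU E) (ordU E).
Definition Vh := face_space Om (cells D) (kindV E) (ordV E).
Definition Lh := pwL D `&` L20 Om.
Definition Wh := pwW D `&` L20 Om.

Definition divh (u : pt R -> pt R) : pt R -> R := xget (fun=> 0)
  [set d | Sigmah d /\ forall s, Sigmah s -> ip Om d s = - vip Om u (wgrad Om s)].
Definition curlh (v : pt R -> pt R) : pt R -> pt R := xget (fun=> 0)
  [set k | Uh k /\ forall u, Uh u -> vip Om k u = vip Om v (wcurl Om u)].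

Definition Khs := [set v | Sh v /\ forall q, Lh q -> ip Om (wdiv Om v) q = 0].
Definition Khc := [set u | Uh u /\ aeq Om (divh u) (fun=> 0)].
Definition Khd := [set v | Vh v /\ aeq Om (curlh v) (fun=> 0)].
Definition Kc := [set u | H0curl Om u /\ forall w, H0curl Om w ->
  weak_curl Om w (fun=> 0) -> vip Om u w = 0].
Definition Kd := [set v | H0div Om v /\ forall w, H0div Om w ->
  weak_div Om w (fun=> 0) -> vip Om v w = 0].

Definition Phc (u : pt R -> pt R) : pt R -> pt R := xget (fun=> 0)
  [set w | Khc w /\ forall phi, Khc phi ->
     vip Om (wcurl Om w) (wcurl Om phi) = vip Om (wcurl Om u) (wcurl Om phi)].
Definition Phd (v : pt R -> pt R) : pt R -> pt R := xget (fun=> 0)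
  [set w | Khd w /\ forall psi, Khd psi ->
     ip Om (wdiv Om w) (wdiv Om psi) = ip Om (wdiv Om v) (wdiv Om psi)].
Definition Ihd (v : pt R -> pt R) : pt R -> pt R := xget (fun=> 0)
  [set w | exists v1 v2, [/\ Kc v1, Kd v2, aeq Om v (wcurl Om v1 + v2)
                           & w = wcurl Om (Phc v1) + Phd v2]].

(* The interpolation operators are defined on fields that are smooth up to the
   boundary, on which the diagram is required to commute. *)
Definition commuting_diagram :=
  let pig := interp_grad Om (cells D) (degSigma E) in
  let pic := interp_curl Om (cells D) (kindU E) (ordU E) in
  let pid := interp_div Om (cells D) (kindV E) (ordV E) in
  [/\ forall f, smooth f -> H01 Om f -> weak_grad Om (pig f) (pic (cgrad f)),
      forall v, vsmooth v -> H0curl Om v -> weak_curl Om (pic v) (pid (ccurl v))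
    & forall v, vsmooth v -> H0div Om v ->
        weak_div Om (pid v) (l2proj Om Wh (cdiv v))].

Definition assumption_A1 :=
  [/\ exact_seq Om (H01 Om) (H0curl Om) (H0div Om) (L20 Om),
      exact_seq Om Sigmah Uh Vh Wh & commuting_diagram].

Definition inf_sup (c : R) := forall q, Lh q ->
  c * snorm Om q <= sup [set ip Om q (wdiv Om v) / h1norm Om v | v in Sh].

End FESpaces.

(* A family of discretizations indexed by the mesh sizes h in [hs]. *)
Record fe_family (R : realType) (Om : set (pt R)) (l : nat) (E : elements)
    (hs : set R) (D : R -> discretization R) : Prop := FeFamily {
  fam_elements : admissible_elements l E;
  fam_pos : forall h, hs h -> 0 < h;
  fam_mesh : forall h, hs h -> triangulation Om (cells (D h));
  fam_size : forall h, hs h -> mesh_size (cells (D h)) = h;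
  fam_shape_regular : exists2 g : R, 0 < g & forall h K, hs h ->
    K \in cells (D h) -> contains_ball K (g * diam K);
  fam_quasi_uniform : exists2 g : R, 0 < g & forall h K, hs h ->
    K \in cells (D h) -> g * h <= diam K;
  fam_pwL : forall h, hs h -> pw_poly_space Om (cells (D h)) l (pwL (D h));
  fam_pwW : forall h, hs h -> pw_poly_space Om (cells (D h)) l (pwW (D h));
  fam_A1 : forall h, hs h -> assumption_A1 Om E (D h);
  fam_A2 : exists2 c : R, 0 < c & forall h, hs h -> inf_sup Om E (D h) c }.

Section Time.
Variables (R : realType) (T : R).

Definition C0_on (V : zmodType) (nrm : V -> R) (X : set V) (u : R -> V) :=
  (forall t, 0 <= t <= T -> X (u t)) /\
  forall t (e : R), 0 <= t <= T -> 0 < e -> exists2 d : R, 0 < d &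
    forall s, 0 <= s <= T -> `|s - t| < d -> nrm (u s - u t) <= e.

(* u is C^1 on [0, T] with values in X and derivative du (one-sided at 0, T).
   All norms on a finite element space are equivalent; the L^2 norm is used. *)
Definition C1_on (V : lmodType R) (nrm : V -> R) (X : set V) (u du : R -> V) :=
  [/\ C0_on nrm X u, C0_on nrm X du &
  forall t (e : R), 0 <= t <= T -> 0 < e -> exists2 d : R, 0 < d &
    forall s, 0 <= s <= T -> `|s - t| < d ->
      nrm (u s - u t - (s - t) *: du t) <= e * `|s - t|].

Definition test1 (psi : R -> R) :=
  (forall n t, derivable (derive1n n psi) t 1) /\
  exists a b, [/\ 0 < a, b < T & forall t, ~ (a <= t <= b) -> psi t = 0].

Variable Om : set (pt R).

(* L^2(0,T;H(div)); H(div) is separable, so weak measurability suffices. *)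
Definition L2_Hdiv (g : R -> pt R -> pt R) :=
  [/\ forall t, 0 <= t <= T -> Hdiv Om (g t),
      forall w, L2v Om w ->
        measurable_fun `]0, T[%classic (fun t => vip Om (g t) w),
      forall q, L2 Om q ->
        measurable_fun `]0, T[%classic (fun t => ip Om (wdiv Om (g t)) q)
    & (\int[@lebesgue_measure R]_(t in `]0%R, T[)
         ((hdivnorm Om (g t)) ^+ 2)%:E < +oo)%E].

(* H^1(0,T;H(div)): He and its weak time derivative are in L^2(0,T;H(div)); He
   is the representative that is continuous on [0, T] with values in H(div). *)
Definition H1_Hdiv (He : R -> pt R -> pt R) :=
  [/\ L2_Hdiv He, C0_on (hdivnorm Om) (Hdiv Om) He & exists2 g, L2_Hdiv g &
    forall psi w, test1 psi -> L2v Om w ->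
      \int[@lebesgue_measure R]_(t in `]0, T[) (vip Om (He t) w * derive1 psi t) =
      - \int[@lebesgue_measure R]_(t in `]0, T[) (vip Om (g t) w * psi t)].

End Time.

Record sd_state (R : realType) := SdState {
  sd_u : R -> pt R -> pt R;
  sd_p : R -> pt R -> R;
  sd_m : R -> pt R -> pt R;
  sd_z : R -> pt R -> pt R;
  sd_k : R -> pt R -> pt R;
  sd_H : R -> pt R -> pt R;
  sd_phi : R -> pt R -> R }.

Section Schemes.
Variables (R : realType) (Om : set (pt R)) (T : R) (c : constants R).
Variables (He : R -> pt R -> pt R) (u0 m0 : pt R -> pt R).
Variables (E : elements) (D : discretization R).

Local Notation field := (pt R -> pt R).
Local Notation "v *x w" := (fun x => cross (v x) (w x)) (at level 40).

Definition trilin (v m F : field) : R :=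
  2^-1 * ip Om (fun x => dot (v x) (F x)) (wdiv Om m)
  - 2^-1 * ip Om (fun x => dot (v x) (m x)) (wdiv Om F).

Definition initial_u : field := lagrange_interp Om (cells D) (degS E) u0.
Definition initial_m : field := Ihd Om E D m0.

(* The last two equations of the scheme, at time t. *)
Definition magnetostatic (t : R) (m H : field) (phi : pt R -> R) :=
  (forall G, Vh Om E D G -> vip Om H G + ip Om phi (wdiv Om G) = 0) /\
  (forall r, Wh Om D r ->
     ip Om (wdiv Om H + wdiv Om m) r + ip Om (wdiv Om (He t)) r = 0).

Definition sd_solution (X : sd_state R) :=
  let u := sd_u X in let p := sd_p X in let m := sd_m X in
  let z := sd_z X in let k := sd_k X in
  let H := sd_H X in let phi := sd_phi X in
  exists du dm : R -> field,
  [/\ [/\ C1_on T (vnorm Om) (Sh Om E D) u du,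
          C0_on T (snorm Om) (Lh Om D) p,
          C1_on T (vnorm Om) (Vh Om E D) m dm
        & [/\ C0_on T (vnorm Om) (Uh Om E D) z,
              C0_on T (vnorm Om) (Uh Om E D) k,
              C0_on T (vnorm Om) (Vh Om E D) H
            & C0_on T (snorm Om) (Wh Om D) phi]],
      aeq Om (u 0) initial_u, aeq Om (m 0) initial_m
    & forall t, 0 <= t <= T ->
      [/\ (forall v, Sh Om E D v ->
             vip Om (du t) v - vip Om (u t *x wcurl Om (u t)) v
             + eta c * gip Om (u t) v - ip Om (p t) (wdiv Om v)
             - mu0 c * trilin v (H t) (m t)
             - mu0 c / 2 * vip Om (v *x k t) (H t) = 0),
          (forall q, Lh Om D q -> ip Om (wdiv Om (u t)) q = 0),
          (forall F, Vh Om E D F ->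
             vip Om (dm t) F + trilin (u t) (m t) F
             + 2^-1 * vip Om (u t *x F) (k t)
             - 2^-1 * vip Om (wcurl Om (z t)) F
             + sigma c * vip Om (wcurl Om (k t)) F
             + sigma c * ip Om (wdiv Om (m t)) (wdiv Om F)
             + (tau c)^-1 * vip Om (m t) F
             - chi0 c / tau c * vip Om (H t) F
             + beta c * vip Om (m t *x (m t *x H t)) F = 0),
          (forall w, Uh Om E D w ->
             vip Om (z t) w - vip Om (u t *x m t) w = 0)
          /\ (forall w, Uh Om E D w ->
             vip Om (k t) w - vip Om (m t) (wcurl Om w) = 0)
        & magnetostatic t (m t) (H t) (phi t)]].

Definition sd_eq (X Y : sd_state R) := forall t, 0 <= t <= T ->
  [/\ aeq Om (sd_u X t) (sd_u Y t), aeq Om (sd_p X t) (sd_p Y t),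
      aeq Om (sd_m X t) (sd_m Y t), aeq Om (sd_z X t) (sd_z Y t)
    & [/\ aeq Om (sd_k X t) (sd_k Y t), aeq Om (sd_H X t) (sd_H Y t)
        & aeq Om (sd_phi X t) (sd_phi Y t)]].

Definition magnetic (t : R) (m : field) : field * (pt R -> R) :=
  xget (fun=> 0, fun=> 0) [set Hp | [/\ Vh Om E D Hp.1, Wh Om D Hp.2
                                      & magnetostatic t m Hp.1 Hp.2]].

Definition aux_solution (u m : R -> field) :=
  let H t := (magnetic t (m t)).1 in
  let curlm t := curlh Om E D (m t) in
  exists du dm : R -> field,
  [/\ C1_on T (vnorm Om) (Khs Om E D) u du /\
      C1_on T (vnorm Om) (Vh Om E D) m dm,
      aeq Om (u 0) initial_u, aeq Om (m 0) initial_m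
    & forall t, 0 <= t <= T ->
      (forall v, Khs Om E D v ->
         vip Om (du t) v - vip Om (u t *x wcurl Om (u t)) v
         + eta c * gip Om (u t) v
         - mu0 c * trilin v (H t) (m t)
         - mu0 c / 2 * vip Om (v *x curlm t) (H t) = 0) /\
      (forall F, Vh Om E D F ->
         vip Om (dm t) F + trilin (u t) (m t) F
         + 2^-1 * vip Om (u t *x F) (curlm t)
         + (tau c)^-1 * vip Om (m t) F
         - 2^-1 * vip Om (u t *x m t) (curlh Om E D F)
         + sigma c * vip Om (curlm t) (curlh Om E D F)
         + sigma c * ip Om (wdiv Om (m t)) (wdiv Om F)
         - chi0 c / tau c * vip Om (H t) F
         + beta c * vip Om (m t *x (m t *x H t)) F = 0)].

(* The maximum of the four L^infinity norms, at time t. *)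
Definition aux_size (u m : R -> field) (t : R) : \bar R :=
  maxe (maxe (Linfv Om (u t)) (Linfv Om (m t)))
       (maxe (Linfv Om (curlh Om E D (m t))) (Linf Om (wdiv Om (m t)))).

End Schemes.

(* Main.v *)
From HB Require Import structures.
Require Import Defs.
From mathcomp Require Import all_boot all_order all_algebra.
From mathcomp Require Import all_classical all_reals all_analysis.
From mathcomp Require Import measurable_realfun lra.
Set Implicit Arguments. Unset Strict Implicit. Unset Printing Implicit Defensive.
Import Order.TTheory GRing.Theory Num.Theory numFieldNormedType.Exports.
Local Open Scope classical_set_scope.
Local Open Scope ring_scope.

(* In orthonormal bases the scheme is an ordinary differential equation. Testing the
   momentum equation with discretely divergence-free fields eliminates the pressure, which
   is recovered from the inf-sup condition. The fields z, k, H and phi are multilinear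
   functions of u, m and of the data: H comes from a right inverse of the divergence whose
   range is orthogonal to the divergence-free fields. Hence the right-hand side is
   continuous in time and locally Lipschitz, and solutions are unique. They are global:
   tested with m, the magnetization equation loses its trilinear terms and the orthogonality
   of H to H + m + Theta (where div Theta is the projection of div H_e) bounds m; the momentum
   equation tested with u then has a bounded forcing. That the chosen weak derivatives
   are linear up to null sets rests on the fundamental lemma of the calculus of variations. *)

(** * Boxes and measurability in R^3 *)

(** Fields are total functions compared almost everywhere and their weak derivatives are chosen
    representatives, so no space here carries a genuine inner product. Hence everything after the
    measure theory is phrased with semi-definite forms: a functional is also asked to vanish on null
    vectors, and two fields are identified when the form vanishes on their difference. The scheme is
    solved once for abstract forms of this kind. The a priori bound must be found in a fixed order.
    The forcing of u is quadratic in m and the data, whereas the estimate of m contains no u: tested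
    with F = m, the terms (u x m, k) / 2 and (curl z, m) / 2 both equal (z, k) / 2, by the equations
    of z and k, and cancel. So m is bounded first, with linear growth in time, and u afterwards by
    Gronwall. The mesh is fixed, so constants may depend on it. Piecewise polynomials are bounded,
    which makes products of three or four fields integrable, and uniqueness only needs a Lipschitz
    constant on one ball that contains both solutions. *)

Section OpenBoxes.
Variable R : realType.

Definition box (a b : pt R) : set (pt R) :=
  (`]a.1.1, b.1.1[ `*` `]a.1.2, b.1.2[) `*` `]a.2, b.2[.
Definition cbox (a b : pt R) : set (pt R) :=
  (`[a.1.1, b.1.1] `*` `[a.1.2, b.1.2]) `*` `[a.2, b.2].

Definition rat3 (q : rat * rat * rat) : pt R := (ratr q.1.1, ratr q.1.2, ratr q.2).

Lemma measurable_box a b : measurable (box a b).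
Proof. by do 2?apply: measurableX. Qed.

Lemma measurable_cbox a b : measurable (cbox a b).
Proof. by do 2?apply: measurableX. Qed.

Lemma compact_cbox a b : compact (cbox a b).
Proof. by do 2?apply: compact_setX; exact: segment_compact. Qed.

Lemma box_cbox a b : box a b `<=` cbox a b.
Proof.
move=> x [[]] /=; rewrite !in_itv /= => /andP[? ?] /andP[? ?] /andP[? ?].
by split; [split|]; rewrite /= in_itv /= !ltW.
Qed.

Lemma rat_itv (x e : R) : 0 < e ->
  exists p q : rat, [/\ ratr p < x, x < ratr q, x - e < ratr p & ratr q < x + e].
Proof.
move=> e0.
have [p] : exists p : rat, x - e < ratr p < x by apply: rat_in_itvoo; lra.
have [q] : exists q : rat, x < ratr q < x + e by apply: rat_in_itvoo; lra.
by move=> /andP[? ?] /andP[? ?]; exists p, q.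
Qed.

(** Rational corners keep the family of boxes countable. The closed box is kept inside U because it
    will be the compact support of a test function. *)
Lemma open_cover_box (U : set (pt R)) (x : pt R) : open U -> U x ->
  exists p q, box (rat3 p) (rat3 q) x /\ cbox (rat3 p) (rat3 q) `<=` U.
Proof.
move=> oU Ux.
have : nbhs x U by exact: open_nbhs_nbhs.
rewrite -nbhs_ballE => -[e /= e0 he].
have [p1 [q1 [? ? ? ?]]] := rat_itv x.1.1 e0.
have [p2 [q2 [? ? ? ?]]] := rat_itv x.1.2 e0.
have [p3 [q3 [? ? ? ?]]] := rat_itv x.2 e0.
exists (p1, p2, p3), (q1, q2, q3); split.
  by split; [split|]; rewrite /= in_itv /=; apply/andP.
move=> y [[]] /=; rewrite !in_itv /= => /andP[? ?] /andP[? ?] /andP[? ?].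
apply: he; split; [split|]; rewrite /ball /= ltr_distl; lra.
Qed.

(** Measurability on R^3 refers to the product of Borel sigma-algebras, so an open set has to be
    written as a countable union of boxes. *)
Lemma measurable_open3 (U : set (pt R)) : open U -> measurable U.
Proof.
move=> oU.
(* The inclusion is part of the set: [F pq] is a box or empty, and the union can run over all pairs
   of rational corners. *)
pose F (pq : (rat * rat * rat) * (rat * rat * rat)) : set (pt R) :=
  [set x | cbox (rat3 pq.1) (rat3 pq.2) `<=` U /\ box (rat3 pq.1) (rat3 pq.2) x].
have -> : U = \bigcup_pq F pq.
  apply/seteqP; split => [x Ux|x [pq _ [h /box_cbox]]]; last exact: h.
  by have [p [q [? ?]]] := open_cover_box oU Ux; exists (p, q).
apply: countable_bigcupT_measurable => [|pq]; first exact: countableP.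
have [h|h] := pselect (cbox (rat3 pq.1) (rat3 pq.2) `<=` U).
  have -> : F pq = box (rat3 pq.1) (rat3 pq.2).
    by apply/seteqP; split => x; [case|].
  exact: measurable_box.
have -> : F pq = set0 by apply/seteqP; split => x // [].
exact: measurable0.
Qed.

Lemma measurable_continuous3 (f : pt R -> R) (D : set (pt R)) :
  continuous f -> measurable_fun D f.
Proof.
move=> /continuousP cf; apply: (@measurable_funS _ _ _ _ setT) => //.
apply: (measurability _ (measurable_realfun.RGenOpens.measurableE R)) => // _ [_ [a [b ->] <-]].
by rewrite setTI; apply: measurable_open3; apply: cf; exact: interval_open.
Qed.

Lemma mu3_cbox_fin a b : (mu3 R (cbox a b) < +oo)%E.
Proof.
rewrite /mu3 product_measure1E //; last by apply: measurableX.
have h (x y : R) : (lebesgue_measure `[x, y]%classic < +oo)%E.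
  by rewrite lebesgue_measure_itv; case: ifP => _; rewrite ?EFinB ?ltry.
have e := product_measure1E (@lebesgue_measure R) (@lebesgue_measure R)
  (measurable_itv `[a.1.1, b.1.1]) (measurable_itv `[a.1.2, b.1.2]).
rewrite [X in (X * _ < _)%E]e lte_mul_pinfty ?h //.
  exact: mule_ge0.
by rewrite ge0_fin_numE ?mule_ge0 // lte_mul_pinfty ?h // ge0_fin_numE ?h.
Qed.

Lemma enorm_co (x : pt R) (i : 'I_3) : `|co i x| <= enorm x.
Proof.
rewrite -sqrtr_sqr ler_sqrt; last by apply: sumr_ge0 => j _; rewrite -expr2 sqr_ge0.
rewrite /dot (bigD1 i) //= -expr2 lerDl.
by apply: sumr_ge0 => j _; rewrite -expr2 sqr_ge0.
Qed.

Lemma bounded_cbox (r : R) (x : pt R) : enorm x <= r -> cbox (- r, - r, - r) (r, r, r) x.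
Proof.
move=> h.
have h0 := le_trans (enorm_co x 0%R) h.
have h1 := le_trans (enorm_co x 1%R) h.
have h2 := le_trans (enorm_co x 2%:R) h.
by split; [split|]; rewrite /= in_itv /= -ler_norml.
Qed.

End OpenBoxes.

#[global] Instance mu3_ae_filter (R : realType) : Filter (almost_everywhere (mu3 R)).
Proof. exact: ae_filter_ringOfSetsType. Qed.

(** * Square integrable fields *)

Section GenericL2.
Context d (T : measurableType d) (R : realType).
Variables (mu : {measure set T -> \bar R}) (D : set T) (mD : measurable D).
Implicit Types f g : T -> R.

Definition sqr_int f := measurable_fun D f /\
  (\int[mu]_(x in D) (f x ^+ 2)%:E < +oo)%E.

Lemma integrable_sqr f : sqr_int f -> mu.-integrable D (EFin \o (fun x => f x ^+ 2)).
Proof.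
case=> mf fi; apply/integrableP; split.
  by apply/measurable_EFinP; exact: measurable_funX.
rewrite (le_lt_trans _ fi)//; apply: ge0_le_integral => //=.
- by apply/measurable_EFinP; apply: measurableT_comp => //; exact: measurable_funX.
- by apply/measurable_EFinP; exact: measurable_funX.
- by move=> x _; rewrite lee_fin ger0_norm ?sqr_ge0.
Qed.

Lemma integrable_sqrZ f (c : R) : sqr_int f ->
  mu.-integrable D (EFin \o (fun x => c * f x ^+ 2)).
Proof.
move=> /integrable_sqr /(integrableZl mD c).
by apply: eq_integrable => // x _ /=; rewrite EFinM.
Qed.

(** The product is dominated by f^2 + g^2. *)
Lemma integrable_mul f g : sqr_int f -> sqr_int g ->
  mu.-integrable D (EFin \o (fun x => f x * g x)).
Proof.
move=> hf hg.
have := integrableD mD (integrable_sqr hf) (integrable_sqr hg).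
apply: (le_integrable mD).
  by apply/measurable_EFinP; apply: measurable_funM; [case: hf|case: hg].
move=> x _ /=; rewrite lee_fin normrM [leRHS]ger0_norm ?addr_ge0 ?sqr_ge0//.
rewrite -(real_normK (num_real (f x))) -(real_normK (num_real (g x))).
have := normr_ge0 (f x); have := normr_ge0 (g x).
set a := `|f x|; set b := `|g x|; nra.
Qed.

Lemma sqr_int_le f g : measurable_fun D f ->
  mu.-integrable D (EFin \o g) -> {ae mu, forall x, D x -> f x ^+ 2 <= g x} ->
  sqr_int f.
Proof.
move=> mf ig fg; split=> //; move/integrableP: (ig) => [mg].
apply: le_lt_trans; apply: ae_ge0_le_integral => //=.
- by move=> x _; rewrite lee_fin sqr_ge0.
- by apply/measurable_EFinP; exact: measurable_funX.
- by apply/measurable_EFinP; apply: measurableT_comp => //; exact/measurable_EFinP.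
- apply: filterS fg => x h Dx; rewrite lee_fin; exact: le_trans (h Dx) (ler_norm _).
Qed.

Lemma sqr_int_lin a f g : sqr_int f -> sqr_int g -> sqr_int (fun x => a * f x + g x).
Proof.
move=> hf hg.
have [mf _] := hf; have [mg _] := hg.
(* This majorant is (a f + g)^2 + (a f - g)^2. *)
apply: (@sqr_int_le _ (fun x => (2 * a ^+ 2) * f x ^+ 2 + 2 * g x ^+ 2)).
- by apply: measurable_funD => //; apply: measurable_funM.
- have := integrableD mD (integrable_sqrZ (2 * a ^+ 2) hf) (integrable_sqrZ 2 hg).
  exact: eq_integrable.
- apply: aeW => x Dx; set p := f x; set q := g x.
  have := sqr_ge0 (a * p - q); nra.
Qed.

Lemma sqr_int_mul f g (M : R) : measurable_fun D f ->
  {ae mu, forall x, D x -> `|f x| <= M} -> sqr_int g -> sqr_int (fun x => f x * g x).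
Proof.
move=> mf hM hg; have [mg _] := hg.
apply: (@sqr_int_le _ (fun x => M ^+ 2 * g x ^+ 2)).
- exact: measurable_funM.
- exact: integrable_sqrZ.
- apply: filterS hM => x h Ox.
  rewrite exprMn ler_wpM2r ?sqr_ge0// -(real_normK (num_real (f x))).
  by rewrite lerXn2r ?nnegrE ?h// (le_trans _ (h Ox)).
Qed.

Lemma integrable_lin a f g : mu.-integrable D (EFin \o f) -> mu.-integrable D (EFin \o g) ->
  mu.-integrable D (EFin \o (fun x => a * f x + g x)).
Proof. by move=> hf hg; have := integrableD mD (integrableZl mD a hf) hg. Qed.

Lemma Rintegral_lin a f g : mu.-integrable D (EFin \o f) -> mu.-integrable D (EFin \o g) ->
  \int[mu]_(x in D) (a * f x + g x) =
  a * (\int[mu]_(x in D) f x) + \int[mu]_(x in D) g x.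
Proof.
move=> hf hg; rewrite -RintegralZl// -RintegralD//.
have := integrableZl mD a hf.
by apply: eq_integrable => // x _ /=; rewrite EFinM.
Qed.

Lemma Rintegral_ae f g : measurable_fun D f -> measurable_fun D g ->
  {ae mu, forall x, D x -> f x = g x} ->
  \int[mu]_(x in D) f x = \int[mu]_(x in D) g x.
Proof.
move=> mf mg fg; rewrite /Rintegral; congr fine.
apply: ae_eq_integral => //; [exact/measurable_EFinP..|].
by apply: filterS fg => x h /h /= ->.
Qed.

Lemma Rintegral_sqr_eq0 f : sqr_int f -> \int[mu]_(x in D) (f x * f x) = 0 ->
  {ae mu, forall x, D x -> f x = 0}.
Proof.
move=> hf h0; have [mf _] := hf.
(* The real integral is [fine] of an extended one, and [fine] sends infinity to 0; finiteness must
   come in before the hypothesis can be used. *)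
have hi : (\int[mu]_(x in D) (f x ^+ 2)%:E)%E = 0%E.
  rewrite -[LHS]fineK; last by apply: integrable_fin_num => //; exact: integrable_sqr.
  by rewrite -[RHS]/(0%:E) -h0 /Rintegral; congr (fine _)%:E.
have m2 : measurable_fun D (EFin \o (fun x => f x ^+ 2)).
  by apply/measurable_EFinP; apply: measurable_funX.
have : (\int[mu]_(x in D) `|(f x ^+ 2)%:E| = 0)%E.
  rewrite -hi; apply: eq_integral => x _ /=.
  by rewrite ger0_norm ?sqr_ge0.
move=> /(ae_eq_integral_abs mu mD m2); apply: filterS => x /= h Ox.
by have /eqP := h Ox; rewrite eqe sqrf_eq0 => /eqP.
Qed.

End GenericL2.

Section LTwo.
Variables (R : realType) (Om : set (pt R)).
Hypothesis mOm : measurable Om.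
Implicit Types (f g h : pt R -> R) (v w : pt R -> pt R).

Lemma aeq_refl (V : Type) (f : pt R -> V) : aeq Om f f.
Proof. exact: aeW. Qed.

Lemma aeq_trans (V : Type) (f g h : pt R -> V) :
  aeq Om f g -> aeq Om g h -> aeq Om f h.
Proof. by apply: filterS2 => x h1 h2 Ox; rewrite h1// h2. Qed.

Lemma aeq_map (V W : Type) (F : V -> W) (f g : pt R -> V) :
  aeq Om f g -> aeq Om (fun x => F (f x)) (fun x => F (g x)).
Proof. by apply: filterS => x h Ox; rewrite h. Qed.

Lemma aeq_map2 (V W X : Type) (F : V -> W -> X) (f g : pt R -> V) (f' g' : pt R -> W) :
  aeq Om f g -> aeq Om f' g' ->
  aeq Om (fun x => F (f x) (f' x)) (fun x => F (g x) (g' x)).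
Proof. by apply: filterS2 => x h h' Ox; rewrite h// h'. Qed.

Lemma L2_meas f : L2 Om f -> measurable_fun Om f. Proof. by case. Qed.

Lemma L2_mul_int f g : L2 Om f -> L2 Om g ->
  (mu3 R).-integrable Om (EFin \o (fun x => f x * g x)).
Proof. exact: (@integrable_mul _ _ _ (mu3 R)). Qed.

Lemma L2_lin a f g : L2 Om f -> L2 Om g -> L2 Om (a *: f + g).
Proof. exact: (@sqr_int_lin _ _ _ (mu3 R)). Qed.

Lemma ip_sym f g : ip Om f g = ip Om g f.
Proof. by rewrite /ip; apply: eq_Rintegral => x _; rewrite mulrC. Qed.

Lemma ip_ge0 f : 0 <= ip Om f f.
Proof. by apply: Rintegral_ge0 => x _; rewrite -expr2 sqr_ge0. Qed.

Lemma ip_lin a f g h : L2 Om f -> L2 Om g -> L2 Om h ->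
  ip Om (a *: f + g) h = a * ip Om f h + ip Om g h.
Proof.
move=> hf hg hh; rewrite /ip -Rintegral_lin//; try exact: L2_mul_int.
by apply: eq_Rintegral => x _; rewrite [(a *: f + g) x]/(a * f x + g x) mulrDl mulrA.
Qed.

Lemma Rintegral_aeq f g : measurable_fun Om f -> measurable_fun Om g ->
  aeq Om f g -> \int[mu3 R]_(x in Om) f x = \int[mu3 R]_(x in Om) g x.
Proof. exact: (@Rintegral_ae _ _ _ (mu3 R)). Qed.

Lemma ip_aeq f g f' g' : L2 Om f -> L2 Om g -> L2 Om f' -> L2 Om g' ->
  aeq Om f f' -> aeq Om g g' -> ip Om f g = ip Om f' g'.
Proof.
move=> hf hg hf' hg' e1 e2; apply: Rintegral_aeq;
  [by apply: measurable_funM; exact: L2_meas..|exact: aeq_map2].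
Qed.

Lemma ip_eq0 f : L2 Om f -> ip Om f f = 0 -> aeq Om f (fun=> 0).
Proof. exact: (@Rintegral_sqr_eq0 _ _ _ (mu3 R)). Qed.

(** Essential boundedness on [Om]. A product of two L^2 functions is only integrable, so in the
    trilinear and quadrilinear forms every factor beyond two has to be bounded. *)
Definition bnd f := measurable_fun Om f /\
  exists M : R, {ae mu3 R, forall x, Om x -> `|f x| <= M}.

Lemma bnd_mul_L2 f g : bnd f -> L2 Om g -> L2 Om (fun x => f x * g x).
Proof.
move=> [mf [M hM]] hg; exact: (@sqr_int_mul _ _ _ (mu3 R) _ mOm _ _ _ mf hM).
Qed.

Hypothesis fOm : (mu3 R Om < +oo)%E.

Lemma L2_cst (c : R) : L2 Om (fun=> c).
Proof.
split => //; rewrite integral_cst//; rewrite lte_mul_pinfty ?lee_fin ?sqr_ge0//.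
Qed.

Lemma bnd_L2 f : bnd f -> L2 Om f.
Proof.
move=> bf; have := bnd_mul_L2 bf (L2_cst 1).
by congr L2; apply/funext => x; rewrite mulr1.
Qed.

Lemma vip_sum v w : L2v Om v -> L2v Om w ->
  vip Om v w = \sum_(i < 3) ip Om (co i \o v) (co i \o w).
Proof.
move=> hv hw; rewrite !big_ord_recr big_ord0 /= add0r /ip /vip.
have I i := L2_mul_int (hv i) (hw i).
have e (x : pt R) : dot (v x) (w x) = 1 * (co 0 (v x) * co 0 (w x)) +
    (1 * (co 1 (v x) * co 1 (w x)) + co 2 (v x) * co 2 (w x)).
  by rewrite /dot !big_ord_recr big_ord0 /= add0r !mul1r addrA.
under eq_Rintegral do rewrite e.
have J : (mu3 R).-integrable Om (EFin \o (fun x : pt R =>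
    1 * (co 1 (v x) * co 1 (w x)) + co 2 (v x) * co 2 (w x))).
  exact: (@integrable_lin _ _ _ (mu3 R) _ mOm 1 _ _ (I 1) (I 2%:R)).
rewrite (@Rintegral_lin _ _ _ (mu3 R) _ mOm 1 _ _ (I 0) J).
rewrite (@Rintegral_lin _ _ _ (mu3 R) _ mOm 1 _ _ (I 1) (I 2%:R)).
by rewrite !mul1r addrA.
Qed.

Lemma co_lin i (a : R) (x y : pt R) : co i (a *: x + y) = a * co i x + co i y.
Proof. by case: i => [|[|[|i]]] //; rewrite /co /= !nth_default// mulr0 addr0. Qed.

Lemma co_comp_lin i (a : R) v w : co i \o (a *: v + w) = a *: (co i \o v) + (co i \o w).
Proof. by apply/funext => x; exact: co_lin. Qed.

Lemma co_inj (x y : pt R) : (forall i : 'I_3, co i x = co i y) -> x = y.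
Proof.
move=> h; case: x y h => [[x1 x2] x3] [[y1 y2] y3] h.
by have := h 0; have := h 1; have := h 2%:R; rewrite /co /= => -> -> ->.
Qed.

Lemma L2v_lin a v w : L2v Om v -> L2v Om w -> L2v Om (a *: v + w).
Proof. by move=> hv hw i; rewrite co_comp_lin; apply: L2_lin; [exact: hv|exact: hw]. Qed.

Lemma dotC (x y : pt R) : dot x y = dot y x.
Proof. by apply: eq_bigr => i _; rewrite mulrC. Qed.

Lemma vip_sym v w : vip Om v w = vip Om w v.
Proof. by rewrite /vip; apply: eq_Rintegral => x _; rewrite dotC. Qed.

Lemma vip_ge0 v : 0 <= vip Om v v.
Proof.
by apply: Rintegral_ge0 => x _; apply: sumr_ge0 => i _; rewrite -expr2 sqr_ge0.
Qed.

Lemma vip_lin a u v w : L2v Om u -> L2v Om v -> L2v Om w ->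
  vip Om (a *: u + v) w = a * vip Om u w + vip Om v w.
Proof.
move=> hu hv hw; rewrite !vip_sum//; last exact: L2v_lin.
rewrite mulr_sumr -big_split; apply: eq_bigr => i _ /=.
by rewrite co_comp_lin ip_lin.
Qed.

Lemma vip_aeq u v u' v' : L2v Om u -> L2v Om v -> L2v Om u' -> L2v Om v' ->
  aeq Om u u' -> aeq Om v v' -> vip Om u v = vip Om u' v'.
Proof.
move=> hu hv hu' hv' e1 e2; rewrite !vip_sum//; apply: eq_bigr => i _.
by apply: ip_aeq => //; apply: (@aeq_map _ _ (co i)).
Qed.

Lemma aeq_co v w : (forall i : 'I_3, aeq Om (co i \o v) (co i \o w)) -> aeq Om v w.
Proof.
move=> h; apply: filterS3 (h 0) (h 1) (h 2%:R) => x h0 h1 h2 Ox.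
apply: co_inj => i; rewrite -[LHS]/((co i \o v) x) -[RHS]/((co i \o w) x).
by case: i => [[|[|[|//]]]] hi; [move: (h0 Ox)|move: (h1 Ox)|move: (h2 Ox)].
Qed.

Lemma vip_eq0 v : L2v Om v -> vip Om v v = 0 -> aeq Om v (fun=> 0).
Proof.
move=> hv; rewrite vip_sum// => /eqP.
rewrite psumr_eq0; last by move=> i _; exact: ip_ge0.
move=> /allP h; apply: aeq_co => i.
have /eqP /(ip_eq0 (hv i)) := implyP (h i (mem_index_enum i)) isT.
by apply: filterS => x h' /h' -> /=; case: i {h h'} => [[|[|[|]]]].
Qed.

Definition vbnd v := forall i : 'I_3, bnd (co i \o v).

Lemma vbnd_L2v v : vbnd v -> L2v Om v.
Proof. by move=> h i; exact: bnd_L2. Qed.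

Lemma L2_sub f g : L2 Om f -> L2 Om g -> L2 Om (fun x => f x - g x).
Proof.
move=> bf bg; have := L2_lin (-1) bg bf; congr L2.
by apply/funext => x; rewrite addrC; congr (_ + _); exact: mulN1r.
Qed.

Lemma L2_add f g : L2 Om f -> L2 Om g -> L2 Om (fun x => f x + g x).
Proof.
move=> bf bg; have := L2_lin 1 bf bg; congr L2.
by apply/funext => x; congr (_ + _); exact: mul1r.
Qed.

Lemma L2v_cross v w : vbnd v -> L2v Om w -> L2v Om (fun x => cross (v x) (w x)).
Proof.
move=> hv hw; case=> [[|[|[|//]]]] ? /=; apply: L2_sub; apply: bnd_mul_L2;
 [exact: (hv 1)|exact: (hw 2%:R)|exact: (hv 2%:R)|exact: (hw 1)
 |exact: (hv 2%:R)|exact: (hw 0)|exact: (hv 0)|exact: (hw 2%:R)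
 |exact: (hv 0)|exact: (hw 1)|exact: (hv 1)|exact: (hw 0)].
Qed.

Lemma L2_dot v w : vbnd v -> L2v Om w -> L2 Om (fun x => dot (v x) (w x)).
Proof.
move=> hv hw; rewrite (_ : (fun x => _) = fun x => co 0 (v x) * co 0 (w x)
   + co 1 (v x) * co 1 (w x) + co 2 (v x) * co 2 (w x)); last first.
  by apply/funext => x; rewrite /dot !big_ord_recr big_ord0 /= add0r.
apply: L2_add; first apply: L2_add; apply: bnd_mul_L2;
 [exact: (hv 0)|exact: (hw 0)|exact: (hv 1)|exact: (hw 1)
 |exact: (hv 2%:R)|exact: (hw 2%:R)].
Qed.

End LTwo.

(** * Smooth bump functions *)

Section RealDerivative.
Variable R : realType.
Implicit Types (f g : R -> R) (x l : R).

(** Multiplying out the difference quotient admits y = x and gives the shape of the last clause of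
    [C1_on]. *)
Lemma is_derive_epsP f x l : is_derive x 1 f l <->
  forall e : R, 0 < e -> exists2 d : R, 0 < d &
    forall y, `|y - x| < d -> `|f y - f x - (y - x) * l| <= e * `|y - x|.
Proof.
split=> [[dv dl] e e0|H].
  have : (fun h => h^-1 *: ((f \o shift x) (h *: (1 : R)) - f x)) @ 0^' --> l.
    by rewrite -dl; exact: dv.
  move=> /cvgrPdist_le /(_ _ e0) [d /= d0 hd]; exists d => // y yx.
  have [->|yx0] := eqVneq y x; first by rewrite !subrr mul0r subrr normr0 mulr0.
  have /= := hd (y - x); rewrite sub0r normrN subr_eq0 => /(_ yx yx0).
  rewrite [(y - x) *: 1]mulr1 subrK => h.
  have yx1 : y - x != 0 by rewrite subr_eq0.
  have key (F z : R) : z != 0 -> F - z * l = - ((l - z^-1 * F) * z).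
    by move=> z0; rewrite mulrBl mulrAC mulVf// mul1r opprB mulrC.
  rewrite key//.
  by rewrite normrN normrM ler_wpM2r.
have cv : (fun h => h^-1 *: ((f \o shift x) (h *: (1 : R)) - f x)) @ 0^' --> l.
  apply/cvgrPdist_le => e e0; have [d d0 hd] := H e e0.
  exists d => //= h; rewrite /ball_ /= sub0r normrN => hd' h0.
  have := hd (h + x); rewrite addrK => /(_ hd').
  rewrite [h *: 1]mulr1 => h1.
  rewrite -(ler_pM2l (_ : 0 < `|h|)) ?normr_gt0// (mulrC _ e) (le_trans _ h1)//.
  by rewrite -normrM mulrBr mulrA divff// mul1r distrC.
split; first by apply/cvg_ex; exists l.
exact: cvg_lim cv.
Qed.

End RealDerivative.

Section FlatFunction.
Variable R : realType.

(* flat k x = x^-k exp(-1/x) for x > 0 and 0 otherwise: every derivative is a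
   combination of functions of the same family. *)
Definition flat (k : nat) (x : R) : R :=
  if 0 < x then x ^- k * expR (- x^-1) else 0.

Lemma flat_ge0 k x : 0 <= flat k x.
Proof.
by rewrite /flat; case: ifP => // x0; rewrite mulr_ge0 ?expR_ge0// invr_ge0 exprn_ge0// ltW.
Qed.

(** From exp y >= y^(k+2) / (k+2)! at y = 1/x. The quadratic bound makes the derivative at 0 exist
    and vanish. *)
Lemma flat_le k (x : R) : 0 < x -> flat k x <= (k.+2)`!%:R * x ^+ 2.
Proof.
move=> x0; rewrite /flat x0.
have y0 : 0 < x^-1 by rewrite invr_gt0.
have := expR_ge1Dxn k.+1 (ltW y0).
move=> h; have : x^-1 ^+ k.+2 / (k.+2)`!%:R <= expR x^-1 by rewrite (le_trans _ h)// lerDr.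
rewrite ler_pdivrMr ?ltr0n ?fact_gt0// => h2.
rewrite expRN ler_pdivrMr ?expR_gt0// -exprVn.
rewrite -(ler_pM2l (exprn_gt0 2 y0)) -exprD add2n (le_trans h2)//.
have xE : x^-1 ^+ 2 * x ^+ 2 = 1 by rewrite -exprMn mulVf ?expr1n// gt_eqF.
set C := _%:R; set E := expR _.
have -> : x^-1 ^+ 2 * (C * x ^+ 2 * E) = E * C * (x^-1 ^+ 2 * x ^+ 2).
  by set a := x^-1 ^+ 2; set b := x ^+ 2; lra.
by rewrite xE mulr1.
Qed.

Lemma is_derive_flat (k : nat) (x : R) :
  is_derive x 1 (flat k) (- k%:R * flat k.+1 x + flat k.+2 x).
Proof.
have [x0|x0|->] := ltgtP x 0.
- have -> : - k%:R * flat k.+1 x + flat k.+2 x = 0.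
    by rewrite /flat !ltNge (ltW x0) /= mulr0 addr0.
  have H := @is_derive_cst R R R 0 x 1.
  apply: near_eq_is_derive H.
  near=> y; rewrite /flat; case: ifP => // /lt_trans y0.
  have : y < 0 by near: y; exact: lt_nbhsl.
  by move=> /y0; rewrite ltxx.
- have xn0 : x != 0 by rewrite gt_eqF.
  have H1 : is_derive x 1 (fun y : R => y^-1) (- x ^- 2 *: 1).
    by apply: (@is_deriveV _ id) => //.
  have H2 := @is_deriveX _ _ _ k x 1 _ H1.
  have H3 := @is_derive1_comp _ expR _ x _ _ (is_derive_expR _) (is_deriveN H1).
  have H4 := is_deriveM H2 H3.
  apply: (@is_derive_eq _ _ _ _ _ _ _ _ (near_eq_is_derive _ H4)).
    near=> y; rewrite /flat; have -> : 0 < y by near: y; exact: lt_nbhsr.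
    by rewrite !fctE exprVn.
  rewrite /flat x0 !fctE /GRing.scale /= !mulr1 !opprK.
  set E := expR _; rewrite -!exprVn; set y := x^-1.
  case: k {H2 H4} => [|k]; first by rewrite !expr0 !mul0r; lra.
  rewrite -pred_Sn !exprS; lra.
- apply/is_derive_epsP => e e0.
  pose C : R := (k.+2)`!%:R; have C0 : 0 < C by rewrite ltr0n fact_gt0.
  exists (e / C); first exact: divr_gt0.
  move=> y; rewrite /flat ltxx !subr0 mulr0 addr0 mulr0 subr0 -/(flat k y) => yd.
  have [y0|y0] := leP y 0.
    by rewrite /flat ltNge y0 /= normr0 mulr_ge0// ltW.
  rewrite (ger0_norm (flat_ge0 _ _)) (le_trans (flat_le k y0))//.
  rewrite -/C gtr0_norm// expr2 mulrA ler_pM2r//.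
  by move: yd; rewrite ltr_pdivlMr// gtr0_norm// mulrC => /ltW.
Unshelve. all: by end_near. Qed.

End FlatFunction.

Section SmoothBump.
Variable R : realType.

(** This algebra contains its own partial derivatives ([flatalg_diff]), so differentiability of its
    members already gives smoothness of all orders. Generators are affine in one coordinate to allow
    the scaling and reflection of [bump1]. *)
Inductive flatalg : (pt R -> R) -> Prop :=
| flatalg_base k (i : 'I_3) c d : flatalg (fun x => flat k (c * co i x + d))
| flatalg_cst c : flatalg (fun=> c)
| flatalg_add f g : flatalg f -> flatalg g -> flatalg (fun x => f x + g x)
| flatalg_mul f g : flatalg f -> flatalg g -> flatalg (fun x => f x * g x).

Lemma continuous_co (i : nat) : continuous (@co R i).
Proof.
move: i => [|[|[|i]]] x; rewrite /co /=.
- apply: (@continuous_comp _ _ _ (fun x : pt R => x.1) (fun y : R * R => y.1)); exact: cvg_fst.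
- apply: (@continuous_comp _ _ _ (fun x : pt R => x.1) (fun y : R * R => y.2));
    [exact: cvg_fst|exact: cvg_snd].
- exact: cvg_snd.
- by rewrite nth_nil; exact: cvg_cst.
Qed.

Lemma is_diff_co (i : nat) (x : pt R) :
  differentiable (@co R i) x /\ forall v, 'D_v (@co R i) x = co i v.
Proof.
pose f0 (x : pt R) : R := co i x.
have lf : linear f0 by move=> a u v; rewrite /f0 co_lin.
pose lf' := GRing.isLinear.Build _ _ _ _ f0 lf.
pose f : {linear pt R -> R} := HB.pack f0 lf'.
have df := @linear_differentiable _ _ _ f x (@continuous_co i).
split; first exact: df.
by move=> v; rewrite deriveE// (@diff_lin _ _ _ f x (@continuous_co i)).
Qed.

Lemma flatalg_diff f : flatalg f ->
  (forall x, differentiable f x) /\ forall j : 'I_3, flatalg (pd j f).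
Proof.
elim=> [k i c d|c|{}f g _ [df pf] _ [dg pg]|{}f g ff [df pf] fg [dg pg]].
- pose h (y : R) := flat k (c * y + d).
  have dh (y : R) : is_derive y 1 h
      ((- k%:R * flat k.+1 (c * y + d) + flat k.+2 (c * y + d)) * c).
    apply: is_derive1_comp; first exact: is_derive_flat.
    have := is_deriveD (@is_deriveZ _ _ _ id c y 1 _ (is_derive_id y 1)) (is_derive_cst d y 1).
    by move=> H; apply: is_derive_eq H _; rewrite addr0 /GRing.scale /= mulr1.
  have dh' (y : R) : differentiable h y by apply/derivable1_diffP; case: (dh y).
  have dc x := (is_diff_co i x).1.
  split=> [x|j].
    by apply: (@differentiable_comp _ _ _ _ (@co R i) h).
  have -> : pd j (fun x => flat k (c * co i x + d)) =
    fun x => (- k%:R * c * co i (ev R j)) * flat k.+1 (c * co i x + d)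
           + (c * co i (ev R j)) * flat k.+2 (c * co i x + d).
    apply/funext => x; rewrite /pd deriveE; last exact: (@differentiable_comp _ _ _ _ (@co R i) h).
    rewrite (@diff_comp _ _ _ _ (@co R i) h)//= diff1E// derive1E.
    rewrite -deriveE// (is_diff_co i x).2 (@derive_val _ _ _ _ _ _ _ (dh _)) /GRing.scale /=.
    lra.
  by apply: flatalg_add; apply: flatalg_mul; constructor.
- split=> [x|j]; first exact: differentiable_cst.
  by rewrite (_ : pd _ _ = fun=> 0); [constructor|apply/funext => x; rewrite /pd derive_cst].
- split=> [x|j]; first exact: differentiableD.
  rewrite (_ : pd _ _ = fun x => pd j f x + pd j g x); first exact: flatalg_add.
  by apply/funext => x; rewrite /pd deriveD//; exact: diff_derivable.
- split=> [x|j]; first exact: differentiableM.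
  rewrite (_ : pd _ _ = fun x => f x * pd j g x + g x * pd j f x).
    by apply: flatalg_add; apply: flatalg_mul.
  by apply/funext => x; rewrite /pd deriveM//; exact: diff_derivable.
Qed.

Lemma flatalg_smooth f : flatalg f -> smooth f.
Proof.
move=> hf s; suff : flatalg (foldr (fun i : 'I_3 => pd i) f s).
  by move=> /flatalg_diff [].
by elim: s => //= i s /flatalg_diff [_]; apply.
Qed.

End SmoothBump.

Section SmoothFunctions.
Variables (R : realType) (Om : set (pt R)).
Implicit Types f : pt R -> R.

Lemma smooth_continuous f : smooth f -> continuous f.
Proof. by move=> hf x; apply: differentiable_continuous; exact: (hf [::]). Qed.

Lemma smooth_pd f (i : 'I_3) : smooth f -> smooth (pd i f).
Proof. by move=> hf s x; have := hf (rcons s i) x; rewrite foldr_rcons. Qed.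

Lemma smooth_bnd f : (exists r : R, forall x, Om x -> enorm x <= r) ->
  smooth f -> bnd Om f.
Proof.
move=> [r hr] /smooth_continuous cf; split; first exact: measurable_continuous3.
have /compact_bounded [M [_ hM]] : compact (f @` cbox (- r, - r, - r) (r, r, r)).
  by apply: continuous_compact; [exact: continuous_subspaceT|exact: compact_cbox].
exists (`|M| + 1); apply: aeW => x /hr /bounded_cbox bx.
by apply: (hM (`|M| + 1)); [rewrite (le_lt_trans (ler_norm _))// ltrDl|exists x].
Qed.

End SmoothFunctions.

Section BoxBump.
Variable R : realType.
Implicit Types a b x : pt R.

(** Equal to exp(-1/((n+1)(y-s))) exp(-1/((n+1)(t-y))) on ]s, t[ and to 0 elsewhere: values in
    [0, 1], converging pointwise to the indicator of the open interval. *)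
Definition bump1 (n : nat) (s t y : R) : R :=
  flat 0 (n.+1%:R * y + - (n.+1%:R * s)) * flat 0 (- n.+1%:R * y + n.+1%:R * t).

Definition bump n a b x : R :=
  (bump1 n (co 0 a) (co 0 b) (co 0 x) * bump1 n (co 1 a) (co 1 b) (co 1 x))
  * bump1 n (co 2 a) (co 2 b) (co 2 x).

Lemma bump_smooth n a b : smooth (bump n a b).
Proof.
apply: flatalg_smooth; rewrite /bump /bump1.
have B (i : 'I_3) (s t : R) : flatalg (fun x : pt R =>
    flat 0 (n.+1%:R * co i x + - (n.+1%:R * s)) * flat 0 (- n.+1%:R * co i x + n.+1%:R * t)).
  by apply: flatalg_mul; apply: flatalg_base.
apply: flatalg_mul; last exact: (B 2%:R).
by apply: flatalg_mul; [exact: (B 0)|exact: (B 1)].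
Qed.

Lemma flat0_le1 (y : R) : flat 0 y <= 1.
Proof.
rewrite /flat; case: ifP => // y0.
by rewrite expr0 invr1 mul1r expR_le1 oppr_le0 invr_ge0 ltW.
Qed.

Lemma flat0_le0 k (y : R) : y <= 0 -> flat k y = 0.
Proof. by move=> y0; rewrite /flat ltNge y0. Qed.

Lemma flat0_cvg (y : R) : 0 < y -> flat 0 (n.+1%:R * y) @[n --> \oo] --> (1 : R).
Proof.
move=> y0; suff : flat 0 (n.+1%:R * y) @[n --> \oo] --> expR (- (0 : R)) by rewrite oppr0 expR0.
rewrite (_ : (fun n => _) = fun n : nat => expR (- (harmonic n * y^-1))).
  apply: continuous_cvg; first exact: continuous_expR.
  apply: cvgN; rewrite -(mul0r y^-1); apply: cvgMl => //.
  exact: cvg_harmonic.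
by apply/funext => n; rewrite /flat mulr_gt0// expr0 invr1 mul1r invfM.
Qed.

Lemma bump1_ge0 n s t y : 0 <= bump1 n s t y.
Proof. by rewrite mulr_ge0// flat_ge0. Qed.

Lemma bump1_le1 n s t y : bump1 n s t y <= 1.
Proof. by rewrite mulr_ile1// ?flat_ge0// flat0_le1. Qed.

Lemma bump1_out n s t y : ~ (s < y < t) -> bump1 n s t y = 0.
Proof.
move=> h; rewrite /bump1; have [sy|ys] := ltP s y.
  have ty : t <= y by rewrite leNgt; apply/negP => yt; apply: h; rewrite sy.
  rewrite [X in _ * X]flat0_le0 ?mulr0// mulNr addrC subr_le0 ler_wpM2l//.
by rewrite flat0_le0 ?mul0r// subr_le0 ler_wpM2l.
Qed.

Lemma bump1_cvg s t y : s < y < t -> bump1 n s t y @[n --> \oo] --> (1 : R).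
Proof.
move=> /andP[sy yt]; have -> : (1 : R) = 1 * 1 by rewrite mulr1.
have H1 : 0 < y - s by rewrite subr_gt0.
have H2 : 0 < t - y by rewrite subr_gt0.
rewrite (_ : (fun n => _) = (fun n : nat => flat 0 (n.+1%:R * (y - s))) \*
    (fun n : nat => flat 0 (n.+1%:R * (t - y)))).
  by apply: cvgM; exact: flat0_cvg.
apply/funext => n; rewrite /bump1 /= !mulrBr; congr (_ * flat 0 _).
by rewrite addrC mulNr.
Qed.

Lemma boxP a b x : box a b x <-> [/\ co 0 a < co 0 x < co 0 b,
  co 1 a < co 1 x < co 1 b & co 2 a < co 2 x < co 2 b].
Proof.
split=> [[[]] | []] /=; first by rewrite !in_itv.
by move=> h0 h1 h2; split; [split|]; rewrite /= in_itv.
Qed.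

Lemma bump_ge0 n a b x : 0 <= bump n a b x.
Proof. by apply: mulr_ge0; [apply: mulr_ge0|]; exact: bump1_ge0. Qed.

Lemma bump_le1 n a b x : bump n a b x <= 1.
Proof.
apply: mulr_ile1; [apply: mulr_ge0| |apply: mulr_ile1|];
  by [exact: bump1_ge0|exact: bump1_le1].
Qed.

Lemma bump_out n a b x : ~ box a b x -> bump n a b x = 0.
Proof.
move=> /boxP hx; rewrite /bump.
have [h0|/negP h0] := boolP (co 0 a < co 0 x < co 0 b); last by rewrite bump1_out// !mul0r.
have [h1|/negP h1] := boolP (co 1 a < co 1 x < co 1 b); last first.
  by rewrite [X in _ * X * _]bump1_out// mulr0 mul0r.
have [h2|/negP h2] := boolP (co 2 a < co 2 x < co 2 b); last first.
  by rewrite [X in _ * X]bump1_out// mulr0.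
by exfalso; apply: hx.
Qed.

Lemma bump_cvg a b x : bump n a b x @[n --> \oo] --> (\1_(box a b) x : R).
Proof.
rewrite indicE; have [hb|hx] := pselect (box a b x).
  rewrite mem_set//; move/boxP: hb => [h0 h1 h2].
  have -> : true%:R = (1 : R) * 1 * 1 by rewrite !mulr1.
  by apply: cvgM; [apply: cvgM|]; exact: bump1_cvg.
rewrite memNset// (_ : (fun n => _) = fun=> 0); first exact: cvg_cst.
by apply/funext => n; rewrite bump_out.
Qed.

Lemma bump_test (Om : set (pt R)) n a b : cbox a b `<=` Om -> test Om (bump n a b).
Proof.
move=> h; split; first exact: bump_smooth.
exists (cbox a b); split => //; first exact: compact_cbox.
by move=> x hx; apply: bump_out => /box_cbox.
Qed.

End BoxBump.

(** * Dynkin systems and the fundamental lemma of the calculus of variations *)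

Section DynkinIntegral.
Context d d' (T : measurableType d) (T' : measurableType d') (R : realType).
Variables (mu : {measure set T -> \bar R}) (E : set T) (f : T -> \bar R).
Variables (p : T -> T') (G : set (set T')).
Hypotheses (mE : measurable E) (fi : mu.-integrable E f).
Hypothesis mp : measurable_fun setT p.
Hypotheses (GE : @measurable _ T' = <<s G >>) (GI : setI_closed G).
Local Open Scope ereal_scope.

(** The sets A with vanishing integral over their preimage form a Dynkin system: the integral over
    all of E settles complements, integrability settles disjoint unions. The map p allows one
    coordinate to be treated at a time. *)
Lemma dynkin_integral_eq0 : \int[mu]_(x in E) f x = 0 ->
  (forall A, G A -> \int[mu]_(x in E `&` p @^-1` A) f x = 0) ->
  forall A, measurable A -> \int[mu]_(x in E `&` p @^-1` A) f x = 0.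
Proof.
move=> E0 G0 A; rewrite GE; move: A.
have mI (A : set T') : measurable A -> measurable (E `&` p @^-1` A).
  by move=> mA; apply: measurableI => //; rewrite -[_ @^-1` _]setTI; exact: mp.
apply: (dynkin_induction GE GI).
- by rewrite preimage_setT setIT.
- exact: G0.
- move=> S mS S0.
  have mf : measurable_fun E f by apply: measurable_int fi.
  have := @integral_setU _ _ _ mu (E `&` p @^-1` S) (E `&` p @^-1` (~` S)) f (mI _ mS)
     (mI _ (measurableC mS)).
  rewrite -setIUr -preimage_setU setUCr preimage_setT setIT => /(_ mf).
  rewrite E0 S0 add0r => <-//.
  by apply/disj_setPS => x /= [[_ ?] [_]].
- move=> F mF tF F0; rewrite preimage_bigcup setI_bigcupr.
  rewrite integral_bigcup//.
  + by rewrite eseries0// => i _ _; exact: F0.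
  + apply/trivIsetP => i j _ _ ij.
    have /trivIsetP /(_ i j I I ij) Fij := tF.
    by rewrite setIACA setIid -preimage_setI Fij preimage_set0 setI0.
  + by move=> k; exact: mI.
  + apply: (integrableS mE _ _ fi); last by move=> x [i _ []].
    by apply: bigcup_measurable => k _; exact: mI.
Qed.

End DynkinIntegral.

Section FundamentalLemma.
Variables (R : realType) (Om : set (pt R)).
Hypothesis oOm : open Om.
Hypothesis bOm : exists r : R, forall x, Om x -> enorm x <= r.
Implicit Types (a b : pt R) (g : pt R -> R).

Lemma mOm : measurable Om.
Proof. exact: measurable_open3. Qed.

Lemma fOm : (mu3 R Om < +oo)%E.
Proof.
have [r hr] := bOm.
apply: le_lt_trans (mu3_cbox_fin (- r, - r, - r) (r, r, r)).
apply: le_measure; rewrite ?inE; [exact: mOm|exact: measurable_cbox|].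
by move=> x /hr; exact: bounded_cbox.
Qed.

Lemma L2_int g : L2 Om g -> (mu3 R).-integrable Om (EFin \o g).
Proof.
move=> hg; have := L2_mul_int mOm hg (L2_cst mOm fOm 1).
by congr (_.-integrable _ _); apply/funext => x /=; rewrite mulr1.
Qed.

Variable g : pt R -> R.
Hypothesis Lg : L2 Om g.
Hypothesis g0 : forall phi, test Om phi -> ip Om g phi = 0.

(** Dominated convergence along the bumps of the box, which are test functions since the closed box
    lies in [Om]. The majorant is |g|, integrable because [Om] has finite measure. *)
Lemma integral_box_eq0 a b : cbox a b `<=` Om ->
  (\int[mu3 R]_(x in box a b) (g x)%:E = 0)%E.
Proof.
move=> h.
pose f_ n (x : pt R) := (g x * bump n a b x)%:E.
pose f (x : pt R) := (g x * \1_(box a b) x)%:E.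
have mg : measurable_fun Om g by case: Lg.
have mb n : measurable_fun Om (bump n a b).
  by apply: measurable_continuous3; apply: smooth_continuous; exact: bump_smooth.
have -> : (\int[mu3 R]_(x in box a b) (g x)%:E = \int[mu3 R]_(x in Om) f x)%E.
  have e : Om `&` box a b = box a b by apply/setIidr => x /box_cbox /h.
  rewrite -[in LHS]e integral_mkcondr; apply: eq_integral => x _.
  by rewrite /f patchE indicE; case: (x \in _); rewrite ?mulr1// mulr0.
have [] := @dominated_convergence _ _ _ (mu3 R) Om mOm f_ f (fun x => `|g x|%:E).
- by move=> n; apply/measurable_EFinP; exact: (measurable_funM mg (mb n)).
- apply/measurable_EFinP; apply: measurable_funM => //.
  by apply: measurable_indic; exact: measurable_box.
- apply: aeW => x _; apply: cvg_EFin; first by apply: nearW.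
  apply: cvgMr; exact: bump_cvg.
- by have /integrable_abse := L2_int Lg; apply: eq_integrable => //; exact: mOm.
- apply: aeW => x n _; rewrite lee_fin normrM ler_piMr//.
  by rewrite ger0_norm ?bump_ge0 ?bump_le1.
move=> _ _.
have -> : (fun n => \int[mu3 R]_(x in Om) f_ n x)%E = fun=> 0%E.
  apply/funext => n; have := g0 (bump_test n h).
  rewrite /ip /Rintegral => e.
  rewrite -[LHS]fineK ?e//; apply: integrable_fin_num; first exact: mOm.
  apply: L2_mul_int => //; first exact: mOm.
  apply: bnd_L2; [exact: mOm|exact: fOm|].
  by apply: smooth_bnd => //; exact: bump_smooth.
by move=> /cvg_lim <-//; rewrite lim_cst.
Qed.

Let giS a b E : cbox a b `<=` Om -> measurable E -> E `<=` box a b ->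
  (mu3 R).-integrable E (fun x => (g x)%:E).
Proof.
move=> h mE Eb; apply: (@integrableS _ _ _ (mu3 R) Om E _ mOm mE _ (L2_int Lg)).
by move=> x /Eb /box_cbox /h.
Qed.

Let gi a b (h : cbox a b `<=` Om) := giS h (measurable_box a b) (@subset_refl _ _).

Let halfline_gen : @measurable _ R = <<s @measurable_realfun.RGenOInfty.G R >>.
Proof. exact: measurable_realfun.RGenOInfty.measurableE. Qed.

Let halfline_setI : setI_closed (@measurable_realfun.RGenOInfty.G R).
Proof.
move=> _ _ [x ->] [y ->]; exists (Num.max x y).
apply/seteqP; split => z /=; rewrite !in_itv /= !andbT gt_max; first by case=> -> ->.
by move/andP.
Qed.

Let DI d' (T' : measurableType d') E p G :=
  @dynkin_integral_eq0 _ d' _ T' R (mu3 R) E (fun x => (g x)%:E) p G.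

Let p1 (x : pt R) : R := x.1.1.
Let p2 (x : pt R) : R := x.1.2.
Let p3 (x : pt R) : R := x.2.
Let p12 (x : pt R) : R * R := x.1.

Let mp12 : measurable_fun setT p12. Proof. exact: measurable_fst. Qed.
Let mp1 : measurable_fun setT p1.
Proof. by apply: (measurableT_comp _ mp12); exact: measurable_fst. Qed.
Let mp2 : measurable_fun setT p2.
Proof. by apply: (measurableT_comp _ mp12); exact: measurable_snd. Qed.
Let mp3 : measurable_fun setT p3. Proof. exact: measurable_snd. Qed.

(** Half-lines ]z, +oo[ are stable under intersection and generate the Borel sets, and cutting a box
    by such a half-space only raises a lower corner, so the previous stage applies again. The next
    two lemmas repeat this in the other coordinates. *)
Let integral0_slab a b : cbox a b `<=` Om -> forall A3, measurable A3 ->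
  (\int[mu3 R]_(x in box a b `&` p3 @^-1` A3) (g x)%:E = 0)%E.
Proof.
move=> h; apply: (DI _ _ mp3 halfline_gen halfline_setI).
- exact: measurable_box.
- exact: gi.
- exact: integral_box_eq0.
- move=> _ [z ->].
  have -> : box a b `&` p3 @^-1` `]z, +oo[ = box (a.1, Num.max a.2 z) b.
    apply/seteqP; split => x; rewrite /box /p3 /= !in_itv /= !andbT.
      by move=> [[[-> ->] /andP[? ->]] ?]; rewrite gt_max andbT; split => //; apply/andP.
    by move=> [[-> ->]]; rewrite gt_max => /andP[/andP[-> ->] ->].
  apply: integral_box_eq0 => x [xx]; rewrite /= in_itv /= ge_max => /andP[/andP[? ?] ?].
  by apply: h; split => //; rewrite /= in_itv /=; apply/andP.
Qed.

Let integral0_slab2 a b : cbox a b `<=` Om -> forall A2 A3, measurable A2 -> measurable A3 ->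
  (\int[mu3 R]_(x in (box a b `&` p3 @^-1` A3) `&` p2 @^-1` A2) (g x)%:E = 0)%E.
Proof.
move=> h A2 A3 mA2 mA3; move: A2 mA2.
have mE : measurable (box a b `&` p3 @^-1` A3).
  apply: measurableI; first exact: measurable_box.
  by rewrite -[_ @^-1` _]setTI; exact: mp3.
apply: (DI mE _ mp2 halfline_gen halfline_setI).
- apply: (giS h mE).
  by move=> x [].
- exact: integral0_slab.
- move=> _ [z ->].
  have -> : box a b `&` p3 @^-1` A3 `&` p2 @^-1` `]z, +oo[ =
      box (a.1.1, Num.max a.1.2 z, a.2) b `&` p3 @^-1` A3.
    apply/seteqP; split => x; rewrite /box /p3 /p2 /= !in_itv /= !andbT.
      move=> [[[[-> /andP[? ->]] ->] ?] ?]; rewrite gt_max andbT.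
      by split => //; split => //; split => //; apply/andP.
    by move=> [[[->]]]; rewrite gt_max => /andP[/andP[-> ->] ->] ->.
  apply: integral0_slab => // x [[xx]]; rewrite /= !in_itv /= ge_max => /andP[/andP[? ?] ?] ?.
  by apply: h; split => //; split=> //; rewrite /= in_itv /=; apply/andP.
Qed.

Let integral0_rectangle a b : cbox a b `<=` Om -> forall A1 A2 A3,
  measurable A1 -> measurable A2 -> measurable A3 ->
  (\int[mu3 R]_(x in ((box a b `&` p3 @^-1` A3) `&` p2 @^-1` A2) `&` p1 @^-1` A1)
     (g x)%:E = 0)%E.
Proof.
move=> h A1 A2 A3 mA1 mA2 mA3; move: A1 mA1.
have mE : measurable (box a b `&` p3 @^-1` A3 `&` p2 @^-1` A2).
  apply: measurableI; first apply: measurableI; first exact: measurable_box.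
    by rewrite -[_ @^-1` _]setTI; exact: mp3.
  by rewrite -[_ @^-1` _]setTI; exact: mp2.
apply: (DI mE _ mp1 halfline_gen halfline_setI).
- apply: (giS h mE).
  by move=> x [[]].
- exact: integral0_slab2.
- move=> _ [z ->].
  have -> : box a b `&` p3 @^-1` A3 `&` p2 @^-1` A2 `&` p1 @^-1` `]z, +oo[ =
      box (Num.max a.1.1 z, a.1.2, a.2) b `&` p3 @^-1` A3 `&` p2 @^-1` A2.
    apply/seteqP; split => x; rewrite /box /p3 /p2 /p1 /= !in_itv /= !andbT.
      move=> [[[[[/andP[? ->] ->] ->] ?] ?] ?]; rewrite gt_max andbT.
      by split => //; split => //; split => //; split => //; apply/andP.
    by move=> [[[[]]]]; rewrite gt_max => /andP[/andP[-> ->] ->] -> -> ? ?.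
  apply: integral0_slab2 => // x [[]]; rewrite /= !in_itv /= ge_max => /andP[/andP[? ?] ?] ? ?.
  by apply: h; split => //; split=> //; rewrite /= in_itv /=; apply/andP.
Qed.

(** The sigma-algebra is that of (R x R) x R, so two more Dynkin arguments are needed: from
    rectangles to measurable subsets X of the plane, then from products of X with A3 to all
    measurable sets. *)
Let integral0_cylinder a b : cbox a b `<=` Om -> forall X A3, measurable X -> measurable A3 ->
  (\int[mu3 R]_(x in (box a b `&` p3 @^-1` A3) `&` p12 @^-1` X) (g x)%:E = 0)%E.
Proof.
move=> h X A3 mX mA3; move: X mX.
have mE : measurable (box a b `&` p3 @^-1` A3).
  apply: measurableI; first exact: measurable_box.
  by rewrite -[_ @^-1` _]setTI; exact: mp3.
apply: (DI mE _ mp12 (measurable_prod_measurableType _ _)).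
- apply: (giS h mE).
  by move=> x [].
- move=> _ _ [A1 mA1 [A2 mA2 <-]] [B1 mB1 [B2 mB2 <-]].
  exists (A1 `&` B1); first exact: measurableI.
  by exists (A2 `&` B2); [exact: measurableI|rewrite setXI].
- exact: integral0_slab.
- move=> _ [A1 mA1 [A2 mA2 <-]].
  rewrite (_ : _ `&` p12 @^-1` _ = box a b `&` p3 @^-1` A3 `&` p2 @^-1` A2 `&` p1 @^-1` A1).
    exact: integral0_rectangle.
  by apply/seteqP; split=> x; rewrite /p12 /p2 /p1 /=; [case=> ? []|case=> -[]].
Qed.

Let integral0_measurable a b : cbox a b `<=` Om -> forall A, measurable A ->
  (\int[mu3 R]_(x in box a b `&` A) (g x)%:E = 0)%E.
Proof.
move=> h.
apply: (DI (measurable_box a b) (gi h) (@measurable_id _ _ setT)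
  (measurable_prod_measurableType _ _)).
- move=> _ _ [A1 mA1 [A2 mA2 <-]] [B1 mB1 [B2 mB2 <-]].
  exists (A1 `&` B1); first exact: measurableI.
  by exists (A2 `&` B2); [exact: measurableI|rewrite setXI].
- exact: integral_box_eq0.
- move=> _ [X mX [A3 mA3 <-]].
  rewrite (_ : _ `&` _ @^-1` _ = box a b `&` p3 @^-1` A3 `&` p12 @^-1` X).
    exact: integral0_cylinder.
  by apply/seteqP; split=> x; rewrite /p12 /p3 /=; [case=> ? []|case=> -[]].
Qed.

Let box_ae a b : cbox a b `<=` Om -> {ae mu3 R, forall x, box a b x -> g x = 0}.
Proof.
move=> h.
have := @integral_ae_eq _ _ _ (mu3 R) (box a b) (measurable_box a b)
   (fun=> 0%E) (EFin \o g) (gi h) (measurable_cst _).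
have H : forall E, E `<=` box a b -> measurable E ->
   (\int[mu3 R]_(x in E) (EFin \o g) x = \int[mu3 R]_(x in E) 0)%E.
  move=> E Eb mE; rewrite integral0.
  by have := integral0_measurable h mE; rewrite (setIidr Eb).
by move=> /(_ H); apply: filterS => x hx /hx [].
Qed.

Lemma fundamental_lemma : aeq Om g (fun=> 0).
Proof.
(* [ae_foralln] intersects over nat, so the pairs of rational corners are read through [unpickle];
   codes of no pair, and boxes not inside [Om], impose nothing. *)
pose Q n (x : pt R) := if unpickle n is Some pq then
  cbox (rat3 R pq.1) (rat3 R pq.2) `<=` Om -> box (rat3 R pq.1) (rat3 R pq.2) x -> g x = 0
  else True.
have : {ae mu3 R, forall x, forall n, Q n x}.
  apply: ae_foralln => n; rewrite /Q; case: unpickle => [pq|]; last exact: aeW.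
  have [h|h] := pselect (cbox (rat3 R pq.1) (rat3 R pq.2) `<=` Om); last exact: aeW.
  by apply: filterS (box_ae h) => x hx _.
apply: filterS => x hx Ox; have [p [q [h1 h2]]] := open_cover_box oOm Ox.
by have := hx (pickle (p, q)); rewrite /Q pickleK; apply.
Qed.

End FundamentalLemma.

(** * Functions on [0, T] *)

Section TimeFunctions.
Variables (R : realType) (T : R).
Hypothesis T0 : 0 < T.
Implicit Types (f g df dg : R -> R) (s t e : R).

Definition clamp t : R := Num.max 0 (Num.min t T).

Lemma clampP t : 0 <= clamp t <= T.
Proof. by rewrite /clamp le_max lexx /= ge_max (ltW T0) ge_min lexx orbT. Qed.

Lemma clamp_id t : 0 <= t <= T -> clamp t = t.
Proof. by case/andP => h0 h1; rewrite /clamp (min_idPl h1) (max_idPr h0). Qed.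

Lemma clamp_lip s t : `|clamp s - clamp t| <= `|s - t|.
Proof.
rewrite /clamp ler_norml /Num.max /Num.min.
by do 4 (case: ifP; rewrite ?ltNge; try (move=> /negbT; rewrite negbK));
  rewrite ?ler_normr; do ?case: ifP;
  have := ler_norm (s - t); have := ler_norm (t - s); rewrite (distrC t s); lra.
Qed.

(* Continuity on [0, T]: [f] is frozen outside of the interval. *)
Definition contT f := continuous (f \o clamp).

Lemma contTP f : contT f <-> forall t e, 0 <= t <= T -> 0 < e -> exists2 d, 0 < d &
  forall s, 0 <= s <= T -> `|s - t| < d -> `|f s - f t| <= e.
Proof.
split=> [cf t e ht e0|H t].
  have /cvgrPdist_le /(_ e e0) [d /= d0 hd] := cf t.
  exists d => // s hs st; have := hd s; rewrite /ball_ /= distrC => /(_ st).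
  by rewrite !clamp_id// distrC.
apply/cvgrPdist_le => e e0; have [d d0 hd] := H _ _ (clampP t) e0.
exists d => // s; rewrite /ball_ /= distrC => st; rewrite distrC; apply: hd; first exact: clampP.
by rewrite (le_lt_trans (clamp_lip _ _)).
Qed.

Lemma contT_cst (c : R) : contT (fun=> c).
Proof. by move=> t; exact: cvg_cst. Qed.

Lemma contT_add f g : contT f -> contT g -> contT (fun t => f t + g t).
Proof. by move=> cf cg t; apply: cvgD; [exact: cf|exact: cg]. Qed.

Lemma contT_mul f g : contT f -> contT g -> contT (fun t => f t * g t).
Proof. by move=> cf cg t; apply: cvgM; [exact: cf|exact: cg]. Qed.

Lemma contT_bounded f : contT f -> exists2 M, 0 <= M & forall t, 0 <= t <= T -> `|f t| <= M.
Proof.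
move=> cf; have cn : continuous (fun t => `|(f \o clamp) t|).
  by move=> t; apply: cvg_norm; exact: cf.
have [c _ hc] := @EVT_max R (fun t => `|(f \o clamp) t|) 0 T (ltW T0)
  (continuous_subspaceT cn).
exists `|f (clamp c)| => // t ht; have := hc t; rewrite in_itv /= => /(_ ht).
by rewrite clamp_id.
Qed.

(** Both points range over [0, T], so the derivative is one-sided at 0 and T, as in [C1_on]. *)
Definition derivT f df := forall t e, 0 <= t <= T -> 0 < e -> exists2 d, 0 < d &
  forall s, 0 <= s <= T -> `|s - t| < d -> `|f s - f t - (s - t) * df t| <= e * `|s - t|.

Lemma derivT_cont f df : derivT f df -> contT f.
Proof.
move=> H; apply/contTP => t e ht e0; have [d d0 hd] := H t 1 ht ltr01.
pose K := 1 + `|df t|; have K0 : 0 < K by rewrite ltr_wpDr.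
exists (Num.min d (e / K)); first by rewrite lt_min d0 divr_gt0.
move=> s hs; rewrite lt_min => /andP[h1 h2]; have := hd s hs h1.
rewrite mul1r => h3; rewrite -(subrK ((s - t) * df t) (f s - f t)).
rewrite (le_trans (ler_normD _ _))// normrM.
rewrite (le_trans (lerD h3 (lexx _)))// -{1}(mulr1 `|s - t|) -mulrDr.
by move: h2; rewrite ltr_pdivlMr// => /ltW.
Qed.

Lemma derivT_is_derive f df t : derivT f df -> 0 < t < T ->
  is_derive t 1 (f \o clamp) (df t).
Proof.
move=> H /andP[t0 tT]; apply/is_derive_epsP => e e0.
have ht : 0 <= t <= T by rewrite !ltW.
have [d d0 hd] := H t e ht e0.
exists (Num.min d (Num.min t (T - t))); first by rewrite !lt_min d0 t0 subr_gt0.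
move=> y; rewrite !lt_min => /andP[h1 /andP[h2 h3]].
have hy : 0 <= y <= T.
  by move: h2 h3; rewrite !ltr_norml => /andP[? ?] /andP[? ?]; apply/andP; split; lra.
by rewrite /= !clamp_id//; exact: hd.
Qed.

Lemma is_derive_derivT f df : (forall t, 0 <= t <= T -> is_derive t 1 f (df t)) ->
  derivT f df.
Proof.
move=> H t e ht e0; have [d d0 hd] := (is_derive_epsP f t (df t)).1 (H t ht) e e0.
by exists d => // s _; exact: hd.
Qed.

Lemma derivT_nonincreasing f df : continuous f ->
  (forall t, 0 < t < T -> is_derive t 1 f (df t)) ->
  (forall t, 0 < t < T -> df t <= 0) -> forall t, 0 <= t <= T -> f t <= f 0.
Proof.
move=> cf H df0 t /andP[]; rewrite le_eqVlt => /predU1P[<-//|t0] tT.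
have [||c] := @MVT R f df 0 t t0.
- move=> x; rewrite in_itv /= => /andP[x0 xt]; apply: H.
  by rewrite x0 (lt_le_trans xt).
- exact: continuous_subspaceT.
rewrite in_itv /= => /andP[c0 ct] e.
rewrite -subr_le0 e subr0 mulr_le0_ge0 ?(ltW t0)// df0// c0.
by rewrite (lt_le_trans ct).
Qed.

Lemma derivT_add f g df dg : derivT f df -> derivT g dg ->
  derivT (fun t => f t + g t) (fun t => df t + dg t).
Proof.
move=> H H' t e ht e0; have e2 : 0 < e / 2 by rewrite divr_gt0.
have [d d0 hd] := H t _ ht e2; have [d' d0' hd'] := H' t _ ht e2.
exists (Num.min d d'); first by rewrite lt_min d0.
move=> s hs; rewrite lt_min => /andP[h1 h2].
have := hd s hs h1; have := hd' s hs h2.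
set A := g s - _ - _; set B := f s - _ - _ => hA hB.
have -> : f s + g s - (f t + g t) - (s - t) * (df t + dg t) = B + A by rewrite /A /B; lra.
by rewrite (le_trans (ler_normD _ _))//; lra.
Qed.

Lemma derivT_cmul (c : R) f df : derivT f df -> derivT (fun t => c * f t) (fun t => c * df t).
Proof.
move=> H t e ht e0; have K0 : 0 < `|c| + 1 by rewrite ltr_wpDl.
have e2 : 0 < e / (`|c| + 1) by rewrite divr_gt0.
have [d d0 hd] := H t _ ht e2; exists d => // s hs /(hd s hs).
set A := f s - _ - _ => hA.
have -> : c * f s - c * f t - (s - t) * (c * df t) = c * A by rewrite /A; lra.
rewrite normrM; apply: le_trans (_ : (`|c| + 1) * `|A| <= _).
  by rewrite ler_wpM2r// lerDl.
by move: hA; rewrite mulrAC ler_pdivlMr// mulrC.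
Qed.

Lemma derivT_le f g df dg : derivT f df -> derivT g dg -> f 0 <= g 0 ->
  (forall t, 0 <= t <= T -> df t <= dg t) -> forall t, 0 <= t <= T -> f t <= g t.
Proof.
move=> Hf Hg f0 dfg t ht.
have H := derivT_add Hf (derivT_cmul (-1) Hg).
have := @derivT_nonincreasing _ _ (derivT_cont H) (fun t => derivT_is_derive H).
have h2 : forall s, 0 < s < T -> df s + -1 * dg s <= 0.
  move=> s /andP[/ltW s0 /ltW sT]; have := dfg s; rewrite s0 sT => /(_ isT); lra.
move=> /(_ h2 t ht); rewrite /= !clamp_id//; last by rewrite lexx ltW.
by move: f0; lra.
Qed.

Lemma derivT_norm_le f g df dg : derivT f df -> derivT g dg -> `|f 0| <= g 0 ->
  (forall t, 0 <= t <= T -> `|df t| <= dg t) -> forall t, 0 <= t <= T -> `|f t| <= g t.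
Proof.
move=> Hf Hg; rewrite ler_norml => /andP[h1 h2] dfg t ht; rewrite ler_norml.
apply/andP; split; last first.
  by apply: (derivT_le Hf Hg) => // s /dfg; rewrite ler_norml => /andP[].
have := derivT_le (derivT_cmul (-1) Hf) Hg; have h3 : -1 * f 0 <= g 0 by lra.
move=> /(_ h3) H; have : -1 * f t <= g t.
  by apply: H => // s /dfg; rewrite ler_norml => /andP[]; lra.
lra.
Qed.

Lemma derivT_eq f df dg : derivT f df -> derivT f dg ->
  forall t, 0 <= t <= T -> df t = dg t.
Proof.
move=> H H' t ht; apply/eqP; rewrite -subr_eq0 -normr_le0.
apply/ler_addgt0Pl => e e0; rewrite addr0.
have e2 : 0 < e / 2 by rewrite divr_gt0.
have [d d0 hd] := H t _ ht e2; have [d' d0' hd'] := H' t _ ht e2.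
have [s [hs sd sd' st]] : exists s, [/\ 0 <= s <= T, `|s - t| < d, `|s - t| < d' & s != t].
  (* A second point of [0, T] near t is needed to divide by s - t. As r <= T / 2, there is room for
     it to the right of t when t <= T / 2 and to the left otherwise. *)
  pose r := Num.min (Num.min d d') T / 2.
  have r0 : 0 < r by rewrite divr_gt0// !lt_min d0 d0'.
  have [rd rd' rT] : [/\ r < d, r < d' & r <= T / 2].
    have h : forall a b : R, 0 < b -> a <= b -> a / 2 < b by move=> a b; lra.
    split; [apply: h => //|apply: h => //|rewrite ler_pM2r//]; last by rewrite ge_min lexx orbT.
    - by rewrite !ge_min lexx.
    - by rewrite !ge_min lexx orbT.
  case/andP: ht => t0 tT.
  have [tT2|tT2] := leP t (T / 2).
    exists (t + r); rewrite [t + r]addrC addrK gtr0_norm//; split => //.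
      by apply/andP; split; lra.
    by rewrite eq_sym -subr_eq0 opprD addrCA subrr addr0 oppr_eq0 gt_eqF.
  exists (t - r); rewrite addrAC subrr add0r normrN gtr0_norm//; split => //.
    by apply/andP; split; lra.
  by rewrite -subr_eq0 addrAC subrr add0r oppr_eq0 gt_eqF.
have := hd s hs sd; have := hd' s hs sd'.
set A := _ - _ - _; set B := _ - _ - _ => hA hB.
have h : 0 < `|s - t| by rewrite normr_gt0 subr_eq0.
rewrite -(ler_pM2r h) -normrM.
have -> : (df t - dg t) * (s - t) = A - B by rewrite /A /B; lra.
by rewrite (le_trans (ler_normB _ _))//; lra.
Qed.

Lemma derivT_cst (c : R) : derivT (fun=> c) (fun=> 0).
Proof.
move=> t e ht e0; exists 1 => // s _ _.
by rewrite subrr mulr0 subr0 normr0 mulr_ge0// ltW.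
Qed.

Lemma derivT_expR (k : R) : derivT (fun t => expR (k * t)) (fun t => k * expR (k * t)).
Proof.
apply: is_derive_derivT => t _.
have H := @is_derive1_comp _ expR (fun t => k *: t) t _ _ (is_derive_expR _)
  (@is_deriveZ _ _ _ id k t 1 _ (is_derive_id t 1)).
by apply: is_derive_eq H _; rewrite /GRing.scale /= mulr1 mulrC.
Qed.

Lemma derivT_mul f g df dg : derivT f df -> derivT g dg ->
  (forall t, 0 < t < T -> is_derive t 1 ((f \o clamp) * (g \o clamp))
     (f t * dg t + g t * df t)).
Proof.
move=> Hf Hg t ht; have ht' : 0 <= t <= T by case/andP: ht => ? ?; rewrite !ltW.
have := is_deriveM (derivT_is_derive Hf ht) (derivT_is_derive Hg ht).
by rewrite /GRing.scale /= !clamp_id.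
Qed.

(** The function w(t) exp(-K t) - C t is nonincreasing, since its derivative is at most C (exp(-K t)
    - 1) <= 0. *)
Lemma gronwall (w dw : R -> R) (K C : R) : 0 <= K -> 0 <= C -> 0 <= w 0 -> derivT w dw ->
  (forall t, 0 <= t <= T -> dw t <= K * w t + C) ->
  forall t, 0 <= t <= T -> w t <= (w 0 + C * T) * expR (K * T).
Proof.
move=> K0 C0 w0 Hw dwK t ht.
have HE := derivT_expR (- K).
have HC : derivT (fun t => - C * t) (fun=> - C).
  move=> s e hs e0; exists 1 => // u _ _.
  have -> : - C * u - - C * s - (u - s) * - C = 0 by lra.
  by rewrite normr0 mulr_ge0// ltW.
pose F := ((w \o clamp) * ((fun t => expR (- K * t)) \o clamp)) + ((fun t => - C * t) \o clamp).
have cF : continuous F.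
  move=> x; apply: cvgD; last exact: (derivT_cont HC).
  by apply: cvgM; [exact: (derivT_cont Hw)|exact: (derivT_cont HE)].
have dF : forall s, 0 < s < T -> is_derive s 1 F
   ((w s * (- K * expR (- K * s)) + expR (- K * s) * dw s) + - C).
  by move=> s hs; exact: is_deriveD (derivT_mul Hw HE hs) (derivT_is_derive HC hs).
have := derivT_nonincreasing cF dF.
have h1 : forall s, 0 < s < T ->
   (w s * (- K * expR (- K * s)) + expR (- K * s) * dw s) + - C <= 0.
  move=> s /andP[/ltW s0 /ltW sT]; have := dwK s; rewrite s0 sT => /(_ isT) h.
  have E0 := expR_ge0 (- K * s).
  have E1 : expR (- K * s) <= 1 by rewrite expR_le1 mulNr oppr_le0 mulr_ge0.
  set E := expR _ in E0 E1 *; nra.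
move=> /(_ h1 t ht); rewrite /F !fctE /= !clamp_id//; last by rewrite lexx ltW.
rewrite !mulr0 expR0 mulr1 addr0 => h2.
case/andP: ht => t0 tT.
have h3 : w t * expR (- K * t) <= w 0 + C * T.
  by apply: le_trans (_ : w 0 + C * t <= _); [lra|rewrite lerD2l ler_wpM2l].
have E1 : expR (K * t) <= expR (K * T) by rewrite ler_expR ler_wpM2l.
have E2 : expR (- K * t) * expR (K * t) = 1 by rewrite mulNr mulrC expRxMexpNx_1.
have -> : w t = (w t * expR (- K * t)) * expR (K * t) by rewrite -mulrA E2 mulr1.
apply: le_trans (_ : (w 0 + C * T) * expR (K * t) <= _).
  by rewrite ler_wpM2r// expR_ge0.
by rewrite ler_wpM2l// addr_ge0// mulr_ge0// ltW.
Qed.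

Lemma antiderivative g : contT g -> exists2 P, P 0 = 0 & derivT P g.
Proof.
move=> cg; pose h := g \o clamp.
pose F x := \int[@lebesgue_measure R]_(t in `[-1, x]) h t.
exists (fun t => F t + - F 0); first by rewrite subrr.
have dF t : 0 <= t <= T -> is_derive t 1 F (g t).
  move=> /andP[t0 tT].
  have := @continuous_FTC1_closed R h (-1) t (T + 1); case.
  - by rewrite (le_lt_trans tT)// ltrDl.
  - apply: continuous_compact_integrable; first exact: segment_compact.
    exact: continuous_subspaceT.
  - by rewrite (lt_le_trans _ t0).
  - exact: cg.
  rewrite -/F => d1; rewrite derive1E => d2; split=> //.
  by rewrite d2 /h /= clamp_id// t0.
have := derivT_add (is_derive_derivT dF) (derivT_cst (- F 0)).
move=> H t e ht e0; have [d d0 hd] := H t e ht e0; exists d => // s hs st.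
by have := hd s hs st; rewrite addr0.
Qed.

Lemma derivT_eqf f f' df : (forall t, 0 <= t <= T -> f t = f' t) -> derivT f df -> derivT f' df.
Proof.
move=> e H t ep ht ep0; have [d d0 hd] := H t ep ht ep0; exists d => // s hs st.
by rewrite -!e//; exact: hd.
Qed.

Lemma derivT_eqd f df df' : (forall t, 0 <= t <= T -> df t = df' t) -> derivT f df -> derivT f df'.
Proof.
move=> e H t ep ht ep0; have [d d0 hd] := H t ep ht ep0; exists d => // s hs st.
by rewrite -e//; exact: hd.
Qed.

Lemma contT_eq f f' : (forall t, 0 <= t <= T -> f t = f' t) -> contT f -> contT f'.
Proof.
move=> e; rewrite /contT; suff -> : f \o clamp = f' \o clamp by [].
by apply/funext => t /=; apply: e; exact: clampP.
Qed.

Lemma contT_sum (J : Type) (s : seq J) (f : J -> R -> R) :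
  (forall j, contT (f j)) -> contT (fun t => \sum_(j <- s) f j t).
Proof.
move=> cf; elim: s => [|j s IH].
  by apply: (@contT_eq (fun=> 0)) => [t _|]; [rewrite big_nil|exact: contT_cst].
apply: (@contT_eq (fun t => f j t + \sum_(j <- s) f j t)) => [t _|].
  by rewrite big_cons.
exact: contT_add.
Qed.

Lemma derivT_sqr f df : derivT f df -> derivT (fun t => f t ^+ 2) (fun t => 2 * (f t * df t)).
Proof.
move=> H t e ht e0.
have [M M0 hM] := contT_bounded (derivT_cont H).
(* K bounds |f s + f t| and |df t|. The error splits below into two terms, each at most e / 4 * |s -
   t|. *)
pose K := `|df t| + M + M + 1.
have K1 : 1 <= K by rewrite /K lerDr !addr_ge0.
have K0 : 0 < K by rewrite (lt_le_trans _ K1).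
have e1 : 0 < e / K / 4 by rewrite !divr_gt0.
have [d d0 hd] := H t _ ht e1.
have e2 : 0 < e / 4 / K by rewrite !divr_gt0.
have [d' d0' hd'] := (contTP _).1 (derivT_cont H) t _ ht e2.
exists (Num.min d d'); first by rewrite lt_min d0.
move=> s hs; rewrite lt_min => /andP[/(hd s hs) h1 /(hd' s hs) h2].
have hs' := hM s hs; have ht' := hM t ht.
have -> : f s ^+ 2 - f t ^+ 2 - (s - t) * (2 * (f t * df t)) =
  (f s + f t) * (f s - f t - (s - t) * df t) + (f s - f t) * ((s - t) * df t).
  by lra.
apply: le_trans (ler_normD _ _) _; rewrite !normrM.
have a1 : `|f s + f t| <= K.
  rewrite (le_trans (ler_normD _ _))// /K; have := normr_ge0 (df t); lra.
have a2 : `|df t| <= K by rewrite /K; lra.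
have b1 : `|f s + f t| * `|f s - f t - (s - t) * df t| <= K * (e / K / 4 * `|s - t|).
  by rewrite ler_pM.
have b2 : `|f s - f t| * (`|s - t| * `|df t|) <= e / 4 / K * (`|s - t| * K).
  by rewrite ler_pM// ?mulr_ge0// ler_wpM2l.
have c1 : K * (e / K / 4 * `|s - t|) = e / 4 * `|s - t|.
  by rewrite mulrA; congr (_ * _); rewrite mulrC -!mulrA; congr (_ * _); rewrite mulrCA mulVf ?mulr1// gt_eqF.
have c2 : e / 4 / K * (`|s - t| * K) = e / 4 * `|s - t|.
  by rewrite (mulrC `|s - t|) mulrA -(mulrA _ K^-1) mulVf ?mulr1// gt_eqF.
have := normr_ge0 (s - t); move: b1 b2; rewrite c1 c2; nra.
Qed.

Lemma derivT_sum (J : Type) (s : seq J) (f df : J -> R -> R) :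
  (forall j, derivT (f j) (df j)) ->
  derivT (fun t => \sum_(j <- s) f j t) (fun t => \sum_(j <- s) df j t).
Proof.
move=> H; elim: s => [|j s IH].
  apply: derivT_eqf (_ : forall t, _ -> (fun=> 0) t = _) _ => [t _|]; first by rewrite big_nil.
  by apply: derivT_eqd (derivT_cst 0) => t _; rewrite big_nil.
apply: (@derivT_eqf (fun t => f j t + \sum_(j <- s) f j t)) => [t _|]; first by rewrite big_cons.
by apply: derivT_eqd (derivT_add (H j) IH) => t _; rewrite big_cons.
Qed.

Lemma geometric_limit (u : nat -> R) (C : R) :
  (forall k, `|u k.+1 - u k| <= C / 2 ^+ k) ->
  exists l, forall k, `|u k - l| <= 2 * C / 2 ^+ k.
Proof.
move=> H.
pose q k : R := (2 ^+ k)^-1; have qS k : q k = 2 * q k.+1.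
  by rewrite /q exprS invfM mulrA divff// mul1r.
have C0 : 0 <= C.
  by have := le_trans (normr_ge0 _) (H 0%N); rewrite expr0 divr1.
have q0 k : 0 <= q k by rewrite invr_ge0 exprn_ge0.
(* The shift by 2 C / 2^k drops by C / 2^k at each step, exactly enough to absorb an increment of u:
   w increases, v decreases, and the supremum of w lies between them. *)
pose w k := u k - 2 * C * q k; pose v k := u k + 2 * C * q k.
have hH k : - (C * q k) <= u k.+1 - u k <= C * q k by rewrite -ler_norml; exact: H.
have wS k : w k <= w k.+1.
  by rewrite /w qS; have /andP[] := hH k; rewrite qS; lra.
have vS k : v k.+1 <= v k.
  by rewrite /v (qS k); have /andP[] := hH k; rewrite (qS k); lra.
have wm i j : (i <= j)%N -> w i <= w j by move=> ij; apply/(homo_leq (r := <=%O)) => //; exact: le_trans.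
have vm i j : (i <= j)%N -> v j <= v i.
  elim: j => [|j IH]; first by rewrite leqn0 => /eqP->.
  by rewrite leq_eqVlt ltnS => /predU1P[->//|/IH]; exact: le_trans.
have wv i j : w i <= v j.
  apply: le_trans (wm i (maxn i j) (leq_maxl _ _)) _.
  apply: le_trans (_ : v (maxn i j) <= _); last by apply: vm; exact: leq_maxr.
  by rewrite /w /v; have := mulr_ge0 (mulr_ge0 (ltW (ltr0Sn R 1)) C0) (q0 (maxn i j)); lra.
pose l := sup (range w).
have lb k : w k <= l by apply: ub_le_sup; [exists (v 0%N) => _ [i _ <-]|exists k].
have ub k : l <= v k by apply: ge_sup; [exists (w 0%N), 0%N|move=> _ [i _ <-]].
exists l => k; rewrite -[_ / _]/(2 * C * q k) ler_norml.
by have := lb k; have := ub k; rewrite /w /v => *; apply/andP; split; lra.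
Qed.

End TimeFunctions.

(** * Ordinary differential equations *)

Section Picard.
Variables (R : realType) (T : R) (I : finType).
Hypothesis T0 : 0 < T.
Implicit Types (x y : R -> I -> R) (G : R -> (I -> R) -> I -> R).
Local Notation contT := (contT T).
Local Notation derivT := (derivT T).

Let T00 : 0 <= (0 : R) <= T. Proof. by rewrite lexx ltW. Qed.

(** Picard iteration with errors measured against exp(la t): in this weighted norm one step halves
    distances, so the iterates converge on all of [0, T] at once, without a subdivision into short
    intervals. *)
Lemma picard G (x0 : I -> R) (L : R) : 0 <= L ->
  (forall x, (forall i, contT (x ^~ i)) -> forall i, contT (fun t => G t (x t) i)) ->
  (forall (t : R) (a b : I -> R) (d : R), 0 <= t <= T -> (forall i, `|a i - b i| <= d) ->
     forall i, `|G t a i - G t b i| <= L * d) ->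
  exists x, x 0 = x0 /\ forall i, derivT (x ^~ i) (fun t => G t (x t) i).
Proof.
move=> L0 GC GL.
(* A total antiderivative operator, so that [step] can be iterated as a function; nothing is claimed
   about it at discontinuous g. *)
have /choice [A hA] : forall g, exists P, contT g -> P 0 = 0 /\ derivT P g.
  move=> g.
  have [cg|ncg] := pselect (contT g); last by exists (fun=> 0).
  by have [P P0 dP] := antiderivative cg; exists P.
pose step x t i := x0 i + A (fun s => G s (x s) i) t.
have stepC x : (forall i, contT (x ^~ i)) ->
    step x 0 = x0 /\ forall i, derivT ((step x)^~ i) (fun t => G t (x t) i).
  move=> cx; split.
    by apply/funext => i; rewrite /step (hA _ (GC _ cx i)).1 addr0.
  move=> i; have := derivT_add (@derivT_cst R T (x0 i)) (hA _ (GC _ cx i)).2.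
  by apply: derivT_eqd => t _; rewrite add0r.
pose X k := iter k step (fun=> x0).
have XC k : forall i, contT ((X k)^~ i).
  elim: k => [|k IH] i; first exact: contT_cst.
  exact: (derivT_cont T0 ((stepC _ IH).2 i)).
have X0 k : X k 0 = x0 by case: k => [//|k]; exact: (stepC _ (XC k)).1.
have Xd k i : derivT ((X k.+1)^~ i) (fun t => G t (X k t) i) := (stepC _ (XC k)).2 i.
(* Halving requires L <= la / 2; the extra 1 keeps la positive when L = 0. *)
pose la := 2 * L + 1.
have la0 : 0 < la by rewrite /la; lra.
have [M M0 hM] : exists2 M, 0 <= M & forall i t, 0 <= t <= T -> `|X 1%N t i - X 0%N t i| <= M.
  have /choice [m hm] : forall i, exists m, 0 <= m /\ forall t, 0 <= t <= T -> `|X 1%N t i - X 0%N t i| <= m.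
    move=> i; have [m m0 hm] := contT_bounded T0 (contT_add (XC 1%N i) (@contT_cst R T (- x0 i))).
    by exists m.
  exists (\sum_i m i); first by apply: sumr_ge0 => i _; case: (hm i).
  move=> i t ht; apply: le_trans ((hm i).2 t ht) _.
  rewrite (bigD1 i)//= lerDl; apply: sumr_ge0 => j _; exact: (hm j).1.
pose E (k : nat) t : R := M / 2 ^+ k * expR (la * t).
have Edec k t : 0 <= t <= T -> E k t <= M * expR (la * T) / 2 ^+ k.
  move=> /andP[_ tT]; rewrite /E mulrAC ler_wpM2r ?invr_ge0 ?exprn_ge0//.
  by rewrite ler_wpM2l// ler_expR ler_wpM2l// ltW.
have step_le k : forall i t, 0 <= t <= T -> `|X k.+1 t i - X k t i| <= E k t.
  elim: k => [|k IH] i t ht.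
    rewrite (le_trans (hM i t ht))// /E expr0 divr1 ler_peMr//.
    have /andP[t0 _] := ht.
    by rewrite -expR0 ler_expR mulr_ge0// ltW.
  have D1 := derivT_add (Xd k.+1 i) (derivT_cmul (-1) (Xd k i)).
  have D2 := derivT_cmul (M / 2 ^+ k.+1) (@derivT_expR R T la).
  have := derivT_norm_le T0 D1 D2.
  rewrite !X0 mulN1r subrr normr0 => /(_ _ _ t ht).
  rewrite mulN1r; apply.
    by rewrite !mulr_ge0 ?invr_ge0 ?exprn_ge0// expR_ge0.
  move=> s hs; rewrite mulN1r.
  apply: le_trans (GL s _ _ (E k s) hs (fun j => IH j s hs) i) _.
  rewrite /E exprS invfM.
  have e0 := expR_ge0 (la * s).
  have m0 : 0 <= M * (2 ^+ k)^-1 by rewrite mulr_ge0// invr_ge0 exprn_ge0.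
  have -> : M * (2^-1 * (2 ^+ k)^-1) * (la * expR (la * s)) =
    (la / 2) * (M * (2 ^+ k)^-1 * expR (la * s)).
    by set a := (2 ^+ k)^-1; set b := expR _; lra.
  by rewrite ler_wpM2r ?mulr_ge0 ?invr_ge0 ?exprn_ge0// /la; lra.
pose C := M * expR (la * T).
have /choice [z hz] : forall ti : R * I, exists l, 0 <= ti.1 <= T ->
    forall k, `|X k ti.1 ti.2 - l| <= 2 * C / 2 ^+ k.
  move=> [t i]; have [ht|nht] := pselect (0 <= t <= T); last by exists 0 => /nht.
  have [|l hl] := @geometric_limit R (fun k => X k t i) C; last by exists l.
  by move=> k; apply: le_trans (step_le k i t ht) (Edec _ _ ht).
pose x (t : R) (i : I) := z (t, i).
have hx t i k : 0 <= t <= T -> `|X k t i - x t i| <= 2 * C / 2 ^+ k by move=> /(hz (t, i)); apply.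
have small (c e : R) : 0 < e -> exists k, c / 2 ^+ k <= e.
  move=> e0; have [c0|c0] := leP c 0.
    by exists 0%N; rewrite expr0 divr1 (le_trans c0)// ltW.
  have [k hk] : exists k : nat, c / e <= k%:R.
    by exists (Num.truncn (c / e)).+1; rewrite ltW// truncnS_gt.
  exists k; rewrite ler_pdivrMr ?exprn_gt0// mulrC -ler_pdivrMr//.
  by rewrite (le_trans hk)// -natrX ler_nat ltnW// ltn_expl.
have xC i : contT (x ^~ i).
  apply/(contTP T0) => t e ht e0.
  have e3 : 0 < e / 3 by rewrite divr_gt0.
  have [k hk] := small (2 * C) _ e3.
  have [d d0 hd] := (contTP T0 _).1 (XC k i) t _ ht e3.
  exists d => // s hs st; have := hd s hs st => h1.
  have h2 := le_trans (hx s i k hs) hk; have h3 := le_trans (hx t i k ht) hk.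
  move: h1 h2 h3; rewrite !ler_norml => /andP[? ?] /andP[? ?] /andP[? ?].
  by apply/andP; split; lra.
have [Y0 dY] := stepC _ xC.
have xY (t : R) (i : I) : 0 <= t <= T -> x t i = step x t i.
  move=> ht; apply/eqP; rewrite -subr_eq0 -normr_le0.
  apply/ler_addgt0Pl => e e0; rewrite addr0.
  have [k hk] := small (2 * C + 2 * (L * (2 * C)) * T) _ e0.
  apply: le_trans hk.
  (* [X k.+1] is the step of [X k], so the distance from [X k] to the limit, multiplied by L, bounds
     the derivative of this difference. *)
  have bnd : `|X k.+1 t i - step x t i| <= L * (2 * C / 2 ^+ k) * t.
    have D1 := derivT_add (Xd k i) (derivT_cmul (-1) (dY i)).
    have D2 : derivT (fun t => (L * (2 * C / 2 ^+ k)) * t) (fun=> (L * (2 * C / 2 ^+ k))).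
      move=> s ep hs ep0; exists 1 => // u _ _.
      set K := L * _; have -> : K * u - K * s - (u - s) * K = 0 by lra.
      by rewrite normr0 mulr_ge0// ltW.
    have := derivT_norm_le T0 D1 D2.
    rewrite X0 Y0 mulN1r subrr normr0 mulr0 => /(_ (lexx _)) /(_ _ t ht).
    rewrite mulN1r; apply => s hs; rewrite mulN1r; apply: GL => // j; exact: hx.
  have h1 := hx t i k.+1 ht.
  have C0 : 0 <= C by rewrite mulr_ge0 ?expR_ge0.
  have q0 : 0 <= (2 ^+ k)^-1 :> R by rewrite invr_ge0 exprn_ge0.
  have tT : t <= T by case/andP: ht.
  have t0 : 0 <= t by case/andP: ht.
  have -> : x t i - step x t i = (X k.+1 t i - step x t i) - (X k.+1 t i - x t i) by lra.
  apply: le_trans (ler_normB _ _) _.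
  apply: le_trans (lerD bnd h1) _.
  have -> : 2 * C / 2 ^+ k.+1 = C / 2 ^+ k.
    by rewrite exprS invfM mulrACA divff// mul1r.
  set q := _^-1 in q0 *.
  have a1 : L * (2 * C * q) * t <= L * (2 * C * q) * T by rewrite ler_wpM2l// !mulr_ge0.
  have a2 : 0 <= C * q by rewrite mulr_ge0.
  have a3 : 0 <= L * (2 * C * q) * T by rewrite !mulr_ge0// ltW.
  by move: a1 a2 a3; lra.
exists (fun t => if t == 0 then x0 else x t); split; first by rewrite eqxx.
have xE t i : 0 <= t <= T -> (if t == 0 then x0 else x t) i = step x t i.
  by move=> ht; case: eqP => [->|_]; [rewrite Y0|exact: xY].
move=> i; apply: derivT_eqf (_ : derivT ((step x)^~ i) _) => [t /xE->//|].
apply: derivT_eqd (dY i) => t ht; congr (G t _ i).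
by apply/funext => j; rewrite xE// xY.
Qed.

End Picard.

(** * Locally Lipschitz equations: global existence from an a priori bound, and uniqueness *)

Section LocallyLipschitz.
Variables (R : realType) (T : R) (I : finType).
Hypothesis T0 : 0 < T.
Local Notation contT := (contT T).
Local Notation derivT := (derivT T).
Implicit Types (f g : R -> (I -> R) -> R) (x y : I -> R) (r s t d : R).

(** The Lipschitz constant is uniform in time. The notion is stable under products and still gives
    continuity along continuous curves ([loclip_comp]). *)
Definition loclip g :=
  (forall x, contT (g ^~ x)) /\
  forall r, exists2 L, 0 <= L & forall t x y d, 0 <= t <= T ->
    (forall i, `|x i| <= r) -> (forall i, `|y i| <= r) ->
    (forall i, `|x i - y i| <= d) -> `|g t x - g t y| <= L * d.

Lemma finite_bound (P : I -> R -> Prop) :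
  (forall i M M', M <= M' -> P i M -> P i M') ->
  (forall i, exists2 M, 0 <= M & P i M) -> exists2 M, 0 <= M & forall i, P i M.
Proof.
move=> mono H; have /choice [m hm] : forall i, exists M, 0 <= M /\ P i M.
  by move=> i; have [M] := H i; exists M.
(* The sum of the nonnegative bounds replaces their maximum. *)
exists (\sum_i m i); first by apply: sumr_ge0 => i _; case: (hm i).
move=> i; apply: mono (hm i).2; rewrite (bigD1 i)//= lerDl.
by apply: sumr_ge0 => j _; exact: (hm j).1.
Qed.

Lemma loclip_bounded g r : loclip g ->
  exists2 M, 0 <= M & forall t x, 0 <= t <= T -> (forall i, `|x i| <= r) -> `|g t x| <= M.
Proof.
move=> [cg lg]; have [L L0 hL] := lg `|r|.
have [M M0 hM] := contT_bounded T0 (cg (fun=> 0)).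
exists (M + L * `|r|); first by rewrite addr_ge0// mulr_ge0.
move=> t x ht hx; rewrite -(subrK (g t (fun=> 0)) (g t x)) addrC.
rewrite (le_trans (ler_normD _ _))// lerD// ?hM//.
apply: hL => // i; rewrite ?normr0// ?subr0; exact: le_trans (hx i) (ler_norm _).
Qed.

Lemma contT_norm (u : R -> R) : contT u -> contT (fun t => `|u t|).
Proof. by move=> cu t; apply: cvg_norm; exact: cu. Qed.

(** Freezing the state at x t splits the increment: the Lipschitz bound handles x s against x t at
    time s, and time continuity handles s against t at the state x t. *)
Lemma loclip_comp g (x : R -> I -> R) : loclip g -> (forall i, contT (x ^~ i)) ->
  contT (fun t => g t (x t)).
Proof.
move=> [cg lg] cx.
have [r r0 hr] : exists2 r, 0 <= r & forall i t, 0 <= t <= T -> `|x t i| <= r.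
  apply: (@finite_bound (fun i r => forall t, 0 <= t <= T -> `|x t i| <= r)).
    by move=> i M M' MM h t /h; move/le_trans; apply.
  by move=> i; exact: contT_bounded.
have [L L0 hL] := lg r.
apply/(contTP T0) => t e ht e0.
have e2 : 0 < e / 2 by rewrite divr_gt0.
have [d1 d10 h1] := (contTP T0 _).1 (cg (x t)) t _ ht e2.
pose w s := \sum_i `|x s i + - x t i|.
have cw : contT w.
  apply: contT_sum => // i; apply: contT_norm.
  exact: contT_add (cx i) (@contT_cst R T _).
have w0 : w t = 0 by rewrite /w big1// => i _; rewrite subrr normr0.
have e3 : 0 < e / 2 / (L + 1) by rewrite !divr_gt0// ltr_wpDl.
have [d2 d20 h2] := (contTP T0 _).1 cw t _ ht e3.
exists (Num.min d1 d2); first by rewrite lt_min d10.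
move=> s hs; rewrite lt_min => /andP[s1 s2].
have a1 := h1 s hs s1; have a2 := h2 s hs s2.
have ws0 : 0 <= w s by apply: sumr_ge0.
rewrite w0 subr0 ger0_norm// in a2.
have a3 : `|g s (x s) - g s (x t)| <= L * w s.
  apply: hL => // [i|i|i]; [exact: hr|exact: hr|].
  by rewrite /w (bigD1 i)//= lerDl; apply: sumr_ge0.
have a4 : L * w s <= e / 2.
  apply: le_trans (_ : (L + 1) * w s <= _); first by rewrite ler_wpM2r// lerDl.
  by move: a2; rewrite ler_pdivlMr ?ltr_wpDl// mulrC.
rewrite -(subrK (g s (x t)) (g s (x s))) -addrA (le_trans (ler_normD _ _))//.
by move: a1 a3 a4; set A := `|_ - _|; set B := `|_ - _|; lra.
Qed.

Lemma loclip_time (u : R -> R) : contT u -> loclip (fun t _ => u t).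
Proof.
move=> cu; split=> // r; exists 0 => // t x y d _ _ _ _.
by rewrite subrr normr0 mul0r.
Qed.

Lemma loclip_coord i : loclip (fun _ x => x i).
Proof.
split=> [x|r]; first exact: contT_cst.
by exists 1 => // t x y d _ _ _ h; rewrite mul1r.
Qed.

Lemma loclip_add f g : loclip f -> loclip g -> loclip (fun t x => f t x + g t x).
Proof.
move=> [cf lf] [cg lg]; split=> [x|r]; first exact: contT_add.
have [L L0 hL] := lf r; have [L' L0' hL'] := lg r.
exists (L + L'); first exact: addr_ge0.
move=> t x y d ht hx hy hd; have := hL t x y d ht hx hy hd; have := hL' t x y d ht hx hy hd.
rewrite mulrDl opprD addrACA => h1 h2.
by rewrite (le_trans (ler_normD _ _))// lerD.
Qed.

Lemma loclip_mul f g : loclip f -> loclip g -> loclip (fun t x => f t x * g t x).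
Proof.
move=> hf hg; have [cf lf] := hf; have [cg lg] := hg.
split=> [x|r]; first exact: contT_mul.
have [L L0 hL] := lf r; have [L' L0' hL'] := lg r.
have [M M0 hM] := loclip_bounded r hf; have [M' M0' hM'] := loclip_bounded r hg.
exists (M * L' + L * M'); first by rewrite addr_ge0// mulr_ge0.
move=> t x y d ht hx hy hd.
have -> : f t x * g t x - f t y * g t y =
  f t x * (g t x - g t y) + (f t x - f t y) * g t y by lra.
rewrite (le_trans (ler_normD _ _))// !normrM mulrDl lerD//.
  by rewrite -mulrA ler_pM// ?hM// hL'.
by rewrite mulrAC ler_pM// ?hM'// hL.
Qed.

Lemma loclip_eq f g : (forall t x, 0 <= t <= T -> f t x = g t x) -> loclip f -> loclip g.
Proof.
move=> e [cf lf]; split=> [x|r].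
  by apply: (contT_eq T0 _ (cf x)) => t ht; exact: e.
have [L L0 hL] := lf r; exists L => // t x y d ht hx hy hd.
by rewrite -!e//; exact: hL.
Qed.

Lemma loclip_cmul (c : R) f : loclip f -> loclip (fun t x => c * f t x).
Proof. by apply: loclip_mul; apply: loclip_time; exact: contT_cst. Qed.

Lemma loclip_sum (J : Type) (s : seq J) (f : J -> R -> (I -> R) -> R) :
  (forall j, loclip (f j)) -> loclip (fun t x => \sum_(j <- s) f j t x).
Proof.
move=> lf; elim: s => [|j s IH].
  apply: (@loclip_eq (fun _ _ => 0)) => [t x _|]; first by rewrite big_nil.
  by apply: loclip_time; exact: contT_cst.
apply: loclip_eq (loclip_add (lf j) IH) => t x _; by rewrite big_cons.
Qed.

Definition clip r s : R := Num.max (- r) (Num.min r s).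
Definition hat r s : R := Num.max 0 (Num.min 1 (r + 1 - `|s|)).

Lemma clip_lip r s t : `|clip r s - clip r t| <= `|s - t|.
Proof.
rewrite /clip ler_norml /Num.max /Num.min.
by do 4 (case: ifP; rewrite ?ltNge; try (move=> /negbT; rewrite negbK));
  have := ler_norm (s - t); have := ler_norm (t - s); rewrite (distrC t s); lra.
Qed.

Lemma clip_id r s : `|s| <= r -> clip r s = s.
Proof. by rewrite ler_norml => /andP[h1 h2]; rewrite /clip (min_idPr h2) (max_idPr h1). Qed.

Lemma clip_le r s : 0 <= r -> `|clip r s| <= r.
Proof.
move=> r0; rewrite ler_norml /clip le_max lexx /= ge_max ge_min lexx /= andbT.
by rewrite (le_trans _ r0)// oppr_le0.
Qed.

Lemma hat_itv r s : 0 <= hat r s <= 1.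
Proof. by rewrite /hat le_max lexx /= ge_max ler01 ge_min lexx. Qed.

Lemma hat1 r s : `|s| <= r -> hat r s = 1.
Proof.
move=> h; have h1 : 1 <= r + 1 - `|s| by lra.
by rewrite /hat (min_idPl h1) (max_idPr ler01).
Qed.

Lemma hat0 r s : r + 1 <= `|s| -> hat r s = 0.
Proof. by move=> h; apply/max_idPl; rewrite ge_min subr_le0 h orbT. Qed.

Lemma hat_lip r s t : `|hat r s - hat r t| <= `|s - t|.
Proof.
rewrite /hat /Num.max /Num.min.
set a := `|s|; set b := `|t|.
have := ler_dist_dist s t; rewrite -/a -/b ler_norml => /andP[].
have := normr_ge0 (s - t); set z := `|s - t|.
by rewrite ler_norml;
  do 4 (case: ifP; rewrite ?ltNge; try (move=> /negbT; rewrite negbK)); lra.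
Qed.

(* A Lipschitz cutoff makes the right-hand side globally Lipschitz; the a priori bound must
   then hold for all damped equations x' = la G, with 0 <= la <= 1. *)
Definition cutoff r x : R := \prod_i hat r (x i).

Lemma prod_itv (J : Type) (s : seq J) (a : J -> R) : (forall j, 0 <= a j <= 1) ->
  0 <= \prod_(j <- s) a j <= 1.
Proof.
move=> ha; elim: s => [|j s /andP[IH0 IH1]]; first by rewrite big_nil ler01 lexx.
by rewrite big_cons; have /andP[? ?] := ha j; rewrite mulr_ge0 ?mulr_ile1.
Qed.

Lemma cutoff_itv r x : 0 <= cutoff r x <= 1.
Proof. by apply: prod_itv => i; exact: hat_itv. Qed.

Lemma prod_lip (J : Type) (s : seq J) (a b : J -> R) d :
  (forall j, 0 <= a j <= 1) -> (forall j, 0 <= b j <= 1) ->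
  (forall j, `|a j - b j| <= d) ->
  `|\prod_(j <- s) a j - \prod_(j <- s) b j| <= (size s)%:R * d.
Proof.
move=> ha hb hd; elim: s => [|j s IH]; first by rewrite !big_nil subrr normr0 mul0r.
rewrite !big_cons; set A := \prod_(j <- s) a j; set B := \prod_(j <- s) b j.
have -> : a j * A - b j * B = a j * (A - B) + (a j - b j) * B by lra.
rewrite (le_trans (ler_normD _ _))// !normrM /= -natr1 mulrDl mul1r.
have /andP[a0 a1] := ha j; have /andP[B0 B1] := prod_itv s hb.
apply: lerD; first by rewrite (le_trans _ IH)// ger0_norm// ler_piMl.
by rewrite (le_trans _ (hd j))// (ger0_norm B0) ler_piMr.
Qed.

Lemma cutoff_lip r x y d : (forall i, `|x i - y i| <= d) ->
  `|cutoff r x - cutoff r y| <= (size (index_enum I))%:R * d.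
Proof.
move=> h; apply: prod_lip => i; [exact: hat_itv|exact: hat_itv|].
exact: le_trans (hat_lip _ _ _) (h i).
Qed.

Lemma contT_lip (phi : R -> R) (u : R -> R) :
  (forall s t, `|phi s - phi t| <= `|s - t|) -> contT u -> contT (fun t => phi (u t)).
Proof.
move=> hphi cu; apply/(contTP T0) => t e ht e0.
have [d d0 hd] := (contTP T0 _).1 cu t e ht e0.
by exists d => // s hs /(hd s hs); exact: le_trans.
Qed.

Theorem ode_global (G : R -> (I -> R) -> I -> R) (x0 : I -> R) r : 0 <= r ->
  (forall i, loclip (fun t x => G t x i)) ->
  (forall (la : R -> R) (x : R -> I -> R), (forall t, 0 <= la t <= 1) -> x 0 = x0 ->
    (forall i, derivT (x ^~ i) (fun t => la t * G t (x t) i)) ->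
    forall t i, 0 <= t <= T -> `|x t i| <= r) ->
  exists x : R -> I -> R, x 0 = x0 /\ forall i, derivT (x ^~ i) (fun t => G t (x t) i).
Proof.
move=> r0 lG apriori.
have r1 : 0 <= r + 1 by rewrite addr_ge0.
(* Clipping makes G bounded and globally Lipschitz, so its product with the cutoff is Lipschitz too.
   It changes nothing, because the cutoff vanishes as soon as some coordinate exceeds r + 1. *)
pose G' t x i := cutoff r x * G t (fun j => clip (r + 1) (x j)) i.
have G'E t x i : G' t x i = cutoff r x * G t x i.
  have [h|/existsNP[j /negP]] := pselect (forall j, `|x j| <= r + 1).
    by rewrite /G'; congr (_ * G t _ i); apply/funext => j; rewrite clip_id.
  rewrite -ltNge => /ltW h; have c0 : cutoff r x = 0.
    by rewrite /cutoff (bigD1 j)//= hat0 ?mul0r.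
  by rewrite /G' c0 !mul0r.
have [M M0 hM] : exists2 M, 0 <= M & forall i t x, 0 <= t <= T ->
    (forall j, `|x j| <= r + 1) -> `|G t x i| <= M.
  apply: (@finite_bound (fun i M => forall t x, 0 <= t <= T ->
    (forall j, `|x j| <= r + 1) -> `|G t x i| <= M)).
    by move=> i A B AB h t x ht hx; rewrite (le_trans (h t x ht hx)).
  by move=> i; exact: loclip_bounded.
have [L L0 hL] : exists2 L, 0 <= L & forall i t x y d, 0 <= d -> 0 <= t <= T ->
    (forall i, `|x i| <= r + 1) -> (forall i, `|y i| <= r + 1) ->
    (forall i, `|x i - y i| <= d) -> `|G t x i - G t y i| <= L * d.
  apply: (@finite_bound (fun i L => forall t x y d, 0 <= d -> 0 <= t <= T ->
    (forall i, `|x i| <= r + 1) -> (forall i, `|y i| <= r + 1) ->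
    (forall i, `|x i - y i| <= d) -> `|G t x i - G t y i| <= L * d)).
    move=> i A B AB h t x y d d0 ht hx hy hd; rewrite (le_trans (h t x y d d0 ht hx hy hd))//.
    by rewrite ler_wpM2r.
  by move=> i; have [L L0 hL] := (lG i).2 (r + 1); exists L => // t x y d _; exact: hL.
pose N : R := (size (index_enum I))%:R.
have N0 : 0 <= N by [].
have [x [xx0 dx]] : exists x : R -> I -> R, x 0 = x0 /\ forall i, derivT (x ^~ i) (fun t => G' t (x t) i).
  apply: (@picard _ _ _ T0 _ _ (N * M + L)); first by rewrite addr_ge0// mulr_ge0.
    move=> x cx i; apply: contT_mul.
      apply: (@loclip_comp (fun _ x => cutoff r x)) => //; split=> [y|s]; first exact: contT_cst.
      by exists N => // t y z d _ _ _ h; exact: cutoff_lip.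
    apply: (@loclip_comp (fun t x => G t x i) (fun t j => clip (r + 1) (x t j))) => // j.
    by apply: contT_lip => //; exact: clip_lip.
  move=> t a b d ht hab i.
  have d0 : 0 <= d by exact: le_trans (normr_ge0 _) (hab i).
  rewrite /G'; set ga := G t _ i; set gb := G t _ i.
  have -> : cutoff r a * ga - cutoff r b * gb =
     (cutoff r a - cutoff r b) * ga + cutoff r b * (ga - gb) by lra.
  rewrite (le_trans (ler_normD _ _))// !normrM mulrDl lerD//.
    rewrite mulrAC ler_pM//; first exact: cutoff_lip.
    by apply: hM => // j; exact: clip_le.
  have /andP[c0 c1] := cutoff_itv r b.
  rewrite (ger0_norm c0); apply: le_trans (_ : `|ga - gb| <= _).
    by rewrite ler_piMl.
  apply: hL => // j; [exact: clip_le|exact: clip_le|].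
  exact: le_trans (clip_lip _ _ _) (hab j).
exists x; split => // i; apply: derivT_eqd (dx i) => t ht.
rewrite G'E; suff -> : cutoff r (x t) = 1 by rewrite mul1r.
rewrite /cutoff big1// => j _; apply: hat1.
(* The solution of the modified equation solves a damped equation, with its own cutoff along the
   trajectory as damping factor. The a priori bound keeps it where the cutoff is 1. *)
apply: (apriori (fun t => cutoff r (x t)) x) => // [s|k]; first exact: cutoff_itv.
by apply: derivT_eqd (dx k) => s _; exact: G'E.
Qed.

(** Gronwall for the squared Euclidean distance. Two given solutions are continuous, hence bounded
    on [0, T], so the Lipschitz constant of a single ball is enough. *)
Theorem ode_unique (G : R -> (I -> R) -> I -> R) (x y : R -> I -> R) :
  (forall i, loclip (fun t x => G t x i)) -> x 0 = y 0 ->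
  (forall i, derivT (x ^~ i) (fun t => G t (x t) i)) ->
  (forall i, derivT (y ^~ i) (fun t => G t (y t) i)) ->
  forall t i, 0 <= t <= T -> x t i = y t i.
Proof.
move=> lG xy0 dx dy t i ht.
have bnd (z : R -> I -> R) (dz : I -> R -> R) : (forall i, derivT (z ^~ i) (dz i)) ->
    exists2 r, 0 <= r & forall i t, 0 <= t <= T -> `|z t i| <= r.
  move=> hz; apply: (@finite_bound (fun i r => forall t, 0 <= t <= T -> `|z t i| <= r)).
    by move=> j M M' MM h s /h; move/le_trans; apply.
  by move=> j; apply: contT_bounded => //; exact: derivT_cont (hz j).
have [r1 r10 hr1] := bnd _ _ dx; have [r2 r20 hr2] := bnd _ _ dy.
pose r := r1 + r2.
have [L L0 hL] : exists2 L, 0 <= L & forall i t x y d, 0 <= d -> 0 <= t <= T ->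
    (forall i, `|x i| <= r) -> (forall i, `|y i| <= r) ->
    (forall i, `|x i - y i| <= d) -> `|G t x i - G t y i| <= L * d.
  apply: (@finite_bound (fun i L => forall t x y d, 0 <= d -> 0 <= t <= T ->
    (forall i, `|x i| <= r) -> (forall i, `|y i| <= r) ->
    (forall i, `|x i - y i| <= d) -> `|G t x i - G t y i| <= L * d)).
    move=> j A B AB h s a b d d0 hs hx hy hd; rewrite (le_trans (h s a b d d0 hs hx hy hd))//.
    by rewrite ler_wpM2r.
  by move=> j; have [L L0 hL] := (lG j).2 r; exists L => // s a b d _; exact: hL.
pose w s := \sum_j (x s j + -1 * y s j) ^+ 2.
pose dw s := \sum_j 2 * ((x s j + -1 * y s j) * (G s (x s) j + -1 * G s (y s) j)).
have Dw : derivT w dw.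
  apply: derivT_sum => j; apply: derivT_sqr => //.
  exact: derivT_add (dx j) (derivT_cmul (-1) (dy j)).
have w_ge0 s : 0 <= w s by apply: sumr_ge0 => j _; exact: sqr_ge0.
pose N : R := (size (index_enum I))%:R.
have key s : 0 <= s <= T -> dw s <= (N * (2 * L)) * w s + 0.
  move=> hs; pose d := Num.sqrt (w s).
  have dE : d ^+ 2 = w s by rewrite sqr_sqrtr.
  have hd j : `|x s j - y s j| <= d.
    rewrite -sqrtr_sqr ler_sqrt// -mulN1r /w (bigD1 j)//= lerDl.
    by apply: sumr_ge0 => k _; exact: sqr_ge0.
  have hG j : `|G s (x s) j - G s (y s) j| <= L * d.
    apply: hL => // [|k|k]; first exact: sqrtr_ge0.
      by rewrite (le_trans (hr1 k s hs))// lerDl.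
    by rewrite (le_trans (hr2 k s hs))// lerDr.
  rewrite addr0 /dw; apply: le_trans (_ : \sum_(j : I) 2 * L * w s <= _).
    apply: ler_sum => j _; rewrite -mulrA ler_pM2l//.
    rewrite !mulN1r -dE; apply: le_trans (ler_norm _) _; rewrite normrM.
    apply: le_trans (ler_pM (normr_ge0 _) (normr_ge0 _) (hd j) (hG j)) _.
    by rewrite expr2 mulrCA.
  rewrite big_const_seq iter_addr addr0 -mulr_natl count_predT -/N; lra.
have NL : 0 <= N * (2 * L) by rewrite !mulr_ge0.
have w00 : w 0 = 0 by rewrite /w big1// => j _; rewrite xy0 mulN1r subrr expr0n.
have := gronwall T0 NL (lexx 0) _ Dw key ht; rewrite w00 lexx => /(_ isT).
rewrite mul0r addr0 mul0r => wt.
have /eqP : w t = 0 by apply/eqP; rewrite eq_le wt w_ge0.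
rewrite psumr_eq0; last by move=> j _; exact: sqr_ge0.
move=> /allP /(_ i (mem_index_enum i)) /=; rewrite sqrf_eq0 mulN1r subr_eq0.
by move/eqP.
Qed.

End LocallyLipschitz.

(** * Finite-dimensional semi-definite spaces *)

Section InnerProduct.
Variables (R : realType) (V : lmodType R).
Implicit Types (X Y : set V) (s : V -> V -> R) (x y z : V).

(* Semi-definite only: equality almost everywhere is not Leibniz equality. *)
Record sip X s : Prop := Sip {
  sip_0 : X 0;
  sip_X : forall (a : R) x y, X x -> X y -> X (a *: x + y);
  sip_lin : forall (a : R) x y z, X x -> X y -> X z ->
    s (a *: x + y) z = a * s x z + s y z;
  sip_sym : forall x y, X x -> X y -> s x y = s y x;
  sip_ge0 : forall x, X x -> 0 <= s x x }.

(** Linear functionals that descend to the quotient by null vectors; the second clause replaces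
    well-definedness on classes of functions. *)
Definition lfun X s (l : V -> R) :=
  (forall (a : R) x y, X x -> X y -> l (a *: x + y) = a * l x + l y) /\
  (forall x, X x -> s x x = 0 -> l x = 0).

Lemma sip_sub X Y s : Y `<=` X -> Y 0 ->
  (forall (a : R) x y, Y x -> Y y -> Y (a *: x + y)) -> sip X s -> sip Y s.
Proof.
move=> YX Y0 Ylin [_ _ hl hs hg]; split => //.
- by move=> a x y z /YX ? /YX ? /YX ?; exact: hl.
- by move=> x y /YX ? /YX ?; exact: hs.
- by move=> x /YX; exact: hg.
Qed.

Section Fixed.
Variables (X : set V) (s : V -> V -> R).
Hypothesis hs : sip X s.

Lemma sipZ (a : R) x : X x -> X (a *: x).
Proof. by move=> hx; rewrite -(addr0 (a *: x)); apply: (sip_X hs) => //; exact: (sip_0 hs). Qed.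

Lemma sipD x y : X x -> X y -> X (x + y).
Proof. by move=> hx hy; rewrite -(scale1r x); exact: (sip_X hs). Qed.

Lemma sipB x y : X x -> X y -> X (x - y).
Proof. by move=> hx hy; rewrite addrC -scaleN1r; exact: (sip_X hs). Qed.

Lemma sip0l y : X y -> s 0 y = 0.
Proof.
move=> hy; have := sip_lin hs 1 (sip_0 hs) (sip_0 hs) hy.
by rewrite scale1r addr0 mul1r => /eqP; rewrite -subr_eq0 opprD addrA subrr add0r oppr_eq0 => /eqP.
Qed.

Lemma sipZl a x y : X x -> X y -> s (a *: x) y = a * s x y.
Proof.
move=> hx hy; have := sip_lin hs a hx (sip_0 hs) hy.
by rewrite addr0 sip0l// addr0.
Qed.

Lemma sipDl x y z : X x -> X y -> X z -> s (x + y) z = s x z + s y z.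
Proof. by move=> hx hy hz; rewrite -[x]scale1r (sip_lin hs)// mul1r scale1r. Qed.

Lemma sipBl x y z : X x -> X y -> X z -> s (x - y) z = s x z - s y z.
Proof.
by move=> hx hy hz; rewrite addrC -scaleN1r (sip_lin hs)// mulN1r addrC.
Qed.

Lemma sip_lfun y : X y -> (forall x, X x -> s x x = 0 -> s x y = 0) -> lfun X s (s ^~ y).
Proof. by move=> hy hn; split => // a x z hx hz; exact: (sip_lin hs). Qed.

Lemma sip_sum (I : Type) (r : seq I) (a : I -> R) (e : I -> V) :
  (forall i, X (e i)) -> X (\sum_(i <- r) a i *: e i).
Proof.
move=> he; elim: r => [|i r IH]; first by rewrite big_nil; exact: (sip_0 hs).
by rewrite big_cons; exact: (sip_X hs).
Qed.

Lemma lfun0 l : lfun X s l -> l 0 = 0.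
Proof. by move=> [_]; apply; [exact: (sip_0 hs)|rewrite sip0l//; exact: (sip_0 hs)]. Qed.

Lemma lfun_sum l (I : Type) (r : seq I) (a : I -> R) (e : I -> V) : lfun X s l ->
  (forall i, X (e i)) -> l (\sum_(i <- r) a i *: e i) = \sum_(i <- r) a i * l (e i).
Proof.
move=> hl he; elim: r => [|i r IH]; first by rewrite !big_nil; exact: lfun0.
by rewrite !big_cons hl.1// ?IH//; exact: sip_sum.
Qed.

Lemma lfunB l x y : lfun X s l -> X x -> X y -> l (x - y) = l x - l y.
Proof. by move=> hl hx hy; rewrite addrC -scaleN1r hl.1// mulN1r addrC. Qed.

Lemma lfun_eq l x y : lfun X s l -> X x -> X y -> s (x - y) (x - y) = 0 -> l x = l y.
Proof.
move=> hl hx hy h; apply/eqP; rewrite -subr_eq0 -lfunB//.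
by apply/eqP; apply: hl.2 => //; exact: sipB.
Qed.

Lemma sip_suml y (I : Type) (r : seq I) (a : I -> R) (e : I -> V) : X y ->
  (forall i, X (e i)) -> s (\sum_(i <- r) a i *: e i) y = \sum_(i <- r) a i * s (e i) y.
Proof.
move=> hy he; elim: r => [|i r IH]; first by rewrite !big_nil sip0l.
by rewrite !big_cons (sip_lin hs)// ?IH//; exact: sip_sum.
Qed.

Lemma sip_cs x y : X x -> X y -> s x y ^+ 2 <= s x x * s y y.
Proof.
move=> hx hy.
have key (t : R) : 0 <= t ^+ 2 * s x x + 2 * t * s x y + s y y.
  have h : X (t *: x + y) by exact: (sip_X hs).
  have := sip_ge0 hs h; rewrite (sip_lin hs)// (sip_sym hs hx h) (sip_sym hs hy h).
  by rewrite !(sip_lin hs)// (sip_sym hs hy hx); lra.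
have a0 := sip_ge0 hs hx; have c0 := sip_ge0 hs hy.
have [a00|an0] := eqVneq (s x x) 0.
  (* When s x x = 0 and s x y is nonzero, this t gives the quadratic the value -1, which is
     impossible. So null vectors are orthogonal to everything. *)
  have h1 := key (- (s y y + 1) / (2 * s x y)).
  have [->|bn0] := eqVneq (s x y) 0; first by rewrite expr0n mulr_ge0.
  move: h1; rewrite a00 mulr0 add0r.
  have -> : 2 * (- (s y y + 1) / (2 * s x y)) * s x y = - (s y y + 1).
    by rewrite mulrAC mulrC mulfVK// mulf_neq0.
  lra.
have h1 := key (- s x y / s x x).
have ap : 0 < s x x by rewrite lt_def an0.
have e1 : (- s x y / s x x) * s x x = - s x y by rewrite mulfVK.
have : 0 <= s x x * ((- s x y / s x x) ^+ 2 * s x x + 2 * (- s x y / s x x) * s x y + s y y).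
  by rewrite mulr_ge0.
set u := - s x y / s x x in e1 *.
have -> : s x x * (u ^+ 2 * s x x + 2 * u * s x y + s y y) =
  (u * s x x) ^+ 2 + 2 * (u * s x x) * s x y + s x x * s y y by lra.
by rewrite e1; lra.
Qed.

Lemma sip_null x y : X x -> X y -> s x x = 0 -> s x y = 0.
Proof.
move=> hx hy h; have := sip_cs hx hy; rewrite h mul0r => h2.
by apply/eqP; rewrite -sqrf_eq0 eq_le h2 sqr_ge0.
Qed.

Lemma sip_lfunl y : X y -> lfun X s (s ^~ y).
Proof. by move=> hy; apply: sip_lfun => // x hx h; exact: sip_null. Qed.

Lemma sip_cs_sqrt x y : X x -> X y -> `|s x y| <= Num.sqrt (s x x) * Num.sqrt (s y y).
Proof.
move=> hx hy; rewrite -sqrtr_sqr -sqrtrM ?(sip_ge0 hs)// ler_sqrt; first exact: sip_cs.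
by rewrite mulr_ge0 ?(sip_ge0 hs).
Qed.

Lemma sip_triangle x y : X x -> X y ->
  Num.sqrt (s (x + y) (x + y)) <= Num.sqrt (s x x) + Num.sqrt (s y y).
Proof.
move=> hx hy; have hxy := sipD hx hy.
rewrite -[leRHS]ger0_norm; last by rewrite addr_ge0 ?sqrtr_ge0.
rewrite -sqrtr_sqr ler_sqrt ?sqr_ge0//.
rewrite sipDl// (sip_sym hs hx hxy) (sip_sym hs hy hxy) !sipDl// (sip_sym hs hy hx).
rewrite sqrrD !sqr_sqrtr ?(sip_ge0 hs)//.
have := le_trans (ler_norm _) (sip_cs_sqrt hx hy); lra.
Qed.

Lemma sip_normZ a x : X x -> Num.sqrt (s (a *: x) (a *: x)) = `|a| * Num.sqrt (s x x).
Proof.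
move=> hx; rewrite sipZl ?(sip_sym hs hx (sipZ a hx)) ?sipZl//; try exact: sipZ.
by rewrite mulrA -expr2 sqrtrM ?sqr_ge0// sqrtr_sqr.
Qed.

Lemma sip_norm_sum (I : Type) (r : seq I) (a : I -> R) (e : I -> V) : (forall i, X (e i)) ->
  Num.sqrt (s (\sum_(i <- r) a i *: e i) (\sum_(i <- r) a i *: e i)) <=
  \sum_(i <- r) `|a i| * Num.sqrt (s (e i) (e i)).
Proof.
move=> he; elim: r => [|i r IH]; first by rewrite !big_nil sip0l ?sqrtr0//; exact: (sip_0 hs).
rewrite !big_cons (le_trans (sip_triangle _ _))//; [exact: sipZ|exact: sip_sum|].
by rewrite sip_normZ// lerD2l.
Qed.

Definition orthonormal n (e : 'I_n -> V) :=
  (forall i, X (e i)) /\ forall i j, s (e i) (e j) = (i == j)%:R.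

Definition obasis n (e : 'I_n -> V) := orthonormal e /\
  forall x, X x -> let r := x - \sum_i s x (e i) *: e i in s r r = 0.

Lemma ortho_coord n (e : 'I_n -> V) (a : 'I_n -> R) j : orthonormal e ->
  s (\sum_i a i *: e i) (e j) = a j.
Proof.
move=> [he ho]; rewrite sip_suml// (bigD1 j)//= ho eqxx mulr1 big1 ?addr0//.
by move=> i ij; rewrite ho (negbTE ij) mulr0.
Qed.

Lemma ortho_norm n (e : 'I_n -> V) (a : 'I_n -> R) : orthonormal e ->
  s (\sum_i a i *: e i) (\sum_i a i *: e i) = \sum_i a i ^+ 2.
Proof.
move=> he; have hX := sip_sum (index_enum 'I_n) a he.1.
rewrite sip_suml//; last exact: he.1.
by apply: eq_bigr => i _; rewrite (sip_sym hs (he.1 i) hX) ortho_coord.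
Qed.

(* [rel x a]: x has coefficients a, which need not be unique (on degenerate cells or in
   an overcomplete family). *)
Definition findim := exists N (rel : V -> 'rV[R]_N -> Prop),
  [/\ rel 0 0, forall (c : R) x y a b, rel x a -> rel y b -> rel (c *: x + y) (c *: a + b),
   forall x, X x -> exists a, rel x a & forall x, X x -> rel x 0 -> s x x = 0].

(** A maximal orthonormal family is a basis. More than N orthonormal vectors would have linearly
    dependent coefficient rows, hence a nontrivial combination with coefficients 0, which is null
    and contradicts [ortho_norm]. A non-null residual could be normalized and added to a maximal
    family. *)
Lemma findim_basis : findim -> exists n (e : 'I_n -> V), obasis e.
Proof.
move=> [N [rel [rel00 rel_lin rel_ex rel0]]].
pose P n := `[< exists e : 'I_n -> V, orthonormal e >].
have P0 : exists n, P n.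
  by exists 0%N; apply/asboolP; exists (fun=> 0); split => [[]|[]].
have Pb n : P n -> (n <= N)%N.
  move=> /asboolP [e [he ho]]; rewrite leqNgt; apply/negP => nN.
  have /choice [a ha] : forall i, exists a, rel (e i) a by move=> i; exact: rel_ex.
  pose A : 'M[R]_(n, N) := \matrix_(i, j) a i 0 j.
  have : kermx A != 0.
    rewrite -mxrank_eq0 mxrank_ker subn_eq0 -ltnNge.
    exact: leq_ltn_trans (rank_leq_col A) nN.
  move=> /rowV0Pn [c /sub_kermxP cA cn0].
  pose x := \sum_i c 0 i *: e i.
  have relx : rel x 0.
    have -> : 0 = \sum_i c 0 i *: a i.
      apply/rowP => j; have := congr1 (fun M : 'rV_N => M 0 j) cA.
      rewrite !mxE => e0; rewrite summxE -[LHS]e0.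
      by apply: eq_bigr => i _; rewrite !mxE.
    rewrite /x; elim: (index_enum _) => [|i r IH]; first by rewrite !big_nil.
    by rewrite !big_cons; apply: rel_lin.
  have := rel0 x (sip_sum _ _ he) relx; rewrite ortho_norm//.
  move=> /eqP; rewrite psumr_eq0; last by move=> i _; exact: sqr_ge0.
  move=> /allP c0; case/eqP: cn0; apply/rowP => i; rewrite mxE.
  by have := c0 i (mem_index_enum i); rewrite /= sqrf_eq0 => /eqP.
case: (ex_maxnP P0 Pb) => n /asboolP [e he] hmax.
exists n, e; split => // x hx r; apply/eqP/negPn/negP => rn0.
have [heX heo] := he.
have hr : X r by apply: sipB => //; exact: sip_sum.
have rp : 0 < s r r by rewrite lt_def rn0 (sip_ge0 hs).
have re i : s r (e i) = 0.
  rewrite /r sipBl//; last exact: sip_sum.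
  by rewrite ortho_coord// subrr.
pose k := (Num.sqrt (s r r))^-1.
have kk : k * (k * s r r) = 1.
  rewrite mulrA -invfM -expr2 sqr_sqrtr ?(sip_ge0 hs)// mulVf//.
pose e' (i : 'I_n.+1) := if unlift ord_max i is Some j then e j else k *: r.
have hkr := sipZ k hr.
have : (n.+1 <= n)%N; last by rewrite ltnn.
apply: hmax; apply/asboolP; exists e'; split=> [i|i j].
  by rewrite /e'; case: unliftP.
rewrite /e'; case: unliftP => [i' ->|->]; case: unliftP => [j' ->|->].
- by rewrite heo (inj_eq (@lift_inj _ _)).
- rewrite (sip_sym hs (heX _) hkr) sipZl// re mulr0.
  by rewrite eq_sym (negbTE (neq_lift _ _)).
- by rewrite sipZl// re mulr0 (negbTE (neq_lift _ _)).
- by rewrite sipZl// (sip_sym hs hr hkr) sipZl// kk eqxx.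
Qed.

Lemma lfun_basis n (e : 'I_n -> V) l x : obasis e -> lfun X s l -> X x ->
  l x = \sum_i s x (e i) * l (e i).
Proof.
move=> [[he ho] hb] hl hx; rewrite -(lfun_sum _ _ hl he).
by apply: lfun_eq => //; [exact: sip_sum|exact: hb].
Qed.

End Fixed.

Lemma findim_sub X Y s : Y `<=` X -> findim X s -> findim Y s.
Proof.
move=> YX [N [rel [h1 h2 h3 h4]]]; exists N, rel; split => //.
- by move=> x /YX; exact: h3.
- by move=> x /YX; exact: h4.
Qed.

End InnerProduct.

(** * Right inverses orthogonal to the kernel *)

Section Lifting.
Variables (R : realType) (V W : lmodType R).
Variables (X : set V) (s : V -> V -> R) (Q : set W) (sQ : W -> W -> R).
Hypotheses (hX : sip X s) (hQ : sip Q sQ).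
Variables (n m : nat) (e : 'I_n -> V) (q : 'I_m -> W).
Hypotheses (he : obasis X s e) (hq : obasis Q sQ q).
Variable b : V -> W -> R.
Hypotheses (bl : forall w, Q w -> lfun X s (b ^~ w)) (br : forall x, X x -> lfun Q sQ (b x)).

Let row_norm_eq0 p (u : 'rV[R]_p) : u *m u^T = 0 -> u = 0.
Proof.
move=> h0; have := congr1 (fun A => fun_of_matrix A 0 0) h0; rewrite !mxE => /eqP.
under eq_bigr do rewrite mxE.
rewrite psumr_eq0; last by move=> i _; rewrite -expr2; exact: sqr_ge0.
move=> /allP c0; apply/rowP => i; rewrite mxE.
by have := c0 i (mem_index_enum i); rewrite /= mulf_eq0 orbb => /eqP.
Qed.

(** The hypothesis says that the matrix B of b has full column rank, so its Gram matrix is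
    invertible and L = (B^T B)^-1 B^T is a left inverse. The rows of L are the coefficients of the
    lifted fields; they are combinations of the columns of B, hence orthogonal to every x on which b
    vanishes. *)
Lemma lifting : (forall w, Q w -> (forall x, X x -> b x w = 0) -> sQ w w = 0) ->
  exists la : 'I_m -> V, [/\ forall k, X (la k),
    forall k l, b (la k) (q l) = (k == l)%:R &
    forall x k, X x -> (forall w, Q w -> b x w = 0) -> s (la k) x = 0].
Proof.
move=> inj; have [[heX heo] heb] := he; have [[hqX hqo] hqb] := hq.
pose B : 'M[R]_(n, m) := \matrix_(i, l) b (e i) (q l).
have Binj (v : 'rV[R]_m) : v *m B^T = 0 -> v = 0.
  move=> vB; pose w := \sum_l v 0 l *: q l.
  have hw : Q w by exact: (sip_sum hQ).
  have := inj w hw; have h : forall x, X x -> b x w = 0.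
    move=> x hx; rewrite (lfun_basis hX he (bl hw) hx) big1// => i _.
    have := congr1 (fun M : 'rV_n => M 0 i) vB; rewrite !mxE.
    rewrite (lfun_sum hQ _ _ (br (heX i)) hqX) => e0.
    have -> : \sum_(i0 <- index_enum 'I_m) v 0 i0 * b (e i) (q i0) = 0.
      by rewrite -[RHS]e0; apply: eq_bigr => l _; rewrite !mxE.
    by rewrite mulr0.
  move=> /(_ h); rewrite (ortho_norm hQ)// => /eqP.
  rewrite psumr_eq0; last by move=> i _; exact: sqr_ge0.
  move=> /allP c0; apply/rowP => i; rewrite mxE.
  by have := c0 i (mem_index_enum i); rewrite /= sqrf_eq0 => /eqP.
pose M := B^T *m B.
have Mu : M \in unitmx.
  rewrite -row_free_unit; apply: inj_row_free => v vM; apply: Binj.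
  have : v *m B^T *m (v *m B^T)^T = 0.
    by rewrite trmx_mul trmxK mulmxA -(mulmxA v) -/M vM mul0mx.
  exact: row_norm_eq0.
pose L := invmx M *m B^T.
have LB : L *m B = 1%:M by rewrite -mulmxA mulVmx.
exists (fun k => \sum_i L k i *: e i); split.
- by move=> k; exact: (sip_sum hX).
- move=> k l; rewrite (lfun_sum hX _ _ (bl (hqX l)) heX).
  have := congr1 (fun A => fun_of_matrix A k l) LB; rewrite !mxE => <-.
  by apply: eq_bigr => i _; rewrite !mxE.
move=> x k hx bx0; rewrite (sip_suml hX)//.
have xB : (\row_i s x (e i)) *m B = 0.
  apply/rowP => l; rewrite !mxE.
  have := lfun_basis hX he (bl (hqX l)) hx; rewrite bx0// => h0.
  by apply: etrans (esym h0); apply: eq_bigr => i _; rewrite !mxE.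
have : L *m (\row_i s x (e i))^T = 0.
  by rewrite /L -mulmxA -trmx_mul xB trmx0 mulmx0.
move=> /(congr1 (fun A => fun_of_matrix A k 0)); rewrite !mxE => h0; apply: etrans h0.
by apply: eq_bigr => i _; rewrite !mxE (sip_sym hX).
Qed.

End Lifting.

(** * Weak derivatives *)

Section WeakDerivatives.
Variables (R : realType) (Om : set (pt R)).
Hypothesis oOm : open Om.
Hypothesis bOm : exists r : R, forall x, Om x -> enorm x <= r.
Implicit Types (f g q phi : pt R -> R) (u v w Phi : pt R -> pt R).

Let mO : measurable Om := mOm oOm.
Let fO : (mu3 R Om < +oo)%E := fOm oOm bOm.

Lemma fct_lin (a : R) f g (x : pt R) : (a *: f + g) x = a * f x + g x.
Proof. by []. Qed.

Lemma smooth_lin (a : R) f g : smooth f -> smooth g -> smooth (a *: f + g).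
Proof.
move=> hf hg s; suff -> : foldr (fun i : 'I_3 => pd i) (a *: f + g) s =
    a *: foldr (fun i : 'I_3 => pd i) f s + foldr (fun i : 'I_3 => pd i) g s.
  by move=> x; apply: differentiableD; [apply: differentiableZ; exact: hf|exact: hg].
elim: s => //= i s ->; apply/funext => x.
rewrite /pd deriveD ?deriveZ//; try exact: diff_derivable.
by apply: derivableZ; exact: diff_derivable.
Qed.

Lemma pd_lin (a : R) f g (i : nat) : smooth f -> smooth g ->
  pd i (a *: f + g) = a *: pd i f + pd i g.
Proof.
move=> hf hg; apply/funext => x.
have df : derivable f x (ev R i) by apply: diff_derivable; exact: (hf [::] x).
have dg : derivable g x (ev R i) by apply: diff_derivable; exact: (hg [::] x).
have dfa : derivable (a \*: f) x (ev R i) by exact: derivableZ.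
by rewrite {1}/pd (deriveD dfa dg) (deriveZ a df).
Qed.

Lemma smooth_cst (c : R) : smooth (fun=> c : R).
Proof. by apply: flatalg_smooth; constructor. Qed.

Lemma test0 : test Om (fun=> 0 : R).
Proof.
split; first exact: smooth_cst.
by exists set0; split => //; exact: compact0.
Qed.

Lemma test_lin (a : R) f g : test Om f -> test Om g -> test Om (a *: f + g).
Proof.
move=> [sf [K [cK KO Kf]]] [sg [K' [cK' KO' Kg]]]; split; first exact: smooth_lin.
exists (K `|` K'); split; [exact: compactU|by move=> x []; [exact: KO|exact: KO']|].
move=> x /not_orP [hK hK']; by rewrite fct_lin Kf// Kg// mulr0 addr0.
Qed.

Lemma smooth_L2 phi : smooth phi -> L2 Om phi.
Proof. by move=> h; apply: bnd_L2 => //; exact: smooth_bnd. Qed.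

Lemma L2v_cgrad phi : smooth phi -> L2v Om (cgrad phi).
Proof.
move=> h; case=> [[|[|[|//]]]] hi; apply: smooth_L2;
  [exact: (smooth_pd 0 h)|exact: (smooth_pd 1 h)|exact: (smooth_pd 2%:R h)].
Qed.

Lemma L2v_ccurl Phi : vsmooth Phi -> L2v Om (ccurl Phi).
Proof.
move=> h; have S (i j : 'I_3) := smooth_L2 (smooth_pd i (h j)).
by case=> [[|[|[|//]]]] hi; apply: L2_sub => //;
  [exact: (S 1 2%:R)|exact: (S 2%:R 1)|exact: (S 2%:R 0)|exact: (S 0 2%:R)
  |exact: (S 0 1)|exact: (S 1 0)].
Qed.

Lemma sip_L2 : sip (L2 Om) (ip Om).
Proof.
split; [exact: (L2_cst mO fO 0)|exact: L2_lin|exact: ip_lin| |].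
  by move=> *; exact: ip_sym.
by move=> *; exact: ip_ge0.
Qed.

Lemma L2v0 : L2v Om (0 : pt R -> pt R).
Proof.
move=> i; rewrite (_ : _ \o _ = (fun=> 0)); first exact: L2_cst.
by apply/funext => x /=; case: i => [[|[|[|]]]].
Qed.

Lemma sip_L2v : sip (L2v Om) (vip Om).
Proof.
split; [exact: L2v0|exact: L2v_lin|exact: vip_lin| |].
  by move=> *; exact: vip_sym.
by move=> *; exact: vip_ge0.
Qed.

Definition vec (i : nat) phi : pt R -> pt R := fun x => phi x *: ev R i.

Lemma co_vec (i : 'I_3) (j : nat) phi :
  co i \o vec j phi = if i == j :> nat then phi else fun=> 0.
Proof.
have coE (x : pt R) : (co i \o vec j phi) x = phi x * (i == j :> nat)%:R.
  rewrite /vec /= -(addr0 (_ *: _)) co_lin.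
  by case: i => [[|[|[|//]]]] hi; rewrite /co /ev /= addr0 [_ == j]eq_sym.
apply/funext => x; rewrite coE; case: eqP => _; by rewrite ?mulr1 ?mulr0.
Qed.

Lemma vtest_vec (i : nat) phi : test Om phi -> vtest Om (vec i phi).
Proof. by move=> h j; rewrite co_vec; case: ifP => // _; exact: test0. Qed.

Lemma ip0r f : L2 Om f -> ip Om f (fun=> 0) = 0.
Proof. by move=> hf; rewrite ip_sym; exact: (sip0l sip_L2). Qed.

Lemma vip_vec (i : 'I_3) phi w : L2 Om phi -> L2v Om w ->
  vip Om w (vec i phi) = ip Om (co i \o w) phi.
Proof.
move=> hphi hw; rewrite vip_sum//; last first.
  by move=> j; rewrite co_vec; case: ifP => // _; exact: L2_cst.
rewrite (bigD1 i)//= co_vec eqxx /= big1 ?addr0// => j ji.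
by rewrite co_vec (_ : _ == _ = false) ?ip0r//; exact: negbTE.
Qed.

Lemma test_L2 phi : test Om phi -> L2 Om phi.
Proof. by case=> h _; exact: smooth_L2. Qed.

Lemma ip_test_eq f g : L2 Om f -> L2 Om g ->
  (forall phi, test Om phi -> ip Om f phi = ip Om g phi) -> aeq Om f g.
Proof.
move=> hf hg h.
have := @fundamental_lemma R Om oOm bOm (-1 *: g + f) (L2_lin mO _ hg hf).
have h0 : forall phi, test Om phi -> ip Om (-1 *: g + f) phi = 0.
  by move=> phi tp; rewrite ip_lin//; [rewrite h// mulN1r addrC subrr|exact: test_L2].
move=> /(_ h0); apply: filterS => x e Ox; have := e Ox.
by rewrite fct_lin mulN1r addrC => /eqP; rewrite subr_eq0 => /eqP.
Qed.

Lemma weak_div_lin (a : R) u v d d' : weak_div Om u d -> weak_div Om v d' ->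
  weak_div Om (a *: u + v) (a *: d + d').
Proof.
move=> [Lu Ld hu] [Lv Ld' hv]; split; [exact: L2v_lin|exact: L2_lin|].
move=> phi tp; rewrite vip_lin//; last by apply: L2v_cgrad; case: tp.
by rewrite ip_lin ?hu ?hv//; [lra|exact: test_L2].
Qed.

(** For u = v this is uniqueness; for u = v almost everywhere it makes the chosen divergence
    independent of the representative. The same form serves for the curl and the gradient. *)
Lemma weak_div_unique u v d d' : weak_div Om u d -> weak_div Om v d' -> aeq Om u v ->
  aeq Om d d'.
Proof.
move=> [Lu Ld hu] [Lv Ld' hv] uv; apply: ip_test_eq => // phi tp.
apply: oppr_inj; rewrite -hu// -hv//.
by apply: vip_aeq => //; [apply: L2v_cgrad; case: tp|apply: L2v_cgrad; case: tp|exact: aeq_refl].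
Qed.

Lemma weak_curl_lin (a : R) u v w w' : weak_curl Om u w -> weak_curl Om v w' ->
  weak_curl Om (a *: u + v) (a *: w + w').
Proof.
move=> [Lu Ld hu] [Lv Ld' hv]; split; [exact: L2v_lin|exact: L2v_lin|].
move=> Phi tp; rewrite vip_lin//; last by apply: L2v_ccurl => i; case: (tp i).
by rewrite vip_lin ?hu ?hv// => i; exact: test_L2.
Qed.

Lemma weak_curl_unique u v w w' : weak_curl Om u w -> weak_curl Om v w' -> aeq Om u v ->
  aeq Om w w'.
Proof.
move=> [Lu Lw hu] [Lv Lw' hv] uv; apply: aeq_co => i; apply: ip_test_eq => // phi tp.
(* Test fields with a single nonzero component reduce the claim to the scalar fundamental lemma. *)
rewrite -!vip_vec//; try exact: test_L2.
rewrite -hu; last exact: vtest_vec.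
rewrite -hv; last exact: vtest_vec.
have L : L2v Om (ccurl (vec i phi)) by apply: L2v_ccurl => j; case: (vtest_vec i tp j).
by apply: vip_aeq => //; exact: aeq_refl.
Qed.

Lemma weak_grad_lin (a : R) f g u v : weak_grad Om f u -> weak_grad Om g v ->
  weak_grad Om (a *: f + g) (a *: u + v).
Proof.
move=> [Lu Ld hu] [Lv Ld' hv]; split; [exact: L2_lin|exact: L2v_lin|].
move=> phi i tp; have Lp : L2 Om (pd i phi) by apply: smooth_L2; apply: smooth_pd; case: tp.
rewrite ip_lin// hu// hv// co_comp_lin ip_lin//; [lra|exact: test_L2].
Qed.

Lemma weak_grad_unique f g u v : weak_grad Om f u -> weak_grad Om g v -> aeq Om f g ->
  aeq Om u v.
Proof.
move=> [Lu Lw hu] [Lv Lw' hv] uv; apply: aeq_co => i; apply: ip_test_eq => // phi tp.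
apply: oppr_inj; rewrite -hu// -hv//.
have Lp : L2 Om (pd i phi) by apply: smooth_L2; apply: smooth_pd; case: tp.
by apply: ip_aeq => //; exact: aeq_refl.
Qed.

Lemma wdivP v : (exists d, weak_div Om v d) -> weak_div Om v (wdiv Om v).
Proof. exact: (@xgetPex _ _ [set d | weak_div Om v d]). Qed.

Lemma wcurlP v : (exists w, weak_curl Om v w) -> weak_curl Om v (wcurl Om v).
Proof. exact: (@xgetPex _ _ [set d | weak_curl Om v d]). Qed.

Lemma wgradP f : (exists u, weak_grad Om f u) -> weak_grad Om f (wgrad Om f).
Proof. exact: (@xgetPex _ _ [set d | weak_grad Om f d]). Qed.

Lemma weak_div0 : weak_div Om (0 : pt R -> pt R) (0 : pt R -> R).
Proof.
split; [exact: L2v0|exact: (sip_0 sip_L2)|].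
move=> phi tp; rewrite (sip0l sip_L2v); last by apply: L2v_cgrad; case: tp.
by rewrite (sip0l sip_L2) ?oppr0//; exact: test_L2.
Qed.

Lemma weak_curl0 : weak_curl Om (0 : pt R -> pt R) (0 : pt R -> pt R).
Proof.
split; [exact: L2v0|exact: L2v0|].
move=> Phi tp; rewrite (sip0l sip_L2v); last by apply: L2v_ccurl => i; case: (tp i).
by rewrite (sip0l sip_L2v)// => i; exact: test_L2.
Qed.

Lemma weak_grad0 : weak_grad Om (0 : pt R -> R) (0 : pt R -> pt R).
Proof.
split; [exact: (sip_0 sip_L2)|exact: L2v0|].
move=> phi i tp; rewrite (sip0l sip_L2); last by apply: smooth_L2; apply: smooth_pd; case: tp.
rewrite (_ : co i \o 0 = 0); last by apply/funext => x /=; case: i => [[|[|[|]]]].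
by rewrite (sip0l sip_L2) ?oppr0//; exact: test_L2.
Qed.

Lemma vsmooth_L2v Phi : vsmooth Phi -> L2v Om Phi.
Proof. by move=> h i; exact: smooth_L2. Qed.

Lemma H0div_lin (a : R) u v : H0div Om u -> H0div Om v -> H0div Om (a *: u + v).
Proof.
move=> [d [hd h]] [d' [hd' h']]; exists (a *: d + d'); split; first exact: weak_div_lin.
have [Lu Ld _] := hd; have [Lv Ld' _] := hd'.
move=> phi sp; rewrite vip_lin//; last exact: L2v_cgrad.
by rewrite ip_lin ?h ?h'//; [lra|exact: smooth_L2].
Qed.

Lemma H0div0 : H0div Om (0 : pt R -> pt R).
Proof.
exists 0; split; first exact: weak_div0.
move=> phi sp; rewrite (sip0l sip_L2v); last exact: L2v_cgrad.
by rewrite (sip0l sip_L2) ?oppr0//; exact: smooth_L2.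
Qed.

Lemma H0curl_lin (a : R) u v : H0curl Om u -> H0curl Om v -> H0curl Om (a *: u + v).
Proof.
move=> [d [hd h]] [d' [hd' h']]; exists (a *: d + d'); split; first exact: weak_curl_lin.
have [Lu Ld _] := hd; have [Lv Ld' _] := hd'.
move=> Phi sp; rewrite vip_lin//; last exact: L2v_ccurl.
by rewrite vip_lin ?h ?h'//; exact: vsmooth_L2v.
Qed.

Lemma H0curl0 : H0curl Om (0 : pt R -> pt R).
Proof.
exists 0; split; first exact: weak_curl0.
move=> Phi sp; rewrite (sip0l sip_L2v); last exact: L2v_ccurl.
by rewrite (sip0l sip_L2v)//; exact: vsmooth_L2v.
Qed.

Lemma cgrad_lin (a : R) f g : smooth f -> smooth g ->
  cgrad (a *: f + g) = a *: cgrad f + cgrad g.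
Proof.
move=> hf hg; apply/funext => x; apply: co_inj => i.
rewrite [(a *: cgrad f + cgrad g) x]/(a *: cgrad f x + cgrad g x) co_lin.
case: i => [[|[|[|//]]]] hi; rewrite /cgrad /co /=.
- by rewrite (pd_lin a 0 hf hg).
- by rewrite (pd_lin a 1 hf hg).
- by rewrite (pd_lin a 2 hf hg).
Qed.

Lemma snorm_lin (a : R) f g : L2 Om f -> L2 Om g ->
  snorm Om (a *: f + g) <= `|a| * snorm Om f + snorm Om g.
Proof.
move=> hf hg; apply: le_trans (sip_triangle sip_L2 (sipZ sip_L2 a hf) hg) _.
by rewrite (sip_normZ sip_L2).
Qed.

Lemma vnorm_lin (a : R) u v : L2v Om u -> L2v Om v ->
  vnorm Om (a *: u + v) <= `|a| * vnorm Om u + vnorm Om v.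
Proof.
move=> hf hg; apply: le_trans (sip_triangle sip_L2v (sipZ sip_L2v a hf) hg) _.
by rewrite (sip_normZ sip_L2v).
Qed.

Lemma H01_lin (a : R) f g : H01 Om f -> H01 Om g -> H01 Om (a *: f + g).
Proof.
move=> [u [hu Hu]] [v [hv Hv]]; exists (a *: u + v); split; first exact: weak_grad_lin.
move=> e e0; have K0 : 0 < `|a| + 1 by rewrite ltr_wpDl.
have e1 : 0 < e / 2 / (`|a| + 1) by rewrite !divr_gt0.
have e2 : 0 < e / 2 by rewrite divr_gt0.
have [phi tp h1] := Hu _ e1; have [psi ts h2] := Hv _ e2.
exists (a *: phi + psi); first exact: test_lin.
have [Lf Lu _] := hu; have [Lg Lv _] := hv.
have [sp _] := tp; have [ss _] := ts.
have Lp := test_L2 tp; have Lq := test_L2 ts.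
have Gp := L2v_cgrad sp; have Gq := L2v_cgrad ss.
have E1 : a *: f + g - (a *: phi + psi) = a *: (f - phi) + (g - psi).
  by rewrite scalerBr opprD addrACA.
have E2 : a *: u + v - cgrad (a *: phi + psi) = a *: (u - cgrad phi) + (v - cgrad psi).
  by rewrite cgrad_lin// scalerBr opprD addrACA.
rewrite E1 E2.
have B1 := sipB sip_L2 Lf Lp; have B2 := sipB sip_L2 Lg Lq.
have B3 := sipB sip_L2v Lu Gp; have B4 := sipB sip_L2v Lv Gq.
apply: le_lt_trans (lerD (snorm_lin a B1 B2) (vnorm_lin a B3 B4)) _.
set A := snorm _ _ in h1 *; set B := snorm _ _ in h2 *.
set A' := vnorm _ _ in h1 *; set B' := vnorm _ _ in h2 *.
have A0 : 0 <= A by exact: sqrtr_ge0. have A0' : 0 <= A' by exact: sqrtr_ge0.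
have h3 : (`|a| + 1) * (A + A') < e / 2 by move: h1; rewrite ltr_pdivlMr// mulrC.
lra.
Qed.

Lemma H01_0 : H01 Om (0 : pt R -> R).
Proof.
exists 0; split; first exact: weak_grad0.
move=> e e0; exists (fun=> 0); first exact: test0.
have -> : (0 : pt R -> R) - (fun=> 0) = 0 by rewrite subr0.
have -> : (0 : pt R -> pt R) - cgrad (fun=> 0) = 0.
  suff -> : cgrad (fun=> 0 : R) = 0 by rewrite subr0.
  by apply/funext => x; rewrite /cgrad /pd !derive_cst.
by rewrite /snorm /vnorm (sip0l sip_L2) ?(sip0l sip_L2v) ?sqrtr0 ?addr0//;
  [exact: (sip_0 sip_L2v)|exact: (sip_0 sip_L2)].
Qed.

Lemma ip_subl f g q : L2 Om f -> L2 Om g -> L2 Om q ->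
  ip Om (fun x => f x - g x) q = ip Om f q - ip Om g q.
Proof. by move=> hf hg hq; rewrite -(sipBl sip_L2). Qed.

Lemma ip_addl f g q : L2 Om f -> L2 Om g -> L2 Om q ->
  ip Om (fun x => f x + g x) q = ip Om f q + ip Om g q.
Proof. by move=> hf hg hq; rewrite -(sipDl sip_L2). Qed.

Lemma H01_weak_grad f : H01 Om f -> exists u, weak_grad Om f u.
Proof. by move=> [g [hg _]]; exists g. Qed.

(** The trace of the weak gradients of the components. Existence has to be proved, since [wdiv]
    falls back to 0 where there is no weak divergence; the same holds below for the curl, the
    antisymmetric part. *)
Lemma H01v_weak_div v : H01v Om v -> exists d, weak_div Om v d.
Proof.
move=> hv; pose g (i : 'I_3) := wgrad Om (co i \o v).
have G (i : 'I_3) : weak_grad Om (co i \o v) (g i) by apply: wgradP; exact: H01_weak_grad.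
have Lg (i j : 'I_3) : L2 Om (co j \o g i) by have [_ + _] := G i; apply.
have Lv : L2v Om v by move=> i; have [] := G i.
pose D01 x := co 0 (g 0 x) + co 1 (g 1 x).
have L01 : L2 Om D01 by apply: L2_add => //; [exact: (Lg 0 0)|exact: (Lg 1 1)].
exists (fun x => D01 x + co 2 (g 2%:R x)); split;
  [exact: Lv|by apply: (L2_add mO L01); exact: (Lg 2%:R 2%:R)|].
move=> phi tp; have Lp := test_L2 tp.
have P (i j : 'I_3) : ip Om (co i \o v) (pd j phi) = - ip Om (co j \o g i) phi.
  by have [_ _] := G i; apply.
rewrite vip_sum//; last by apply: L2v_cgrad; case: tp.
rewrite !big_ord_recr big_ord0 /= add0r.
rewrite ip_addl//; last exact: (Lg 2%:R 2%:R).
rewrite /D01 ip_addl//; [|exact: (Lg 0 0)|exact: (Lg 1 1)].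
have := P 0 0; have := P 1 1; have := P 2%:R 2%:R; rewrite /= => e2 e1 e0.
rewrite -[ip Om _ _ in LHS]/(ip Om (co 0 \o v) (pd 0 phi)) e0.
rewrite -[X in _ + X + _]/(ip Om (co 1 \o v) (pd 1 phi)) e1.
rewrite -[X in _ + X = _]/(ip Om (co 2 \o v) (pd 2 phi)) e2.
by rewrite !opprD.
Qed.

Lemma H01v_weak_curl v : H01v Om v -> exists w, weak_curl Om v w.
Proof.
move=> hv; pose g (i : 'I_3) := wgrad Om (co i \o v).
have G (i : 'I_3) : weak_grad Om (co i \o v) (g i) by apply: wgradP; exact: H01_weak_grad.
have Lg (i j : 'I_3) : L2 Om (co j \o g i) by have [_ + _] := G i; apply.
have Lv : L2v Om v by move=> i; have [] := G i.
pose w x : pt R := (co 1 (g 2%:R x) - co 2 (g 1 x), co 2 (g 0 x) - co 0 (g 2%:R x),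
  co 0 (g 1 x) - co 1 (g 0 x)).
have Lw : L2v Om w.
  by case=> [[|[|[|//]]]] hi; apply: L2_sub => //;
   [exact: (Lg 2%:R 1)|exact: (Lg 1 2%:R)|exact: (Lg 0 2%:R)|exact: (Lg 2%:R 0)
   |exact: (Lg 1 0)|exact: (Lg 0 1)].
exists w; split; [exact: Lv|exact: Lw|move=> Phi tP].
have sP (i : 'I_3) : smooth (co i \o Phi) by case: (tP i).
have P (i j k : 'I_3) : ip Om (co i \o v) (pd j (co k \o Phi)) = - ip Om (co j \o g i) (co k \o Phi).
  by have [_ _] := G i; apply.
have LPhi (i : 'I_3) : L2 Om (co i \o Phi) by exact: test_L2.
have LdP (i j : 'I_3) : L2 Om (pd i (co j \o Phi)) by apply: smooth_L2; exact: smooth_pd.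
rewrite !vip_sum//; last exact: L2v_ccurl.
rewrite !big_ord_recr !big_ord0 /= !add0r.
have S (i j k l m : 'I_3) :
  ip Om (co i \o v) (fun x => pd j (co k \o Phi) x - pd l (co m \o Phi) x) =
  - ip Om (co j \o g i) (co k \o Phi) + ip Om (co l \o g i) (co m \o Phi).
  rewrite ip_sym ip_subl; [|exact: LdP|exact: LdP|by have [] := G i].
  by rewrite (ip_sym _ (pd j _)) (ip_sym _ (pd l _)) !P opprK.
have S' (i j k l m : 'I_3) :
  ip Om (fun x => co i (g j x) - co k (g l x)) (co m \o Phi) =
  ip Om (co i \o g j) (co m \o Phi) - ip Om (co k \o g l) (co m \o Phi).
  by rewrite ip_subl//; [exact: (Lg j i)|exact: (Lg l k)].
rewrite -[ip Om _ _ in LHS]/(ip Om (co 0 \o v) (fun x => pd 1 (co 2 \o Phi) x - pd 2 (co 1 \o Phi) x)).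
rewrite -[X in _ + X + _ = _]/(ip Om (co 1 \o v) (fun x => pd 2 (co 0 \o Phi) x - pd 0 (co 2 \o Phi) x)).
rewrite -[X in _ + X = _]/(ip Om (co 2 \o v) (fun x => pd 0 (co 1 \o Phi) x - pd 1 (co 0 \o Phi) x)).
rewrite -[X in _ = X + _ + _]/(ip Om (fun x => co 1 (g 2%:R x) - co 2 (g 1 x)) (co 0 \o Phi)).
rewrite -[X in _ = _ + X + _]/(ip Om (fun x => co 2 (g 0 x) - co 0 (g 2%:R x)) (co 1 \o Phi)).
rewrite -[X in _ = _ + X]/(ip Om (fun x => co 0 (g 1 x) - co 1 (g 0 x)) (co 2 \o Phi)).
rewrite (S 0 1 2%:R 2%:R 1) (S 1 2%:R 0 0 2%:R) (S 2%:R 0 1 1 0).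
rewrite (S' 1 2%:R 2%:R 1 0) (S' 2%:R 0 0 2%:R 1) (S' 0 1 1 0 2%:R).
lra.
Qed.

End WeakDerivatives.

(** * Piecewise polynomials *)

Section FiniteSpan.
Variables (R : realType) (P : Type) (V : lmodType R).
Implicit Types S : set (P -> V).

(** Generators need not be independent nor belong to S, which keeps the closure properties below
    immediate. *)
Definition finspan S := exists (I : finType) (g : I -> P -> V),
  forall p, S p -> exists a : I -> R, p = \sum_i a i *: g i.

Lemma finspan_sub S S' : S `<=` S' -> finspan S' -> finspan S.
Proof. by move=> h [I [g hg]]; exists I, g => p /h; exact: hg. Qed.

Lemma finspan1 (f : P -> V) : finspan [set p | exists c : R, p = c *: f].
Proof.
exists unit, (fun=> f) => p [c ->]; exists (fun=> c).
by rewrite (big_pred1 tt)// => -[].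
Qed.

Lemma finspan_add S S' : finspan S -> finspan S' ->
  finspan [set p | exists2 f, S f & exists2 g, S' g & p = f + g].
Proof.
move=> [I [g hg]] [J [g' hg']].
exists (I + J)%type, (fun k => match k with inl i => g i | inr j => g' j end).
move=> p [f /hg [a ->] [f' /hg' [b ->] ->]].
exists (fun k => match k with inl i => a i | inr j => b j end).
by rewrite big_sumType.
Qed.

Lemma finspan_sum n (S : nat -> set (P -> V)) : (forall i, finspan (S i)) ->
  finspan [set p | exists2 f, (forall i, S i (f i)) & p = \sum_(i < n) f i].
Proof.
move=> hS; elim: n => [|n IH].
  by exists 'I_0, (fun _ => 0) => p [f _ ->]; exists (fun=> 0); rewrite !big_ord0.
apply: finspan_sub (finspan_add IH (hS n)) => p [f hf ->].
exists (\sum_(i < n) f i); first by exists f.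
by exists (f n) => //; rewrite big_ord_recr.
Qed.

End FiniteSpan.

Lemma finspan_image (R : realType) (P : Type) (V W : lmodType R)
    (S : set (P -> V)) (L : (P -> V) -> P -> W) :
  (forall (a : R) f g, L (a *: f + g) = a *: L f + L g) -> finspan S ->
  finspan [set p | exists2 f, S f & p = L f].
Proof.
move=> hL [I [g hg]]; exists I, (L \o g) => p [f /hg [a ->] ->]; exists a.
elim: (index_enum I) => [|i r IH]; last by rewrite !big_cons hL IH.
rewrite !big_nil; have := hL 1 0 0; rewrite scaler0 addr0 scale1r => /eqP.
by rewrite -subr_eq0 opprD addrA subrr add0r oppr_eq0 => /eqP.
Qed.

Section Shapes.
Variable R : realType.

Lemma finspan_pol3 d : finspan (@pol3 R d).
Proof.
pose m i j k (x : pt R) : R := co 0 x ^+ i * co 1 x ^+ j * co 2 x ^+ k.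
pose S3 i j k : set (pt R -> R) := [set p | exists c : R, p = c *: m i j k].
pose S2 i j : set (pt R -> R) :=
  [set p | exists2 f, (forall k, S3 i j k (f k)) & p = \sum_(k < d - i - j) f k].
pose S1 i : set (pt R -> R) :=
  [set p | exists2 f, (forall j, S2 i j (f j)) & p = \sum_(j < d - i) f j].
have H2 i j : finspan (S2 i j) := finspan_sum (d - i - j) (fun k => finspan1 (m i j k)).
have H1 i : finspan (S1 i) := finspan_sum (d - i) (H2 i).
apply: finspan_sub (finspan_sum d H1) => p [c hc].
exists (fun i => \sum_(j < d - i) \sum_(k < d - i - j) c i j k *: m i j k).
  move=> i; exists (fun j => \sum_(k < d - i - j) c i j k *: m i j k) => //.
  by move=> j; exists (fun k => c i j k *: m i j k) => // k; exists (c i j k).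
apply/funext => x; rewrite hc !fct_sumE; apply: eq_bigr => i _.
rewrite fct_sumE; apply: eq_bigr => j _; rewrite fct_sumE; apply: eq_bigr => k _.
have -> : (c i j k *: m i j k) x = c i j k * m i j k x by [].
by rewrite /m !mulrA.
Qed.

Lemma coD (i : nat) (x y : pt R) : co i (x + y) = co i x + co i y.
Proof. by rewrite -[x in LHS]scale1r co_lin mul1r. Qed.

Lemma coZ (i : nat) (a : R) (x : pt R) : co i (a *: x) = a * co i x.
Proof.
have co0 : co i (0 : pt R) = 0 by case: i => [|[|[|i]]] //; rewrite /co /= nth_default.
by rewrite -[a *: x]addr0 co_lin co0 addr0.
Qed.

Lemma vec_lin (i : nat) (a : R) (f g : pt R -> R) : vec i (a *: f + g) = a *: vec i f + vec i g.
Proof.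
apply/funext => x; rewrite /vec; rewrite [RHS]/(a *: (f x *: ev R i) + g x *: ev R i).
by rewrite fct_lin scalerDl scalerA.
Qed.

Lemma vec_sum (v : pt R -> pt R) : v = \sum_(i < 3) vec i (co i \o v).
Proof.
apply/funext => x; rewrite fct_sumE; apply: co_inj => i.
rewrite !big_ord_recr big_ord0 /= add0r /vec !coD !coZ.
by case: i => [[|[|[|//]]]] hi;
  rewrite [co _ (ev R 0)]/= [co _ (ev R 1)]/= [co _ (ev R 2)]/= !(mulr0, mulr1, addr0, add0r).
Qed.

Lemma finspan_pol3v d : finspan (@pol3v R d).
Proof.
have H (i : nat) := finspan_image (vec_lin i) (finspan_pol3 d).
apply: finspan_sub (finspan_sum 3 H) => v hv.
(* [finspan_sum] asks for a term at every natural number; beyond the three components it is 0. *)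
exists (fun i => vec i (if insub i is Some j then co (j : 'I_3) \o v else 0)).
  move=> i; case: insubP => [j _ _|_].
    by exists (co j \o v).
  by exists 0 => //; exists (fun _ _ _ => 0) => x; rewrite !big1// => i' _;
    rewrite !big1// => j _; rewrite !big1// => k _; rewrite !mul0r.
rewrite {1}(vec_sum v); apply: eq_bigr => i _; by rewrite valK.
Qed.

Lemma co_fct_lin (V : lmodType R) (a : R) (f g : pt R -> V) (x : pt R) :
  (a *: f + g) x = a *: f x + g x.
Proof. by []. Qed.

Lemma cross_linr (a : R) (x y z : pt R) : cross x (a *: y + z) = a *: cross x y + cross x z.
Proof.
have c0 (u w : pt R) : co 0 (cross u w) = co 1 u * co 2 w - co 2 u * co 1 w by [].
have c1 (u w : pt R) : co 1 (cross u w) = co 2 u * co 0 w - co 0 u * co 2 w by [].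
have c2 (u w : pt R) : co 2 (cross u w) = co 0 u * co 1 w - co 1 u * co 0 w by [].
apply: co_inj => i; rewrite co_lin; case: i => [[|[|[|//]]]] hi;
  rewrite [nat_of_ord _]/= ?c0 ?c1 ?c2 !co_lin; lra.
Qed.

Lemma finspan_nedelec d : finspan (@nedelec R d).
Proof.
have H := @finspan_image R (pt R) (pt R) (pt R) _ (fun b x => cross x (b x)) _ (finspan_pol3v d).
have {}H := H (fun a f g => funext (fun x => cross_linr a x (f x) (g x))).
apply: finspan_sub (finspan_add (finspan_pol3v d) H).
move=> v [a [b [ha hb e]]]; exists a => //.
exists (fun x => cross x (b x)); first by exists b.
by apply/funext.
Qed.

Lemma finspan_raviart_thomas d : finspan (@raviart_thomas R d).
Proof.
have H := @finspan_image R (pt R) R (pt R) _ (fun b x => b x *: x) _ (finspan_pol3 d).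
have L (a : R) (f g : pt R -> R) : (fun x : pt R => (a *: f + g) x *: x) =
    a *: (fun x => f x *: x) + (fun x => g x *: x).
  by apply/funext => x; rewrite !co_fct_lin scalerDl scalerA.
apply: finspan_sub (finspan_add (finspan_pol3v d) (H L)).
move=> v [a [b [ha hb e]]]; exists a => //.
exists (fun x => b x *: x); first by exists b.
by apply/funext.
Qed.

Lemma continuous_pol3 d (p : pt R -> R) : pol3 d p -> continuous p.
Proof.
move=> [c hc]; rewrite (_ : p = fun x => \sum_(i < d) \sum_(j < d - i) \sum_(k < d - i - j)
      c i j k * co 0 x ^+ i * co 1 x ^+ j * co 2 x ^+ k); last exact/funext.
have cs (J : Type) (s : seq J) (F : J -> pt R -> R) : (forall j, continuous (F j)) ->
    continuous (fun x => \sum_(j <- s) F j x).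
  move=> h; elim: s => [|j s IH] x.
    by under eq_fun do rewrite big_nil; exact: cvg_cst.
  under eq_fun do rewrite big_cons; apply: cvgD; [exact: h|exact: IH].
have cm (f g : pt R -> R) : continuous f -> continuous g -> continuous (fun x => f x * g x).
  by move=> h h' x; apply: cvgM; [exact: h|exact: h'].
have cX (i k : nat) : continuous (fun x : pt R => co i x ^+ k).
  elim: k => [|k IH]; first by move=> x; under eq_fun do rewrite expr0; exact: cvg_cst.
  by under eq_fun do rewrite exprS; apply: cm => //; exact: continuous_co.
do 3 (apply: (cs _) => ?); apply: (cm _ _ _ (cX _ _)); apply: (cm _ _ _ (cX _ _)).
by apply: (cm _ _ _ (cX _ _)) => x; exact: cvg_cst.
Qed.

Definition vcontinuous (v : pt R -> pt R) := forall i : 'I_3, continuous (co i \o v).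

Lemma vcontinuous_pol3v d v : pol3v d v -> vcontinuous v.
Proof. by move=> h i; exact: continuous_pol3 (h i). Qed.

Lemma vcontinuous_nedelec d v : nedelec d v -> vcontinuous v.
Proof.
move=> [a [b [ha hb e]]] i x.
rewrite (_ : co i \o v = fun x => (co i \o a) x + co i (cross x (b x))); last first.
  apply/funext => y /=; rewrite e -[a y]scale1r co_lin mul1r//.
  by rewrite scale1r.
apply: cvgD; first exact: (vcontinuous_pol3v ha).
have B (j k : 'I_3) : (co j y * co k (b y)) @[y --> x] --> co j x * co k (b x).
  by apply: cvgM; [exact: continuous_co|exact: (vcontinuous_pol3v hb)].
by case: i => [[|[|[|//]]]] hi; apply: cvgB;
  [exact: (B 1 2%:R)|exact: (B 2%:R 1)|exact: (B 2%:R 0)|exact: (B 0 2%:R)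
  |exact: (B 0 1)|exact: (B 1 0)].
Qed.

Lemma vcontinuous_raviart_thomas d v : raviart_thomas d v -> vcontinuous v.
Proof.
move=> [a [b [ha hb e]]] i x.
rewrite (_ : co i \o v = fun x => (co i \o a) x + b x * co i x); last first.
  by apply/funext => y /=; rewrite e addrC co_lin addrC.
apply: cvgD; first exact: (vcontinuous_pol3v ha).
by apply: cvgM; [exact: (continuous_pol3 hb)|exact: continuous_co].
Qed.

Lemma edge_shape_spec k r : finspan (@edge_shape R k r) /\
  edge_shape k r `<=` vcontinuous.
Proof.
case: k; split; [exact: finspan_nedelec|exact: vcontinuous_nedelec
  |exact: finspan_pol3v|exact: vcontinuous_pol3v].
Qed.

Lemma face_shape_spec k r : finspan (@face_shape R k r) /\
  face_shape k r `<=` vcontinuous.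
Proof.
case: k; split; [exact: finspan_raviart_thomas|exact: vcontinuous_raviart_thomas
  |exact: finspan_pol3v|exact: vcontinuous_pol3v].
Qed.

Lemma pol3_lin d (a : R) f g : pol3 d f -> pol3 d g -> pol3 d (a *: f + g).
Proof.
move=> [c hc] [c' hc']; exists (fun i j k => a * c i j k + c' i j k) => x.
rewrite fct_lin hc hc' mulr_sumr -big_split; apply: eq_bigr => i _ /=.
rewrite mulr_sumr -big_split; apply: eq_bigr => j _ /=.
rewrite mulr_sumr -big_split; apply: eq_bigr => k _ /=; lra.
Qed.

Lemma pol3_0 d : pol3 d (0 : pt R -> R).
Proof.
exists (fun _ _ _ => 0) => x; rewrite !big1// => i' _.
by rewrite !big1// => j _; rewrite !big1// => k _; rewrite !mul0r.
Qed.

Lemma pol3v_lin d (a : R) f g : pol3v d f -> pol3v d g -> pol3v d (a *: f + g).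
Proof. by move=> hf hg i; rewrite co_comp_lin; apply: pol3_lin; [exact: hf|exact: hg]. Qed.

Lemma pol3v_0 d : pol3v d (0 : pt R -> pt R).
Proof.
move=> i; rewrite (_ : _ \o _ = 0); first exact: pol3_0.
by apply/funext => x; case: i => [[|[|[|]]]].
Qed.

Lemma edge_shape_lin k r (a : R) f g : edge_shape k r f -> edge_shape k r g ->
  edge_shape k r (a *: f + g).
Proof.
case: k => /=; last exact: pol3v_lin.
move=> [p [q [hp hq e]]] [p' [q' [hp' hq' e']]].
exists (a *: p + p'), (a *: q + q'); split; [exact: pol3v_lin|exact: pol3v_lin|].
by move=> x; rewrite !co_fct_lin e e' cross_linr scalerDr addrACA.
Qed.

Lemma face_shape_lin k r (a : R) f g : face_shape k r f -> face_shape k r g ->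
  face_shape k r (a *: f + g).
Proof.
case: k => /=; last exact: pol3v_lin.
move=> [p [q [hp hq e]]] [p' [q' [hp' hq' e']]].
exists (a *: p + p'), (a *: q + q'); split; [exact: pol3v_lin|exact: pol3_lin|].
by move=> x; rewrite !co_fct_lin e e' scalerDl scalerDr scalerA addrACA.
Qed.

Lemma edge_shape_0 k r : edge_shape k r (0 : pt R -> pt R).
Proof.
case: k => /=; last exact: pol3v_0.
exists 0, 0; split; [exact: pol3v_0|exact: pol3v_0|].
move=> x; rewrite add0r; have := cross_linr (-1) x 0 0; rewrite scaleN1r addNr => ->.
by rewrite scaleN1r addNr.
Qed.

Lemma face_shape_0 k r : face_shape k r (0 : pt R -> pt R).
Proof.
case: k => /=; last exact: pol3v_0.
exists 0, 0; split; [exact: pol3v_0|exact: pol3_0|].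
by move=> x; rewrite add0r scale0r.
Qed.

End Shapes.

Section Piecewise.
Variables (R : realType) (Om : set (pt R)) (Th : seq (tet R)).
Hypothesis oOm : open Om.
Hypothesis bOm : exists r : R, forall x, Om x -> enorm x <= r.
Hypothesis hTh : triangulation Om Th.

Let mO : measurable Om := mOm oOm.

Lemma Om_cover x : Om x -> exists2 K, K \in Th & hull K x.
Proof. by case: hTh => _ cl _ /subset_closure; rewrite cl => -[K]; exists K. Qed.

Lemma hull_bounded : exists r : R, forall K x, K \in Th -> hull K x ->
  cbox (- r, - r, - r) (r, r, r) x.
Proof.
have [r hr] := bOm; exists r => K x KT Kx.
have clx : closure Om x by case: hTh => _ -> _; exists K.
have : closed (cbox (- r, - r, - r) (r, r, r)).
  by apply: compact_closed; [exact: norm_hausdorff|exact: compact_cbox].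
move=> /closure_id ->; apply: closure_subset clx => y /hr; exact: bounded_cbox.
Qed.

Lemma ae_cells (Q : tet R -> pt R -> Prop) :
  (forall K, K \in Th -> {ae mu3 R, forall x, Q K x}) ->
  {ae mu3 R, forall x, forall K, K \in Th -> Q K x}.
Proof.
move=> h; pose K0 : tet R := [tuple 0; 0; 0; 0].
have : {ae mu3 R, forall x, forall n, (n < size Th)%N -> Q (nth K0 Th n) x}.
  apply: ae_foralln => n; have [nT|nT] := ltnP n (size Th).
    by apply: filterS (h _ (mem_nth K0 nT)) => x hx _.
  by apply: aeW => x.
by apply: filterS => x hx K KT; rewrite -(nth_index K0 KT); apply: hx; rewrite index_mem.
Qed.

Lemma agree_aeq (V : Type) (f g : pt R -> V) :
  (forall K, K \in Th -> agree_on K f g) -> aeq Om f g.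
Proof.
move=> h; have := ae_cells h; apply: filterS => x hx Ox.
by have [K KT Kx] := Om_cover Ox; exact: hx Kx.
Qed.

Lemma piecewise_bnd (f : pt R -> R) : measurable_fun Om f ->
  (forall K, K \in Th -> exists2 p, continuous p & agree_on K f p) -> bnd Om f.
Proof.
move=> mf hf; split => //; have [r hr] := hull_bounded.
have /choice [M hM] : forall K, exists M : R, K \in Th ->
    {ae mu3 R, forall x, hull K x -> `|f x| <= M}.
  move=> K; have [KT|] := boolP (K \in Th); last by exists 0.
  have [p cp fp] := hf K KT.
  have /compact_bounded [M [_ h]] : compact (p @` cbox (- r, - r, - r) (r, r, r)).
    by apply: continuous_compact; [exact: continuous_subspaceT|exact: compact_cbox].
  exists (`|M| + 1) => _; apply: filterS fp => x e Kx; rewrite e//.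
  apply: (h (`|M| + 1)); first by rewrite (le_lt_trans (ler_norm _))// ltrDl.
  by exists x => //; exact: hr KT Kx.
exists (\sum_(K <- Th) `|M K|).
have := ae_cells hM; apply: filterS => x hx Ox.
have [K KT Kx] := Om_cover Ox; apply: le_trans (hx K KT Kx) _.
apply: le_trans (ler_norm _) _.
rewrite (perm_big _ (perm_to_rem KT)) big_cons lerDl.
by apply: sumr_ge0.
Qed.

(** The coefficient vector lists, cell after cell, coefficients in the common generating family. The
    cells cover [Om], so zero coefficients force f = 0 almost everywhere. *)
Lemma piecewise_findim (V : lmodType R) (X : set (pt R -> V)) s (S : set (pt R -> V)) :
  finspan S -> (forall f, X f -> aeq Om f 0 -> s f f = 0) ->
  (forall f, X f -> forall K, K \in Th -> exists2 p, S p & agree_on K f p) -> findim X s.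
Proof.
move=> [I [g hg]] s0 hX.
pose m := size Th; pose J := ('I_m * I)%type; pose N := #|{: J}|.
pose K0 : tet R := [tuple 0; 0; 0; 0].
pose ph (a : 'rV[R]_N) (i : 'I_m) : pt R -> V := \sum_(j : I) a 0 (enum_rank (i, j)) *: g j.
exists N, (fun f a => forall i : 'I_m, agree_on (nth K0 Th i) f (ph a i)).
have ph_lin (c : R) a b i : ph (c *: a + b) i = c *: ph a i + ph b i.
  rewrite /ph scaler_sumr -big_split; apply: eq_bigr => j _.
  by rewrite !mxE scalerDl scalerA.
have ph0 i : ph 0 i = 0 by rewrite /ph big1// => j _; rewrite mxE scale0r.
split.
- by move=> i; rewrite ph0; exact: aeW.
- move=> c x y a b hx hy i; rewrite ph_lin.
  by apply: filterS2 (hx i) (hy i) => z h h' Kz; rewrite !co_fct_lin h// h'.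
- move=> f hf; have /choice [a ha] : forall i : 'I_m, exists a : I -> R,
      agree_on (nth K0 Th i) f (\sum_j a j *: g j).
    move=> i; have [p /hg [a ->] h] := hX f hf _ (mem_nth K0 (ltn_ord i)).
    by exists a.
  exists (\row_k a (enum_val k).1 (enum_val k).2) => i.
  rewrite /ph; under eq_bigr do rewrite mxE enum_rankK /=.
  exact: ha.
- move=> f hf h; apply: s0 => //; apply: agree_aeq => K KT.
  have iK : (index K Th < m)%N by rewrite index_mem.
  by have := h (Ordinal iK); rewrite ph0 /= nth_index.
Qed.

End Piecewise.

(** * Finite element spaces *)

Section FiniteElements.
Variables (R : realType) (Om : set (pt R)) (E : elements) (D : discretization R).
Implicit Types (u v w : pt R -> pt R) (f g q : pt R -> R).

(** The interface between the finite elements and the scheme. Besides finite dimension and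
    boundedness it records where curl and div land, the surjectivity of div onto W_h, and the
    inf-sup condition reduced to injectivity. *)
Record fe_ok : Prop := FeOk {
  ok_S : sip (Sh Om E D) (vip Om);
  ok_Sf : findim (Sh Om E D) (vip Om);
  ok_Sb : forall v, Sh Om E D v -> vbnd Om v;
  ok_S1 : forall v, Sh Om E D v -> H01v Om v;
  ok_U : sip (Uh Om E D) (vip Om);
  ok_Uf : findim (Uh Om E D) (vip Om);
  ok_Ub : forall v, Uh Om E D v -> vbnd Om v;
  ok_Uc : forall u, Uh Om E D u -> weak_curl Om u (wcurl Om u) /\ Vh Om E D (wcurl Om u);
  ok_V : sip (Vh Om E D) (vip Om);
  ok_Vf : findim (Vh Om E D) (vip Om);
  ok_Vb : forall v, Vh Om E D v -> vbnd Om v;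
  ok_Vd : forall v, Vh Om E D v -> weak_div Om v (wdiv Om v) /\ Wh Om D (wdiv Om v);
  ok_W : sip (Wh Om D) (ip Om);
  ok_Wf : findim (Wh Om D) (ip Om);
  ok_WL2 : forall q, Wh Om D q -> L2 Om q;
  ok_Wex : forall q, Wh Om D q -> exists2 v, Vh Om E D v & aeq Om (wdiv Om v) q;
  ok_L : sip (Lh Om D) (ip Om);
  ok_Lf : findim (Lh Om D) (ip Om);
  ok_LL2 : forall q, Lh Om D q -> L2 Om q;
  ok_Linj : forall q, Lh Om D q ->
    (forall v, Sh Om E D v -> ip Om (wdiv Om v) q = 0) -> ip Om q q = 0 }.

Hypothesis oOm : open Om.
Hypothesis bOm : exists r : R, forall x, Om x -> enorm x <= r.
Hypothesis hTh : triangulation Om (cells D).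

Let mO : measurable Om := mOm oOm.

Lemma agree_lin (V : lmodType R) (K : tet R) (a : R) (f g p q : pt R -> V) :
  agree_on K f p -> agree_on K g q -> agree_on K (a *: f + g) (a *: p + q).
Proof. by apply: filterS2 => x h h' Kx; rewrite !co_fct_lin h// h'. Qed.

Lemma ip_aeq0 f : L2 Om f -> aeq Om f 0 -> ip Om f f = 0.
Proof.
move=> hf e; have L0 := sip_0 (sip_L2 oOm bOm).
by rewrite (ip_aeq mO hf hf L0 L0 e e) (sip0l (sip_L2 oOm bOm)).
Qed.

Lemma vip_aeq0 v : L2v Om v -> aeq Om v 0 -> vip Om v v = 0.
Proof.
move=> hf e; have L0 := sip_0 (sip_L2v oOm bOm).
by rewrite (vip_aeq mO hf hf L0 L0 e e) (sip0l (sip_L2v oOm bOm)).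
Qed.

Lemma face_L2v k r v : face_space Om (cells D) k r v -> L2v Om v.
Proof. by move=> [[d [[]]]]. Qed.

Lemma edge_L2v k r v : edge_space Om (cells D) k r v -> L2v Om v.
Proof. by move=> [[d [[]]]]. Qed.

Lemma face_space0 k r : face_space Om (cells D) k r 0.
Proof.
split=> [|K _]; first exact: H0div0.
by exists 0; [exact: face_shape_0|exact: aeW].
Qed.

Lemma edge_space0 k r : edge_space Om (cells D) k r 0.
Proof.
split=> [|K _]; first exact: H0curl0.
by exists 0; [exact: edge_shape_0|exact: aeW].
Qed.

Lemma sip_face k r : sip (face_space Om (cells D) k r) (vip Om).
Proof.
apply: (sip_sub _ _ _ (sip_L2v oOm bOm)); [exact: face_L2v|exact: face_space0|].
move=> a v w [hv pv] [hw pw]; split=> [|K KT]; first exact: H0div_lin.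
have [p hp vp] := pv K KT; have [q hq wq] := pw K KT.
by exists (a *: p + q); [exact: face_shape_lin|exact: agree_lin].
Qed.

Lemma sip_edge k r : sip (edge_space Om (cells D) k r) (vip Om).
Proof.
apply: (sip_sub _ _ _ (sip_L2v oOm bOm)); [exact: edge_L2v|exact: edge_space0|].
move=> a v w [hv pv] [hw pw]; split=> [|K KT]; first exact: H0curl_lin.
have [p hp vp] := pv K KT; have [q hq wq] := pw K KT.
by exists (a *: p + q); [exact: edge_shape_lin|exact: agree_lin].
Qed.

Lemma findim_face k r : findim (face_space Om (cells D) k r) (vip Om).
Proof.
apply: (piecewise_findim hTh (face_shape_spec R k r).1) => [v hv|v [_]//].
exact: vip_aeq0 (face_L2v hv).
Qed.

Lemma findim_edge k r : findim (edge_space Om (cells D) k r) (vip Om).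
Proof.
apply: (piecewise_findim hTh (edge_shape_spec R k r).1) => [v hv|v [_]//].
exact: vip_aeq0 (edge_L2v hv).
Qed.

Lemma agree_co (K : tet R) (i : nat) v w : agree_on K v w -> agree_on K (co i \o v) (co i \o w).
Proof. by apply: filterS => x h Kx /=; rewrite h. Qed.

Lemma vbnd_face k r v : face_space Om (cells D) k r v -> vbnd Om v.
Proof.
move=> hv i; apply: (piecewise_bnd bOm hTh); first by have [] := face_L2v hv i.
move=> K KT; have [p hp vp] := hv.2 K KT.
by exists (co i \o p); [exact: (face_shape_spec R k r).2 hp i|exact: agree_co].
Qed.

Lemma vbnd_edge k r v : edge_space Om (cells D) k r v -> vbnd Om v.
Proof.
move=> hv i; apply: (piecewise_bnd bOm hTh); first by have [] := edge_L2v hv i.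
move=> K KT; have [p hp vp] := hv.2 K KT.
by exists (co i \o p); [exact: (edge_shape_spec R k r).2 hp i|exact: agree_co].
Qed.

Lemma lagrange_lin k (a : R) f g : Defs.lagrange Om (cells D) k f -> Defs.lagrange Om (cells D) k g ->
  Defs.lagrange Om (cells D) k (a *: f + g).
Proof.
move=> [Hf cf pf] [Hg cg pg]; split; first exact: H01_lin.
  move=> x; apply: cvgD; last exact: cg.
  by apply: cvgMr; exact: cf.
move=> K KT; have [p hp e] := pf K KT; have [q hq e'] := pg K KT.
exists (a *: p + q); first exact: pol3_lin.
by move=> x Kx; rewrite !fct_lin e// e'.
Qed.

Lemma lagrange0 k : Defs.lagrange Om (cells D) k 0.
Proof.
split; first exact: H01_0.
  by move=> x; exact: cvg_cst.
by move=> K KT; exists 0 => //; exact: pol3_0.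
Qed.

Lemma lagrange_L2 k f : Defs.lagrange Om (cells D) k f -> L2 Om f.
Proof. by move=> [[g [[]]]]. Qed.

Lemma lagrangev_L2v k v : lagrangev Om (cells D) k v -> L2v Om v.
Proof. by move=> h i; exact: lagrange_L2 (h i). Qed.

Lemma sip_lagrangev k : sip (lagrangev Om (cells D) k) (vip Om).
Proof.
apply: (sip_sub _ _ _ (sip_L2v oOm bOm)); [exact: lagrangev_L2v| |].
  move=> i; rewrite (_ : _ \o _ = 0); first exact: lagrange0.
  by apply/funext => x; case: i => [[|[|[|]]]].
by move=> a v w hv hw i; rewrite co_comp_lin; apply: lagrange_lin; [exact: hv|exact: hw].
Qed.

Lemma findim_lagrangev k : findim (lagrangev Om (cells D) k) (vip Om).
Proof.
apply: (piecewise_findim hTh (@finspan_pol3v R k.+1)) => [v hv|v hv K KT].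
  exact: vip_aeq0 (lagrangev_L2v hv).
have /choice [p hp] : forall i : 'I_3, exists p, pol3 k.+1 p /\ forall x, hull K x -> co i (v x) = p x.
  by move=> i; have [_ _ /(_ K KT) [p]] := hv i; exists p.
pose w x : pt R := (p 0 x, p 1 x, p 2%:R x).
have wE (i : 'I_3) : co i \o w = p i.
  by apply/funext => x; case: i => [[|[|[|//]]]] hi; rewrite /= /co /=; congr (p _ x); exact: val_inj.
exists w; first by move=> i; rewrite wE; exact: (hp i).1.
apply: aeW => x Kx; apply: co_inj => i.
by rewrite (hp i).2// -wE.
Qed.

Lemma vbnd_lagrangev k v : lagrangev Om (cells D) k v -> vbnd Om v.
Proof.
move=> hv i; apply: (piecewise_bnd bOm hTh); first by have [] := lagrangev_L2v hv i.
move=> K KT; have [_ _ /(_ K KT) [p hp e]] := hv i.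
by exists p; [exact: continuous_pol3 hp|exact: aeW].
Qed.

Lemma L20_lin (a : R) f g : L20 Om f -> L20 Om g -> L20 Om (a *: f + g).
Proof.
move=> [Lf If] [Lg Ig]; split; first exact: (L2_lin mO).
rewrite -[LHS]/(\int[mu3 R]_(x in Om) (a * f x + g x)).
rewrite (@Rintegral_lin _ _ _ (mu3 R) _ mO a _ _ (L2_int oOm bOm Lf) (L2_int oOm bOm Lg)).
by rewrite If Ig mulr0 addr0.
Qed.

Lemma L20_0 : L20 Om 0.
Proof.
split; first exact: (sip_0 (sip_L2 oOm bOm)).
have := ip0r oOm bOm (sip_0 (sip_L2 oOm bOm)).
by rewrite /ip; under eq_Rintegral do rewrite mulr0.
Qed.

Lemma sip_pw l X : pw_poly_space Om (cells D) l X -> sip (X `&` L20 Om) (ip Om).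
Proof.
move=> hX; apply: (sip_sub _ _ _ (sip_L2 oOm bOm)).
- by move=> f [_ []].
- by split; [exact: (pw_zero hX)|exact: L20_0].
- by move=> a f g [Xf Lf] [Xg Lg]; split; [exact: (pw_lin hX)|exact: L20_lin].
Qed.

Lemma findim_pw l X : pw_poly_space Om (cells D) l X -> findim (X `&` L20 Om) (ip Om).
Proof.
move=> hX; have [N hN] := pw_poly hX.
apply: (piecewise_findim hTh (@finspan_pol3 R N)) => [f [_ [Lf _]]|f [/hN [_ h] _] K KT].
  exact: ip_aeq0.
exact: h.
Qed.

Lemma fe_okP l c : pw_poly_space Om (cells D) l (pwL D) ->
  pw_poly_space Om (cells D) l (pwW D) -> assumption_A1 Om E D ->
  0 < c -> inf_sup Om E D c -> fe_ok.
Proof.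
move=> hL hW [_ [_ [curlV _] [divW Wdiv]] _] c0 infsup.
have Vd v : Vh Om E D v -> weak_div Om v (wdiv Om v).
  by move=> [[d [hd _]] _]; apply: wdivP; exists d.
split.
- exact: sip_lagrangev.
- exact: findim_lagrangev.
- by move=> v; exact: vbnd_lagrangev.
- by move=> v hv i; have [] := hv i.
- exact: sip_edge.
- exact: findim_edge.
- by move=> v; exact: vbnd_edge.
- move=> u hu; have wu : weak_curl Om u (wcurl Om u).
    by have [[w [hw _]] _] := hu; apply: wcurlP; exists w.
  by split => //; exact: (curlV u _ hu wu).1.
- exact: sip_face.
- exact: findim_face.
- by move=> v; exact: vbnd_face.
- by move=> v hv; split; [exact: Vd|exact: divW hv (Vd v hv)].
- exact: sip_pw hW.
- exact: findim_pw hW.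
- by move=> q [_ []].
- move=> q hq; have [v hv vq] := Wdiv q hq; exists v => //.
  exact: (weak_div_unique oOm bOm (Vd v hv) vq (aeq_refl _ _)).
- exact: sip_pw hL.
- exact: findim_pw hL.
- by move=> q [_ []].
- move=> q hq h; have := infsup q hq.
  (* If q is orthogonal to all discrete divergences, every quotient is 0, whatever its denominator.
     The supremum is then 0 and the inf-sup inequality forces the norm of q to vanish. *)
  have -> : [set ip Om q (wdiv Om v) / h1norm Om v | v in Sh Om E D] = [set 0].
    apply/seteqP; split=> [_ [v hv <-]|_ ->].
      by rewrite ip_sym h//= mul0r.
    exists 0; first exact: (sip_0 (sip_lagrangev _)).
    by rewrite ip_sym h ?mul0r//; exact: (sip_0 (sip_lagrangev _)).
  rewrite sup1 pmulr_rle0// => s0.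
  have /eqP : snorm Om q = 0 by apply/eqP; rewrite eq_le s0 sqrtr_ge0.
  rewrite sqrtr_eq0 => q0; apply/eqP; rewrite eq_le q0; exact: ip_ge0.
Qed.

End FiniteElements.

(** * The forms of the scheme, up to null sets *)

Section Forms.
Variables (R : realType) (Om : set (pt R)) (E : elements) (D : discretization R).
Hypothesis oOm : open Om.
Hypothesis bOm : exists r : R, forall x, Om x -> enorm x <= r.
Hypothesis ok : fe_ok Om E D.
Implicit Types (u v w m k z H F : pt R -> pt R) (f g q : pt R -> R).

Let mO : measurable Om := mOm oOm.

Let sL2 := sip_L2 oOm bOm.
Let sL2v := sip_L2v oOm bOm.

Definition Hcurl : set (pt R -> pt R) := [set v | exists w, weak_curl Om v w].
Definition crossf u v : pt R -> pt R := fun x => cross (u x) (v x).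

Lemma Hdiv_L2v v : Hdiv Om v -> L2v Om v. Proof. by move=> [d []]. Qed.
Lemma Hcurl_L2v v : Hcurl v -> L2v Om v. Proof. by move=> [d []]. Qed.
Lemma wdiv_L2 v : Hdiv Om v -> L2 Om (wdiv Om v). Proof. by move=> /wdivP []. Qed.
Lemma wcurl_L2v v : Hcurl v -> L2v Om (wcurl Om v). Proof. by move=> /wcurlP []. Qed.

Lemma aeq_sub0 (V : lmodType R) (f g : pt R -> V) : aeq Om f g -> aeq Om (f - g) 0.
Proof.
apply: filterS => x h Ox; have -> : (f - g) x = f x - g x by [].
by rewrite h ?subrr.
Qed.

Lemma aeq_subP (V : lmodType R) (f g : pt R -> V) : aeq Om (f - g) 0 -> aeq Om f g.
Proof. by apply: filterS => x h Ox; apply/eqP; rewrite -subr_eq0; apply/eqP; exact: h. Qed.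

(** With its converse and the scalar versions, this is the dictionary between equality almost
    everywhere, used by the scheme, and null differences, used by the abstract part. *)
Lemma vip_null u v : L2v Om u -> L2v Om v -> vip Om (u - v) (u - v) = 0 -> aeq Om u v.
Proof. by move=> hu hv h; apply: aeq_subP; apply: (vip_eq0 mO _ h); exact: (sipB sL2v hu hv). Qed.

Lemma vip_nullP u v : L2v Om u -> L2v Om v -> aeq Om u v -> vip Om (u - v) (u - v) = 0.
Proof. by move=> hu hv h; apply: (vip_aeq0 oOm bOm); [exact: (sipB sL2v hu hv)|exact: aeq_sub0]. Qed.

Lemma ip_null f g : L2 Om f -> L2 Om g -> ip Om (f - g) (f - g) = 0 -> aeq Om f g.
Proof. by move=> hu hv h; apply: aeq_subP; apply: (ip_eq0 mO _ h); exact: (sipB sL2 hu hv). Qed.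

Lemma ip_nullP f g : L2 Om f -> L2 Om g -> aeq Om f g -> ip Om (f - g) (f - g) = 0.
Proof. by move=> hu hv h; apply: (ip_aeq0 oOm bOm); [exact: (sipB sL2 hu hv)|exact: aeq_sub0]. Qed.

Lemma lfun_of_aeq (X : set (pt R -> pt R)) (l : (pt R -> pt R) -> R) :
  X 0 -> X `<=` L2v Om ->
  (forall (a : R) u v, X u -> X v -> l (a *: u + v) = a * l u + l v) ->
  (forall u v, X u -> X v -> aeq Om u v -> l u = l v) -> lfun X (vip Om) l.
Proof.
move=> X0 XL lin inv; split => // u Xu h.
have l0 : l 0 = 0.
  have := lin 1 0 0 X0 X0; rewrite scaler0 addr0 mul1r => /eqP.
  by rewrite -subr_eq0 opprD addrA subrr add0r oppr_eq0 => /eqP.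
by rewrite -l0; apply: inv => //; apply: vip_eq0 => //; exact: XL.
Qed.

Lemma wdiv_lin (a : R) u v : Hdiv Om u -> Hdiv Om v ->
  aeq Om (wdiv Om (a *: u + v)) (a *: wdiv Om u + wdiv Om v).
Proof.
move=> hu hv; have h := weak_div_lin oOm bOm a (wdivP hu) (wdivP hv).
by apply: (weak_div_unique oOm bOm (wdivP _) h (aeq_refl _ _)); exists (a *: wdiv Om u + wdiv Om v).
Qed.

Lemma Hdiv_lin (a : R) u v : Hdiv Om u -> Hdiv Om v -> Hdiv Om (a *: u + v).
Proof.
move=> hu hv; exists (a *: wdiv Om u + wdiv Om v).
exact: (weak_div_lin oOm bOm a (wdivP hu) (wdivP hv)).
Qed.

Lemma wdiv_aeq u v : Hdiv Om u -> Hdiv Om v -> aeq Om u v -> aeq Om (wdiv Om u) (wdiv Om v).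
Proof. by move=> hu hv; exact: (weak_div_unique oOm bOm (wdivP hu) (wdivP hv)). Qed.

Lemma wcurl_lin (a : R) u v : Hcurl u -> Hcurl v ->
  aeq Om (wcurl Om (a *: u + v)) (a *: wcurl Om u + wcurl Om v).
Proof.
move=> hu hv; have h := weak_curl_lin oOm bOm a (wcurlP hu) (wcurlP hv).
by apply: (weak_curl_unique oOm bOm (wcurlP _) h (aeq_refl _ _)); exists (a *: wcurl Om u + wcurl Om v).
Qed.

Lemma wcurl_aeq u v : Hcurl u -> Hcurl v -> aeq Om u v -> aeq Om (wcurl Om u) (wcurl Om v).
Proof. by move=> hu hv; exact: (weak_curl_unique oOm bOm (wcurlP hu) (wcurlP hv)). Qed.

Lemma ip_wdiv_lin (a : R) u v q : Hdiv Om u -> Hdiv Om v -> L2 Om q ->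
  ip Om (wdiv Om (a *: u + v)) q = a * ip Om (wdiv Om u) q + ip Om (wdiv Om v) q.
Proof.
move=> hu hv hq; rewrite -ip_lin//; try exact: wdiv_L2.
have Lu := wdiv_L2 hu; have Lv := wdiv_L2 hv; have Luv := wdiv_L2 (Hdiv_lin a hu hv).
by apply: ip_aeq => //; [exact: L2_lin|exact: wdiv_lin|exact: aeq_refl].
Qed.

Lemma ip_wdiv_aeq u v q q' : Hdiv Om u -> Hdiv Om v -> L2 Om q -> L2 Om q' ->
  aeq Om u v -> aeq Om q q' -> ip Om (wdiv Om u) q = ip Om (wdiv Om v) q'.
Proof.
move=> hu hv hq hq' e e'.
by apply: ip_aeq => //; [exact: wdiv_L2|exact: wdiv_L2|exact: wdiv_aeq].
Qed.

Lemma S_Hdiv v : Sh Om E D v -> Hdiv Om v.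
Proof. by move=> /(ok_S1 ok) /(H01v_weak_div oOm bOm). Qed.
Lemma S_Hcurl v : Sh Om E D v -> Hcurl v.
Proof. by move=> /(ok_S1 ok) /(H01v_weak_curl oOm bOm). Qed.
Lemma U_Hcurl v : Uh Om E D v -> Hcurl v.
Proof. by move=> /(ok_Uc ok) [h _]; exists (wcurl Om v). Qed.
Lemma V_Hdiv v : Vh Om E D v -> Hdiv Om v.
Proof. by move=> /(ok_Vd ok) [h _]; exists (wdiv Om v). Qed.
Lemma S_L2v v : Sh Om E D v -> L2v Om v. Proof. by move=> /S_Hdiv; exact: Hdiv_L2v. Qed.
Lemma U_L2v v : Uh Om E D v -> L2v Om v. Proof. by move=> /U_Hcurl; exact: Hcurl_L2v. Qed.
Lemma V_L2v v : Vh Om E D v -> L2v Om v. Proof. by move=> /V_Hdiv; exact: Hdiv_L2v. Qed.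
Lemma U_curl_L2v v : Uh Om E D v -> L2v Om (wcurl Om v).
Proof. by move=> /U_Hcurl; exact: wcurl_L2v. Qed.
Lemma V_div_L2 v : Vh Om E D v -> L2 Om (wdiv Om v).
Proof. by move=> /V_Hdiv; exact: wdiv_L2. Qed.

Lemma crossC (x y : pt R) : cross x y = -1 *: cross y x.
Proof.
by apply: co_inj => i; rewrite coZ; case: i => [[|[|[|//]]]] hi; rewrite /cross /co /=; lra.
Qed.

Lemma cross_linl (a : R) (x y z : pt R) : cross (a *: x + y) z = a *: cross x z + cross y z.
Proof.
rewrite crossC cross_linr scalerDr scalerA [in RHS]crossC [cross y z]crossC scalerA.
by rewrite (mulrC a).
Qed.

Lemma dot_linl (a : R) (x y z : pt R) : dot (a *: x + y) z = a * dot x z + dot y z.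
Proof.
rewrite /dot mulr_sumr -big_split; apply: eq_bigr => i _ /=.
by rewrite co_lin mulrDl mulrA.
Qed.

Lemma dot_cross_self (x y : pt R) : dot (cross x y) x = 0.
Proof. by rewrite /dot !big_ord_recr big_ord0 /= /cross /co /=; lra. Qed.

Lemma crossf_linl (a : R) u v w : crossf (a *: u + v) w = a *: crossf u w + crossf v w.
Proof. by apply/funext => x; exact: cross_linl. Qed.

Lemma crossf_linr (a : R) u v w : crossf w (a *: u + v) = a *: crossf w u + crossf w v.
Proof. by apply/funext => x; exact: cross_linr. Qed.

Lemma crossf_aeq u v u' v' : aeq Om u u' -> aeq Om v v' -> aeq Om (crossf u v) (crossf u' v').
Proof. exact: (@aeq_map2 _ _ _ _ _ (@cross R)). Qed.

Lemma crossf_L2v u v : vbnd Om u -> L2v Om v -> L2v Om (crossf u v).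
Proof. exact: (L2v_cross mO). Qed.

Definition dotf u v : pt R -> R := fun x => dot (u x) (v x).

Lemma dotf_linl (a : R) u v w : dotf (a *: u + v) w = a *: dotf u w + dotf v w.
Proof. by apply/funext => x; exact: dot_linl. Qed.

Lemma dotf_sym u v : dotf u v = dotf v u.
Proof. by apply/funext => x; exact: dotC. Qed.

Lemma dotf_linr (a : R) u v w : dotf w (a *: u + v) = a *: dotf w u + dotf w v.
Proof. by rewrite dotf_sym dotf_linl !(dotf_sym _ w). Qed.

Lemma dotf_aeq u v u' v' : aeq Om u u' -> aeq Om v v' -> aeq Om (dotf u v) (dotf u' v').
Proof. exact: (@aeq_map2 _ _ _ _ _ (@dot R)). Qed.

Lemma dotf_L2 u v : vbnd Om u -> L2v Om v -> L2 Om (dotf u v).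
Proof. exact: (L2_dot mO). Qed.

Lemma vip_crossf_self u v : vip Om (crossf u v) u = 0.
Proof.
have := ip0r oOm bOm (sip_0 sL2); rewrite /ip /vip => <-; apply: eq_Rintegral => x _.
by rewrite dot_cross_self mulr0.
Qed.

Lemma wgrad_L2v f : H01 Om f -> L2v Om (wgrad Om f).
Proof. by move=> /H01_weak_grad /wgradP []. Qed.

Lemma gip_ge0 v : 0 <= gip Om v v.
Proof. by apply: sumr_ge0 => i _; exact: vip_ge0. Qed.

Lemma gip_sym v w : gip Om v w = gip Om w v.
Proof. by apply: eq_bigr => i _; exact: vip_sym. Qed.

Lemma wgrad_lin (a : R) f g : H01 Om f -> H01 Om g ->
  aeq Om (wgrad Om (a *: f + g)) (a *: wgrad Om f + wgrad Om g).
Proof.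
move=> hf hg; have h := weak_grad_lin oOm bOm a (wgradP (H01_weak_grad hf)) (wgradP (H01_weak_grad hg)).
exact: (weak_grad_unique oOm bOm (wgradP (ex_intro _ _ h)) h (aeq_refl _ _)).
Qed.

Lemma gip_lin (a : R) u v w : H01v Om u -> H01v Om v -> H01v Om w ->
  gip Om (a *: u + v) w = a * gip Om u w + gip Om v w.
Proof.
move=> hu hv hw; rewrite /gip mulr_sumr -big_split; apply: eq_bigr => i _ /=.
have Lu := wgrad_L2v (hu i); have Lv := wgrad_L2v (hv i); have Lw := wgrad_L2v (hw i).
have Luv := wgrad_L2v (H01_lin oOm bOm a (hu i) (hv i)).
rewrite -(vip_lin mO a Lu Lv Lw) co_comp_lin.
exact: (vip_aeq mO Luv Lw (L2v_lin mO a Lu Lv) Lw (wgrad_lin a (hu i) (hv i)) (aeq_refl _ _)).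
Qed.

Lemma gip_aeq u v u' v' : H01v Om u -> H01v Om v -> H01v Om u' -> H01v Om v' ->
  aeq Om u u' -> aeq Om v v' -> gip Om u v = gip Om u' v'.
Proof.
move=> hu hv hu' hv' e e'; apply: eq_bigr => i _.
have G f g : H01 Om f -> H01 Om g -> aeq Om f g -> aeq Om (wgrad Om f) (wgrad Om g).
  by move=> hf hg; exact: (weak_grad_unique oOm bOm (wgradP (H01_weak_grad hf)) (wgradP (H01_weak_grad hg))).
apply: vip_aeq => //; try exact: wgrad_L2v.
- by apply: G => //; exact: (@aeq_map _ _ _ _ (co i)).
- by apply: G => //; exact: (@aeq_map _ _ _ _ (co i)).
Qed.

Let half_lin (a A B C D' : R) : 2^-1 * (a * A + B) - 2^-1 * (a * C + D') =
  a * (2^-1 * A - 2^-1 * C) + (2^-1 * B - 2^-1 * D').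
Proof. lra. Qed.

Lemma trilin_linl (a : R) u v m F : vbnd Om u -> vbnd Om v -> Vh Om E D m -> Vh Om E D F ->
  trilin Om (a *: u + v) m F = a * trilin Om u m F + trilin Om v m F.
Proof.
move=> hu hv hm hF; rewrite /trilin -!/(dotf _ _) !dotf_linl.
have LF := V_L2v hF; have Lm := V_L2v hm.
have dm := V_div_L2 hm; have dF := V_div_L2 hF.
rewrite (ip_lin mO a (dotf_L2 hu LF) (dotf_L2 hv LF) dm).
rewrite (ip_lin mO a (dotf_L2 hu Lm) (dotf_L2 hv Lm) dF).
exact: half_lin.
Qed.

Lemma trilin_linr (a : R) u m F G : vbnd Om u -> Vh Om E D m -> Vh Om E D F -> Vh Om E D G ->
  trilin Om u m (a *: F + G) = a * trilin Om u m F + trilin Om u m G.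
Proof.
move=> hu hm hF hG; rewrite /trilin -!/(dotf _ _) !dotf_linr.
have LF := V_L2v hF; have Lm := V_L2v hm; have LG := V_L2v hG.
have dm := V_div_L2 hm.
rewrite !(ip_sym _ (dotf u m)) (ip_wdiv_lin a (V_Hdiv hF) (V_Hdiv hG) (dotf_L2 hu Lm)).
rewrite (ip_lin mO a (dotf_L2 hu LF) (dotf_L2 hu LG) dm).
exact: half_lin.
Qed.

Lemma trilin_anti u m F : trilin Om u F m = - trilin Om u m F.
Proof. by rewrite /trilin opprB. Qed.

Lemma trilin_self u m : trilin Om u m m = 0.
Proof. by rewrite /trilin subrr. Qed.

Lemma trilin_aeq u m F u' m' F' : vbnd Om u -> Vh Om E D m -> Vh Om E D F ->
  vbnd Om u' -> Vh Om E D m' -> Vh Om E D F' ->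
  aeq Om u u' -> aeq Om m m' -> aeq Om F F' -> trilin Om u m F = trilin Om u' m' F'.
Proof.
move=> hu hm hF hu' hm' hF' eu em eF; rewrite /trilin -!/(dotf _ _).
have LF := V_L2v hF; have Lm := V_L2v hm; have LF' := V_L2v hF'; have Lm' := V_L2v hm'.
rewrite !(ip_sym _ (dotf _ _)).
rewrite (ip_wdiv_aeq (V_Hdiv hm) (V_Hdiv hm') (dotf_L2 hu LF) (dotf_L2 hu' LF') em (dotf_aeq eu eF)).
by rewrite (ip_wdiv_aeq (V_Hdiv hF) (V_Hdiv hF') (dotf_L2 hu Lm) (dotf_L2 hu' Lm') eF (dotf_aeq eu em)).
Qed.

End Forms.

(** * Multilinear maps and local Lipschitz continuity *)

Section MoreInnerProduct.
Variables (R : realType) (V : lmodType R) (X : set V) (s : V -> V -> R).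
Hypothesis hs : sip X s.

Lemma sip_sqr (a : R) x y : X x -> X y ->
  s (a *: x + y) (a *: x + y) = a ^+ 2 * s x x + 2 * a * s x y + s y y.
Proof.
move=> hx hy; have h := sip_X hs a hx hy.
rewrite (sip_lin hs a hx hy h) (sip_sym hs hx h) (sip_sym hs hy h).
by rewrite !(sip_lin hs a hx hy)// (sip_sym hs hy hx); lra.
Qed.

Lemma lfun_comb (a : R) l l' : lfun X s l -> lfun X s l' -> lfun X s (fun v => a * l v + l' v).
Proof.
move=> [h1 h2] [h1' h2']; split=> [c x y hx hy|x hx h]; last by rewrite h2// h2'// mulr0 addr0.
by rewrite h1// h1'//; lra.
Qed.

Lemma lfunZ (a : R) l : lfun X s l -> lfun X s (fun v => a * l v).
Proof.
move=> [h1 h2]; split=> [c x y hx hy|x hx h]; last by rewrite h2// mulr0.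
by rewrite h1//; lra.
Qed.

Lemma riesz n (e : 'I_n -> V) l x : obasis X s e -> lfun X s l -> X x ->
  s (\sum_i l (e i) *: e i) x = l x.
Proof.
move=> he hl hx; rewrite (lfun_basis hs he hl hx) (sip_suml hs _ _ hx he.1.1).
by apply: eq_bigr => i _; rewrite mulrC (sip_sym hs hx (he.1.1 i)).
Qed.

Lemma null_sym x y : X x -> X y -> s (x - y) (x - y) = 0 -> s (y - x) (y - x) = 0.
Proof.
move=> hx hy h; rewrite -opprB -scaleN1r.
have hd := sipB hs hx hy; have hn := sipZ hs (-1) hd.
by rewrite (sipZl hs _ hd hn) (sip_sym hs hd hn) (sipZl hs _ hd hd) h !mulr0.
Qed.

Lemma null_trans x y z : X x -> X y -> X z -> s (x - y) (x - y) = 0 ->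
  s (y - z) (y - z) = 0 -> s (x - z) (x - z) = 0.
Proof.
move=> hx hy hz h h'; have -> : x - z = (x - y) + (y - z) by rewrite addrA subrK.
have hd := sipB hs hx hy; have hd' := sipB hs hy hz; have hdd := sipD hs hd hd'.
by rewrite (sipDl hs hd hd' hdd) (sip_null hs hd hdd h) (sip_null hs hd' hdd h') addr0.
Qed.

Lemma null_eq x y w : X x -> X y -> X w -> s (x - y) (x - y) = 0 -> s x w = s y w.
Proof. by move=> hx hy hw h; apply: (lfun_eq hs (sip_lfunl hs hw)). Qed.

Lemma null_basis n (e : 'I_n -> V) x y : obasis X s e -> X x -> X y ->
  (forall i, s x (e i) = s y (e i)) -> s (x - y) (x - y) = 0.
Proof.
move=> he hx hy h; have hd := sipB hs hx hy.
rewrite (lfun_basis hs he (sip_lfunl hs hd) hd) big1// => i _.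
by rewrite (sipBl hs hx hy (he.1.1 i)) h subrr mul0r.
Qed.

Variable T : R.
Hypothesis T0 : 0 < T.
Let nrm (v : V) : R := Num.sqrt (s v v).

Lemma C0_contT u y : C0_on T nrm X u -> X y -> contT T (fun t => s (u t) y).
Proof.
move=> [hX hu] hy; apply/(contTP T0) => t e ht e0.
have K0 : 0 < nrm y + 1 by rewrite ltr_wpDl// sqrtr_ge0.
have [d d0 hd] := hu t _ ht (divr_gt0 e0 K0); exists d => // r hr rt.
have ur := hX _ hr; have ut := hX _ ht.
rewrite -(sipBl hs ur ut hy); apply: le_trans (sip_cs_sqrt hs (sipB hs ur ut) hy) _.
have := hd r hr rt; rewrite -/(nrm _) -/(nrm y) ler_pdivlMr// => h.
apply: le_trans h; rewrite ler_wpM2l// ?sqrtr_ge0//.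
by rewrite lerDl.
Qed.

Lemma C1_derivT u du y : C1_on T nrm X u du -> X y ->
  derivT T (fun t => s (u t) y) (fun t => s (du t) y).
Proof.
move=> [[hX _] [hdX _] hu] hy t e ht e0.
have K0 : 0 < nrm y + 1 by rewrite ltr_wpDl// sqrtr_ge0.
have [d d0 hd] := hu t _ ht (divr_gt0 e0 K0); exists d => // r hr rt.
have ur := hX _ hr; have ut := hX _ ht; have dt := hdX _ ht.
have urt := sipB hs ur ut; have sdt := sipZ hs (r - t) dt.
rewrite -(sipBl hs ur ut hy) -(sipZl hs _ dt hy) -(sipBl hs urt sdt hy).
apply: le_trans (sip_cs_sqrt hs (sipB hs urt sdt) hy) _.
have := hd r hr rt; rewrite mulrAC ler_pdivlMr// -/(nrm _) -/(nrm y) => h.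
apply: le_trans h; rewrite ler_wpM2l// ?sqrtr_ge0//.
by rewrite lerDl.
Qed.

Lemma C0_sum (J : finType) (g : J -> R -> R) (f : J -> V) :
  (forall j, contT T (g j)) -> (forall j, X (f j)) ->
  C0_on T nrm X (fun t => \sum_j g j t *: f j).
Proof.
move=> cg hf; split=> [t _|t e ht e0]; first exact: (sip_sum hs).
have c : contT T (fun r => \sum_j `|g j r - g j t| * nrm (f j)).
  apply: contT_sum => // j; apply: contT_mul; last exact: contT_cst.
  by apply: contT_norm => //; apply: contT_add => //; exact: contT_cst.
have [d d0 hd] := (contTP T0 _).1 c t e ht e0; exists d => // r hr rt.
have := hd r hr rt; rewrite [X in _ - X]big1 ?subr0; last first.
  by move=> j _; rewrite subrr normr0 mul0r.
move=> h; apply: le_trans (le_trans (ler_norm _) h).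
rewrite -sumrB; under eq_bigr do rewrite -scalerBl.
exact: (sip_norm_sum hs).
Qed.

Lemma C1_sum (J : finType) (g dg : J -> R -> R) (f : J -> V) :
  (forall j, derivT T (g j) (dg j)) -> (forall j, contT T (dg j)) -> (forall j, X (f j)) ->
  C1_on T nrm X (fun t => \sum_j g j t *: f j) (fun t => \sum_j dg j t *: f j).
Proof.
move=> hg cg hf; split; [|exact: C0_sum|].
  by apply: C0_sum => // j; exact: (derivT_cont T0 (hg j)).
move=> t e ht e0.
suff [d d0 hd] : exists2 d : R, 0 < d & forall r, 0 <= r <= T -> `|r - t| < d ->
    \sum_j `|g j r - g j t - (r - t) * dg j t| * nrm (f j) <= e * `|r - t|.
  exists d => // r hr rt; apply: le_trans (hd r hr rt).
  rewrite scaler_sumr -!sumrB; under eq_bigr do rewrite scalerA -!scalerBl.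
  exact: (sip_norm_sum hs).
(* The induction is over all tolerances: the head of the list takes one half and the tail the
   other. *)
elim: (index_enum J) e e0 => [|j r IH] e e0.
  by exists 1 => // r _ _; rewrite big_nil mulr_ge0// ltW.
have e2 : 0 < e / 2 by rewrite divr_gt0.
have K0 : 0 < nrm (f j) + 1 by rewrite ltr_wpDl// sqrtr_ge0.
have [d d0 hd] := IH _ e2; have [d' d0' hd'] := hg j t _ ht (divr_gt0 e2 K0).
exists (Num.min d d'); first by rewrite lt_min d0.
move=> q hq; rewrite lt_min => /andP[q1 q2]; rewrite big_cons.
have := hd q hq q1; have := hd' q hq q2; rewrite mulrAC ler_pdivlMr// => h h'.
have := sqrtr_ge0 (s (f j) (f j)); rewrite -/(nrm _) => n0.
have := normr_ge0 (g j q - g j t - (q - t) * dg j t) => g0.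
lra.
Qed.

End MoreInnerProduct.

Section LipschitzCombinations.
Variables (R : realType) (T : R) (I : finType).
Hypothesis T0 : 0 < T.
Local Notation loclip := (@loclip R T I).

Section OneSpace.
Variables (V : lmodType R) (A : set V) (s : V -> V -> R).
Hypothesis hs : sip A s.

(* Curves in a finite dimensional space are handled through such combinations with
   locally Lipschitz coefficients: they are preserved by multilinear maps. *)
Definition lcomb (Psi : R -> (I -> R) -> V) := exists (J : finType)
  (g : J -> R -> (I -> R) -> R) (f : J -> V), [/\ forall j, loclip (g j),
    forall j, A (f j) & forall t x, Psi t x = \sum_j g j t x *: f j].

Lemma lcomb_sum (J : finType) (g : J -> R -> (I -> R) -> R) (f : J -> V) :
  (forall j, loclip (g j)) -> (forall j, A (f j)) -> lcomb (fun t x => \sum_j g j t x *: f j).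
Proof. by move=> hg hf; exists J, g, f. Qed.

Lemma lcomb_cst v : A v -> lcomb (fun _ _ => v).
Proof.
move=> hv; exists unit, (fun _ _ _ => 1), (fun _ => v); split => //.
  by move=> _; apply: loclip_time => //; exact: contT_cst.
by move=> t x; rewrite big_const card_unit /= scale1r addr0.
Qed.

Lemma lcomb_in Psi t x : lcomb Psi -> A (Psi t x).
Proof. by move=> [J [g [f [_ hf ->]]]]; exact: (sip_sum hs). Qed.

(** Linearity of B expands it along the fixed vectors of the combination. Applied to one argument at
    a time, this gives the statements for two, three and four arguments. *)
Lemma lcomb_lfun Psi (B : R -> (I -> R) -> V -> R) : lcomb Psi ->
  (forall t x, lfun A s (B t x)) -> (forall f, A f -> loclip (fun t x => B t x f)) ->
  loclip (fun t x => B t x (Psi t x)).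
Proof.
move=> [J [g [f [hg hf hP]]]] hB lB.
apply: (@loclip_eq _ _ _ T0 (fun t x => \sum_j g j t x * B t x (f j))) => [t x _|].
  by rewrite hP (lfun_sum hs _ _ (hB t x) hf).
by apply: loclip_sum => // j; apply: loclip_mul => //; exact: lB.
Qed.

Lemma lcomb_C0 Psi (x : R -> I -> R) : lcomb Psi -> (forall i, contT T (x ^~ i)) ->
  C0_on T (fun v => Num.sqrt (s v v)) A (fun t => Psi t (x t)).
Proof.
move=> [J [g [f [hg hf hP]]]] cx; rewrite (funext (fun t => hP t (x t))).
by apply: (C0_sum hs T0) => // j; exact: loclip_comp.
Qed.

End OneSpace.

Section Multi.
Variables (V1 V2 V3 V4 : lmodType R) (A1 : set V1) (A2 : set V2) (A3 : set V3) (A4 : set V4).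
Variables (s1 : V1 -> V1 -> R) (s2 : V2 -> V2 -> R) (s3 : V3 -> V3 -> R) (s4 : V4 -> V4 -> R).
Hypotheses (h1 : sip A1 s1) (h2 : sip A2 s2) (h3 : sip A3 s3) (h4 : sip A4 s4).

Definition lfun2 (f : V1 -> V2 -> R) :=
  (forall y, A2 y -> lfun A1 s1 (f ^~ y)) /\ (forall x, A1 x -> lfun A2 s2 (f x)).
Definition lfun3 (f : V1 -> V2 -> V3 -> R) :=
  [/\ forall y z, A2 y -> A3 z -> lfun A1 s1 (fun x => f x y z),
      forall x z, A1 x -> A3 z -> lfun A2 s2 (fun y => f x y z)
    & forall x y, A1 x -> A2 y -> lfun A3 s3 (f x y)].
Definition lfun4 (f : V1 -> V2 -> V3 -> V4 -> R) :=
  [/\ forall y z w, A2 y -> A3 z -> A4 w -> lfun A1 s1 (fun x => f x y z w),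
      forall x z w, A1 x -> A3 z -> A4 w -> lfun A2 s2 (fun y => f x y z w),
      forall x y w, A1 x -> A2 y -> A4 w -> lfun A3 s3 (fun z => f x y z w)
    & forall x y z, A1 x -> A2 y -> A3 z -> lfun A4 s4 (f x y z)].

Lemma lfun2_eq f x x' y y' : lfun2 f -> A1 x -> A1 x' -> A2 y -> A2 y' ->
  s1 (x - x') (x - x') = 0 -> s2 (y - y') (y - y') = 0 -> f x y = f x' y'.
Proof.
move=> [f1 f2] hx hx' hy hy' e1 e2.
by rewrite (lfun_eq h1 (f1 y hy) hx hx' e1) (lfun_eq h2 (f2 _ hx') hy hy' e2).
Qed.

Lemma lfun3_eq f x x' y y' z z' : lfun3 f -> A1 x -> A1 x' -> A2 y -> A2 y' -> A3 z -> A3 z' ->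
  s1 (x - x') (x - x') = 0 -> s2 (y - y') (y - y') = 0 -> s3 (z - z') (z - z') = 0 ->
  f x y z = f x' y' z'.
Proof.
move=> [f1 f2 f3] hx hx' hy hy' hz hz' e1 e2 e3.
rewrite (lfun_eq h1 (f1 _ _ hy hz) hx hx' e1) (lfun_eq h2 (f2 _ _ hx' hz) hy hy' e2).
by rewrite (lfun_eq h3 (f3 _ _ hx' hy') hz hz' e3).
Qed.

Lemma lfun4_eq f x x' y y' z z' w w' : lfun4 f -> A1 x -> A1 x' -> A2 y -> A2 y' ->
  A3 z -> A3 z' -> A4 w -> A4 w' ->
  s1 (x - x') (x - x') = 0 -> s2 (y - y') (y - y') = 0 -> s3 (z - z') (z - z') = 0 ->
  s4 (w - w') (w - w') = 0 -> f x y z w = f x' y' z' w'.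
Proof.
move=> [f1 f2 f3 f4] hx hx' hy hy' hz hz' hw hw' e1 e2 e3 e4.
rewrite (lfun_eq h1 (f1 _ _ _ hy hz hw) hx hx' e1) (lfun_eq h2 (f2 _ _ _ hx' hz hw) hy hy' e2).
by rewrite (lfun_eq h3 (f3 _ _ _ hx' hy' hw) hz hz' e3) (lfun_eq h4 (f4 _ _ _ hx' hy' hz') hw hw' e4).
Qed.

Lemma loclip2 f P1 P2 : lfun2 f -> lcomb A1 P1 -> lcomb A2 P2 ->
  loclip (fun t x => f (P1 t x) (P2 t x)).
Proof.
move=> [f1 f2] c1 c2.
apply: (lcomb_lfun h1 (B := fun t x v => f v (P2 t x)) c1) => [t x|v hv].
  by apply: f1; exact: (lcomb_in h2).
by apply: (lcomb_lfun h2 (B := fun t x => f v) c2) => [t x|w hw];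
  [exact: f2|apply: loclip_time => //; exact: contT_cst].
Qed.

Lemma loclip3 f P1 P2 P3 : lfun3 f -> lcomb A1 P1 -> lcomb A2 P2 -> lcomb A3 P3 ->
  loclip (fun t x => f (P1 t x) (P2 t x) (P3 t x)).
Proof.
move=> [f1 f2 f3] c1 c2 c3.
apply: (lcomb_lfun h1 (B := fun t x v => f v (P2 t x) (P3 t x)) c1) => [t x|v hv].
  by apply: f1; [exact: (lcomb_in h2)|exact: (lcomb_in h3)].
apply: (lcomb_lfun h2 (B := fun t x w => f v w (P3 t x)) c2) => [t x|w hw].
  by apply: f2 => //; exact: (lcomb_in h3).
by apply: (lcomb_lfun h3 (B := fun t x => f v w) c3) => [t x|z hz];
  [exact: f3|apply: loclip_time => //; exact: contT_cst].
Qed.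

Lemma loclip4 f P1 P2 P3 P4 : lfun4 f -> lcomb A1 P1 -> lcomb A2 P2 -> lcomb A3 P3 ->
  lcomb A4 P4 -> loclip (fun t x => f (P1 t x) (P2 t x) (P3 t x) (P4 t x)).
Proof.
move=> [f1 f2 f3 f4] c1 c2 c3 c4.
apply: (lcomb_lfun h1 (B := fun t x v => f v (P2 t x) (P3 t x) (P4 t x)) c1) => [t x|v hv].
  by apply: f1; [exact: (lcomb_in h2)|exact: (lcomb_in h3)|exact: (lcomb_in h4)].
apply: (lcomb_lfun h2 (B := fun t x w => f v w (P3 t x) (P4 t x)) c2) => [t x|w hw].
  by apply: f2 => //; [exact: (lcomb_in h3)|exact: (lcomb_in h4)].
apply: (lcomb_lfun h3 (B := fun t x z => f v w z (P4 t x)) c3) => [t x|z hz].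
  by apply: f3 => //; exact: (lcomb_in h4).
by apply: (lcomb_lfun h4 (B := fun t x => f v w z) c4) => [t x|y hy];
  [exact: f4|apply: loclip_time => //; exact: contT_cst].
Qed.

End Multi.
End LipschitzCombinations.

(** * The scheme for abstract forms *)

Section Scheme.
Variables (R : realType) (T : R) (X Y : lmodType R).
Variables (S U V : set X) (W L : set Y) (s : X -> X -> R) (q : Y -> Y -> R).
Variables (N Tr P Z : X -> X -> X -> R) (G C Dd : X -> X -> R).
Variables (B : X -> X -> X -> X -> R) (b : X -> Y -> R) (Th : R -> Y -> R).
Variable c : constants R.
Implicit Types (u m k z H v F g : X) (p r : Y) (t : R).

(** [sok_N0], [sok_Tr0] and [sok_B0] are the cancellations behind the energy estimates. [sok_injW]
    and [sok_injL] are injectivity conditions dual to surjectivity of the divergence; they feed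
    [lifting]. *)
Record scheme_ok : Prop := SchemeOk {
  sok_S : sip S s; sok_U : sip U s; sok_V : sip V s; sok_W : sip W q; sok_L : sip L q;
  sok_N : lfun3 S S S s s s N; sok_Tr : lfun3 S V V s s s Tr;
  sok_P : lfun3 S U V s s s P; sok_Z : lfun3 S V U s s s Z;
  sok_G : lfun2 S S s s G; sok_C : lfun2 U V s s C; sok_D : lfun2 V V s s Dd;
  sok_B : lfun4 V V V V s s s s B;
  sok_bW : lfun2 V W s q b; sok_bL : lfun2 S L s q b;
  sok_N0 : forall u v, S u -> S v -> N u v u = 0;
  sok_Tr0 : forall u m, S u -> V m -> Tr u m m = 0;
  sok_B0 : forall m v H, V m -> V v -> V H -> B m v H m = 0;
  sok_G0 : forall u, S u -> 0 <= G u u;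
  sok_D0 : forall m, V m -> 0 <= Dd m m;
  sok_injW : forall r, W r -> (forall v, V v -> b v r = 0) -> q r r = 0;
  sok_injL : forall r, L r -> (forall v, S v -> b v r = 0) -> q r r = 0;
  sok_Th : forall r, W r -> contT T (fun t => Th t r);
  sok_Thl : forall t, 0 <= t <= T -> lfun W q (Th t) }.

(* [Z u m w] stands for (u x m, w), [P v k H] for (v x k, H), [C w m] for (curl w, m),
   [b v r] for (div v, r), [B m n H F] for (m x (n x H), F), [N u w v] for (u x curl w, v)
   and [Th t r] for (div H_e(t), r). *)
Definition velocity_form u m k H v := - eta c * G u v + (mu0 c * Tr v H m + (mu0 c / 2 * P v k H + N u u v)).
Definition magnetization_form u m z k H F := 2^-1 * Z u F k + (- 2^-1 * C z F + (sigma c * C k F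
  + (sigma c * Dd m F + ((tau c)^-1 * s m F + (- (chi0 c / tau c) * s H F
  + (beta c * B m m H F + Tr u m F)))))).

Definition abstract_solution ui mi (u du : R -> X) (p : R -> Y) (m dm z k H : R -> X) (ph : R -> Y) :=
  let n v := Num.sqrt (s v v) in let nq r := Num.sqrt (q r r) in
  [/\ [/\ C1_on T n S u du, C0_on T nq L p, C1_on T n V m dm
        & [/\ C0_on T n U z, C0_on T n U k, C0_on T n V H & C0_on T nq W ph]],
      s (u 0 - ui) (u 0 - ui) = 0, s (m 0 - mi) (m 0 - mi) = 0
    & forall t, 0 <= t <= T ->
      [/\ forall v, S v -> s (du t) v = velocity_form (u t) (m t) (k t) (H t) v + b v (p t),
          forall r, L r -> b (u t) r = 0,
          forall F, V F -> s (dm t) F = - magnetization_form (u t) (m t) (z t) (k t) (H t) F,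
          (forall w, U w -> s (z t) w = Z (u t) (m t) w) /\
          (forall w, U w -> s (k t) w = C w (m t))
        & (forall g, V g -> s (H t) g + b g (ph t) = 0) /\
          (forall r, W r -> b (H t) r + b (m t) r + Th t r = 0)]].

Hypothesis T0 : 0 < T.
Hypothesis ok : scheme_ok.

Let hS := sok_S ok.
Let hU := sok_U ok.
Let hV := sok_V ok.
Let hW := sok_W ok.
Let hL := sok_L ok.

(* Testing with these fields eliminates the pressure. *)
Definition div_kernel : set X := [set v | S v /\ forall r, L r -> b v r = 0].

Lemma sip_kernel : sip div_kernel s.
Proof.
apply: (sip_sub _ _ _ hS) => [v []//||a u v [hu bu] [hv bv]].
  by split=> [|r hr]; [exact: (sip_0 hS)|exact: (lfun0 hS ((sok_bL ok).1 r hr))].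
split=> [|r hr]; first exact: (sip_X hS).
by rewrite ((sok_bL ok).1 r hr).1// bu// bv// mulr0 addr0.
Qed.

Lemma lfun_sub (A A' : set X) l : A' `<=` A -> lfun A s l -> lfun A' s l.
Proof. by move=> sub [h h']; split=> [a x y /sub hx /sub hy|x /sub]; [exact: h|exact: h']. Qed.

Lemma lfun_r (A : set X) x : sip A s -> A x -> lfun A s (s x).
Proof.
move=> hA hx; split=> [a y z hy hz|y hy h].
  by rewrite (sip_sym hA hx (sip_X hA a hy hz)) (sip_lin hA a hy hz hx) !(sip_sym hA hx).
by rewrite (sip_sym hA hx hy) (sip_null hA hy hx h).
Qed.

Lemma lfun2_s (A : set X) : sip A s -> lfun2 A A s s s.
Proof. by move=> hA; split=> x hx; [exact: (sip_lfunl hA)|exact: lfun_r]. Qed.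

Lemma lfun_velocity_form u m k H : S u -> V m -> U k -> V H -> lfun S s (velocity_form u m k H).
Proof.
move=> hu hm hk hH; have [t1 _ _] := sok_Tr ok; have [p1 _ _] := sok_P ok; have [_ _ n3] := sok_N ok.
apply: lfun_comb; first exact: (sok_G ok).2.
apply: lfun_comb; first exact: t1.
by apply: lfun_comb; [exact: p1|exact: n3].
Qed.

Lemma lfun_magnetization_form u m z k H : S u -> V m -> U z -> U k -> V H ->
  lfun V s (magnetization_form u m z k H).
Proof.
move=> hu hm hz hk hH; have [_ _ t3] := sok_Tr ok; have [_ z2 _] := sok_Z ok.
have [_ _ _ b4] := sok_B ok; have [_ c2] := sok_C ok; have [_ d2] := sok_D ok.
apply: lfun_comb; first exact: z2.
apply: lfun_comb; first exact: c2.
apply: lfun_comb; first exact: c2.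
apply: lfun_comb; first exact: d2.
apply: lfun_comb; first exact: (lfun_r hV).
apply: lfun_comb; first exact: (lfun_r hV).
by apply: lfun_comb; [exact: b4|exact: t3].
Qed.

Let eqn x y := s (x - y) (x - y) = 0.

Let eqn_refl x : S x \/ V x -> eqn x x.
Proof.
rewrite /eqn subrr => _; exact: (sip0l hS (sip_0 hS)).
Qed.

Lemma velocity_form_eq u m k H u' m' k' H' v : S u -> V m -> U k -> V H -> S u' -> V m' -> U k' -> V H' ->
  eqn u u' -> eqn m m' -> eqn k k' -> eqn H H' -> S v ->
  velocity_form u m k H v = velocity_form u' m' k' H' v.
Proof.
move=> hu hm hk hH hu' hm' hk' hH' eu em ek eH hv; have ev : eqn v v by apply: eqn_refl; left.
rewrite /velocity_form (lfun2_eq hS hS (sok_G ok) hu hu' hv hv eu ev).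
rewrite (lfun3_eq hS hV hV (sok_Tr ok) hv hv hH hH' hm hm' ev eH em).
rewrite (lfun3_eq hS hU hV (sok_P ok) hv hv hk hk' hH hH' ev ek eH).
by rewrite (lfun3_eq hS hS hS (sok_N ok) hu hu' hu hu' hv hv eu eu ev).
Qed.

Lemma magnetization_form_eq u m z k H u' m' z' k' H' F : S u -> V m -> U z -> U k -> V H ->
  S u' -> V m' -> U z' -> U k' -> V H' ->
  eqn u u' -> eqn m m' -> eqn z z' -> eqn k k' -> eqn H H' -> V F ->
  magnetization_form u m z k H F = magnetization_form u' m' z' k' H' F.
Proof.
move=> hu hm hz hk hH hu' hm' hz' hk' hH' eu em ez ek eH hF.
have eF : eqn F F by apply: eqn_refl; right.
rewrite /magnetization_form (lfun3_eq hS hV hU (sok_Z ok) hu hu' hF hF hk hk' eu eF ek).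
rewrite (lfun2_eq hU hV (sok_C ok) hz hz' hF hF ez eF) (lfun2_eq hU hV (sok_C ok) hk hk' hF hF ek eF).
rewrite (lfun2_eq hV hV (sok_D ok) hm hm' hF hF em eF).
rewrite (null_eq hV hm hm' hF em) (null_eq hV hH hH' hF eH).
rewrite (lfun4_eq hV hV hV hV (sok_B ok) hm hm' hm hm' hH hH' hF hF em em eH eF).
by rewrite (lfun3_eq hS hV hV (sok_Tr ok) hu hu' hm hm' hF hF eu em eF).
Qed.

Variables (n1 n2 n3 n4 n5 : nat) (phi : 'I_n1 -> X) (psi : 'I_n2 -> X) (kap : 'I_n3 -> X)
  (om : 'I_n4 -> Y) (el : 'I_n5 -> Y) (lam : 'I_n4 -> X) (nu : 'I_n5 -> X).
Hypotheses (bphi : obasis div_kernel s phi) (bpsi : obasis V s psi) (bkap : obasis U s kap)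
  (bom : obasis W q om) (bel : obasis L q el).
Hypothesis hlam : [/\ forall i, V (lam i), forall i j, b (lam i) (om j) = (i == j)%:R &
  forall x i, V x -> (forall r, W r -> b x r = 0) -> s (lam i) x = 0].
Hypothesis hnu : (forall i, S (nu i)) /\ forall i j, b (nu i) (el j) = (i == j)%:R.

Local Notation I := ('I_n1 + 'I_n2)%type.
Implicit Type x : I -> R.

Definition uf (_ : R) x : X := \sum_i x (inl i) *: phi i.
Definition mf (_ : R) x : X := \sum_j x (inr j) *: psi j.
Definition kf t x : X := \sum_i C (kap i) (mf t x) *: kap i.
Definition zf t x : X := \sum_i Z (uf t x) (mf t x) (kap i) *: kap i.
(** Minus the lifting of div m + div H_e. Being a combination of [lam], it is orthogonal to
    divergence-free fields, which is the condition for a potential to exist; since (om_i, div lam_j)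
    is the identity matrix, testing with [lam i] reads off the coefficients in [phf]. *)
Definition Hf t x : X := \sum_i (-1 * b (mf t x) (om i) + -1 * Th t (om i)) *: lam i.
Definition phf t x : Y := \sum_i (-1 * s (Hf t x) (lam i)) *: om i.
Definition Gf t x (i : I) : R := match i with
  | inl i => velocity_form (uf t x) (mf t x) (kf t x) (Hf t x) (phi i)
  | inr j => -1 * magnetization_form (uf t x) (mf t x) (zf t x) (kf t x) (Hf t x) (psi j) end.

Local Notation lcomb := (lcomb T (I := I)).
Local Notation loclip := (@loclip R T I).

Let phiS i : S (phi i). Proof. exact: (bphi.1.1 i).1. Qed.
Let psiV j : V (psi j). Proof. exact: bpsi.1.1. Qed.
Let kapU j : U (kap j). Proof. exact: bkap.1.1. Qed.
Let omW j : W (om j). Proof. exact: bom.1.1. Qed.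
Let elL j : L (el j). Proof. exact: bel.1.1. Qed.

Lemma loclip_lin (a : R) (f g : R -> (I -> R) -> R) : loclip f -> loclip g ->
  loclip (fun t x => a * f t x + g t x).
Proof. by move=> hf hg; apply: loclip_add => //; exact: loclip_cmul. Qed.

Lemma uf_comb : lcomb div_kernel uf.
Proof. by apply: lcomb_sum; [move=> j; exact: loclip_coord|move=> j; exact: bphi.1.1]. Qed.
Lemma uf_combS : lcomb S uf.
Proof. by apply: lcomb_sum; [move=> j; exact: loclip_coord|exact: phiS]. Qed.
Lemma mf_comb : lcomb V mf.
Proof. by apply: lcomb_sum; [move=> j; exact: loclip_coord|exact: psiV]. Qed.
Lemma kf_comb : lcomb U kf.
Proof.
apply: lcomb_sum => // j; apply: (loclip2 T0 hU hV (sok_C ok)); last exact: mf_comb.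
exact: lcomb_cst.
Qed.
Lemma zf_comb : lcomb U zf.
Proof.
apply: lcomb_sum => // j; apply: (loclip3 T0 hS hV hU (sok_Z ok) uf_combS mf_comb).
exact: lcomb_cst.
Qed.
Lemma Hf_comb : lcomb V Hf.
Proof.
have [lV _ _] := hlam; apply: lcomb_sum => // j; apply: loclip_lin.
  by apply: (loclip2 T0 hV hW (sok_bW ok) mf_comb); exact: lcomb_cst.
by apply: loclip_cmul => //; apply: loclip_time => //; exact: (sok_Th ok).
Qed.
Lemma phf_comb : lcomb W phf.
Proof.
have [lV _ _] := hlam; apply: lcomb_sum => // j; apply: loclip_cmul => //.
by apply: (loclip2 T0 hV hV (lfun2_s hV) Hf_comb); exact: lcomb_cst.
Qed.

Let ufK t x : div_kernel (uf t x). Proof. exact: (lcomb_in sip_kernel t x uf_comb). Qed.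
Let ufS t x : S (uf t x). Proof. exact: (ufK t x).1. Qed.
Let mfV t x : V (mf t x). Proof. exact: (lcomb_in hV t x mf_comb). Qed.
Let kfU t x : U (kf t x). Proof. exact: (lcomb_in hU t x kf_comb). Qed.
Let zfU t x : U (zf t x). Proof. exact: (lcomb_in hU t x zf_comb). Qed.
Let HfV t x : V (Hf t x). Proof. exact: (lcomb_in hV t x Hf_comb). Qed.
Let phfW t x : W (phf t x). Proof. exact: (lcomb_in hW t x phf_comb). Qed.

Lemma loclip_velocity_form v : S v -> loclip (fun t x => velocity_form (uf t x) (mf t x) (kf t x) (Hf t x) v).
Proof.
move=> hv; have cv := @lcomb_cst _ T I _ _ _ hv.
apply: loclip_lin; first exact: (loclip2 T0 hS hS (sok_G ok) uf_combS cv).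
apply: loclip_lin; first exact: (loclip3 T0 hS hV hV (sok_Tr ok) cv Hf_comb mf_comb).
apply: loclip_lin; first exact: (loclip3 T0 hS hU hV (sok_P ok) cv kf_comb Hf_comb).
exact: (loclip3 T0 hS hS hS (sok_N ok) uf_combS uf_combS cv).
Qed.

Lemma loclip_magnetization_form F : V F ->
  loclip (fun t x => magnetization_form (uf t x) (mf t x) (zf t x) (kf t x) (Hf t x) F).
Proof.
move=> hv; have cv := @lcomb_cst _ T I _ _ _ hv.
apply: loclip_lin; first exact: (loclip3 T0 hS hV hU (sok_Z ok) uf_combS cv kf_comb).
apply: loclip_lin; first exact: (loclip2 T0 hU hV (sok_C ok) zf_comb cv).
apply: loclip_lin; first exact: (loclip2 T0 hU hV (sok_C ok) kf_comb cv).
apply: loclip_lin; first exact: (loclip2 T0 hV hV (sok_D ok) mf_comb cv).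
apply: loclip_lin; first exact: (loclip2 T0 hV hV (lfun2_s hV) mf_comb cv).
apply: loclip_lin; first exact: (loclip2 T0 hV hV (lfun2_s hV) Hf_comb cv).
apply: loclip_lin; first exact: (loclip4 T0 hV hV hV hV (sok_B ok) mf_comb mf_comb Hf_comb cv).
exact: (loclip3 T0 hS hV hV (sok_Tr ok) uf_combS mf_comb cv).
Qed.

Lemma loclip_Gf i : loclip (fun t x => Gf t x i).
Proof.
by case: i => [i|j]; [exact: loclip_velocity_form|apply: loclip_cmul => //; exact: loclip_magnetization_form].
Qed.

Lemma zfE t x w : U w -> s (zf t x) w = Z (uf t x) (mf t x) w.
Proof. by move=> hw; apply: (riesz hU bkap _ hw); have [_ _] := sok_Z ok; exact. Qed.

Lemma kfE t x w : U w -> s (kf t x) w = C w (mf t x).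
Proof. by move=> hw; apply: (riesz hU bkap (l := C ^~ (mf t x)) _ hw); exact: (sok_C ok).1. Qed.

Lemma b_lam (a : 'I_n4 -> R) j : b (\sum_i a i *: lam i) (om j) = a j.
Proof.
have [lV bl _] := hlam.
rewrite (lfun_sum hV _ _ ((sok_bW ok).1 _ (omW j)) lV) (bigD1 j)//= bl eqxx mulr1 big1 ?addr0//.
by move=> i ij; rewrite bl (negbTE ij) mulr0.
Qed.

Lemma HfE t x r : 0 <= t <= T -> W r -> b (Hf t x) r + b (mf t x) r + Th t r = 0.
Proof.
move=> ht hr; have f1 := (sok_bW ok).2 _ (HfV t x); have f2 := (sok_bW ok).2 _ (mfV t x).
rewrite (lfun_basis hW bom f1 hr) (lfun_basis hW bom f2 hr) (lfun_basis hW bom (sok_Thl ok ht) hr).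
rewrite -!big_split big1//= => i _; rewrite /Hf b_lam; lra.
Qed.

Lemma s_lam_ker (a : 'I_n4 -> R) v : V v -> (forall r, W r -> b v r = 0) ->
  s (\sum_i a i *: lam i) v = 0.
Proof.
have [lV _ lo] := hlam; move=> hv h; rewrite (sip_suml hV _ _ hv lV) big1// => i _.
by rewrite lo// mulr0.
Qed.

Lemma phfE t x g : V g -> s (Hf t x) g + b g (phf t x) = 0.
Proof.
have [lV bl lo] := hlam; move=> hg.
have f1 := (sok_bW ok).2 _ hg; rewrite (lfun_sum hW _ _ f1 omW).
(* g' is the divergence-free part of g. H is orthogonal to it, so only the [lam] components of g
   contribute. *)
pose g' := g - \sum_i b g (om i) *: lam i.
have hl := sip_sum hV (index_enum 'I_n4) (fun i => b g (om i)) lV.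
have hg' : V g' by exact: (sipB hV).
have : s (Hf t x) g' = 0.
  apply: s_lam_ker => // r hr; have f2 := (sok_bW ok).1 _ hr.
  have := lfunB f2 hg hl; rewrite /= -/g' => ->; have f3 := (sok_bW ok).2 _ hl.
  rewrite (lfun_basis hW bom f1 hr) (lfun_basis hW bom f3 hr) -sumrB big1// => i _.
  by rewrite b_lam subrr.
rewrite (lfunB (lfun_r hV (HfV t x)) hg hl) (lfun_sum hV _ _ (lfun_r hV (HfV t x)) lV) => e.
have -> : s (Hf t x) g = \sum_i b g (om i) * s (Hf t x) (lam i) by lra.
by rewrite -big_split big1//= => i _; lra.
Qed.

Hypothesis cpos : positive_constants c.

(** Lifting of div H_e: at times in [0, T] the sum of H, m and this field is divergence-free. It
    ignores the state, so its norm is bounded in advance. *)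
Definition Thf (t : R) (_ : I -> R) : X := \sum_i Th t (om i) *: lam i.

Lemma Thf_comb : lcomb V Thf.
Proof.
have [lV _ _] := hlam; apply: lcomb_sum => // j.
by apply: loclip_time => //; exact: (sok_Th ok).
Qed.

(** Tested with m, the trilinear and the double cross product terms vanish, the z and k terms cancel
    to leave sigma |k|^2, and the relaxation term has a sign. What remains is -(chi0 / tau) (H, m),
    where -(H, m) = |H|^2 + (H, Theta) by orthogonality. *)
Lemma energy_m t x : 0 <= t <= T -> - (chi0 c / tau c) * s (Thf t x) (Thf t x) <=
  magnetization_form (uf t x) (mf t x) (zf t x) (kf t x) (Hf t x) (mf t x).
Proof.
move=> ht; have [[e0 mu0 s0] [t0 ch0 be0]] := cpos.
have hTh : V (Thf t x) by exact: (lcomb_in hV t x Thf_comb).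
have [lV _ lo] := hlam.
pose d := Hf t x + mf t x + Thf t x.
have hHm : V (Hf t x + mf t x) by exact: (sipD hV).
have hd : V d by exact: (sipD hV).
have bd r : W r -> b d r = 0.
  move=> hr; have f2 := (sok_bW ok).1 _ hr; rewrite /d -[Hf t x + mf t x]scale1r f2.1//.
  rewrite -[Hf t x]scale1r f2.1// !mul1r.
  rewrite (_ : b (Thf t x) r = Th t r); first exact: HfE.
  rewrite (lfun_basis hW bom ((sok_bW ok).2 _ hTh) hr) (lfun_basis hW bom (sok_Thl ok ht) hr).
  by apply: eq_bigr => i _; rewrite b_lam.
have := s_lam_ker (fun i => -1 * b (mf t x) (om i) + -1 * Th t (om i)) hd bd.
rewrite -/(Hf t x) (sip_sym hV (HfV t x) hd) /d.
rewrite (sipDl hV hHm hTh (HfV t x)) (sipDl hV (HfV t x) (mfV t x) (HfV t x)).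
rewrite (sip_sym hV (mfV t x) (HfV t x)) => eH.
(* Nonnegativity of |Theta / 2 + H|^2 gives |H|^2 + (H, Theta) >= - |Theta|^2 / 4. *)
have h1 := sip_ge0 hV (sip_X hV 2^-1 hTh (HfV t x)).
rewrite (sip_sqr hV 2^-1 hTh (HfV t x)) in h1.
have hTT := sip_ge0 hV hTh.
rewrite /magnetization_form -(zfE _ _ (kfU t x)) -(kfE _ _ (zfU t x)) -(kfE _ _ (kfU t x)).
rewrite (sip_sym hU (zfU t x) (kfU t x)) (sok_B0 ok (mfV t x) (mfV t x) (HfV t x)).
rewrite (sok_Tr0 ok (ufS t x) (mfV t x)).
have r0 : 0 < chi0 c / tau c by rewrite divr_gt0.
have k0 : 0 <= sigma c * s (kf t x) (kf t x) by rewrite mulr_ge0 ?(ltW s0)// (sip_ge0 hU).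
have d0 : 0 <= sigma c * Dd (mf t x) (mf t x) by rewrite mulr_ge0 ?(ltW s0)// (sok_D0 ok).
have m0 : 0 <= (tau c)^-1 * s (mf t x) (mf t x) by rewrite mulr_ge0 ?invr_ge0 ?(ltW t0)// (sip_ge0 hV).
have H0 : 0 <= chi0 c / tau c * (s (Thf t x) (Thf t x) - s (Hf t x) (mf t x)).
  by rewrite mulr_ge0 ?(ltW r0)//; lra.
move: k0 d0 m0 H0; rewrite mulrBr mulr0.
set A1 := _ * s (kf t x) (kf t x); set A2 := _ * Dd _ _; set A3 := _ * s (mf t x) _.
rewrite !mulNr; set A4 := _ * s (Thf t x) _; set A5 := _ * s (Hf t x) _.
set A6 := _ * s (kf t x) _; lra.
Qed.

(* The terms of the momentum balance that survive when it is tested with the velocity. They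
   do not involve the velocity coordinates of [x], hence are bounded once m is. *)
Definition forcing t x v := mu0 c * Tr v (Hf t x) (mf t x) + mu0 c / 2 * P v (kf t x) (Hf t x).

Lemma lfun_forcing t x : lfun S s (forcing t x).
Proof.
have [t1 _ _] := sok_Tr ok; have [p1 _ _] := sok_P ok.
apply: lfun_comb; first exact: t1.
by apply: lfunZ; exact: p1.
Qed.

(** Convection cancels and viscosity has the good sign. The right-hand side is expanded over the
    basis so that the forcing is evaluated only at fixed fields. *)
Lemma energy_u t x : velocity_form (uf t x) (mf t x) (kf t x) (Hf t x) (uf t x) <=
  \sum_i x (inl i) * forcing t x (phi i).
Proof.
have [[e0 _ _] _] := cpos.
rewrite -(lfun_sum hS _ _ (lfun_forcing t x) phiS) -/(uf t x) /velocity_form /forcing.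
rewrite (sok_N0 ok)// addr0 mulNr gerDr oppr_le0 mulr_ge0 ?(ltW e0)//.
exact: (sok_G0 ok).
Qed.

Lemma loclip_forcing v : S v -> loclip (fun t x => forcing t x v).
Proof.
move=> hv; have cv := @lcomb_cst _ T I _ _ _ hv.
apply: loclip_lin; first exact: (loclip3 T0 hS hV hV (sok_Tr ok) cv Hf_comb mf_comb).
apply: loclip_cmul => //; exact: (loclip3 T0 hS hU hV (sok_P ok) cv kf_comb Hf_comb).
Qed.

Let norm_le_sqr (a M : R) : 0 <= M -> a ^+ 2 <= M -> `|a| <= M + 1.
Proof.
move=> M0 aM; have := sqr_ge0 (`|a| - 1); rewrite sqrrB1 real_normK ?num_real//.
by move=> h; have := normr_ge0 a; lra.
Qed.

(** First |m|^2 grows at rate at most C1, which is Gronwall with K = 0. Then the forcing is at most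
    Q on each basis field, and 2 a Q <= a^2 + Q^2 bounds the rate of |u|^2 by |u|^2 + C2, which is
    Gronwall with K = 1. A damping factor in [0, 1] preserves both upper bounds, as they are
    nonnegative. *)
Lemma apriori (x0 : I -> R) : exists2 M, 0 <= M & forall (la : R -> R) (x : R -> I -> R),
  (forall t, 0 <= la t <= 1) -> x 0 = x0 ->
  (forall i, derivT T (x ^~ i) (fun t => la t * Gf t (x t) i)) ->
  forall t i, 0 <= t <= T -> `|x t i| <= M.
Proof.
have [[_ _ _] [t0 ch0 _]] := cpos.
have r0 : 0 < chi0 c / tau c by rewrite divr_gt0.
(* [Thf] does not depend on the state, so a bound at radius 0 holds for all states. *)
have [A A0 hA] := loclip_bounded T0 0 (loclip2 T0 hV hV (lfun2_s hV) Thf_comb Thf_comb).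
pose w0 := \sum_j x0 (inr j) ^+ 2.
have w00 : 0 <= w0 by apply: sumr_ge0 => j _; exact: sqr_ge0.
pose C1 := 2 * (chi0 c / tau c * A); have C10 : 0 <= C1.
  by apply: mulr_ge0 => //; apply: mulr_ge0 => //; exact: ltW.
(* The final 1 comes from |a| <= a^2 + 1, which avoids square roots. *)
pose M1 := w0 + C1 * T + 1.
have M10 : 0 <= M1 by rewrite !addr_ge0// mulr_ge0// ltW.
have [Q Q0 hQ] : exists2 Q, 0 <= Q & forall i t x, 0 <= t <= T ->
    (forall j, `|x j| <= M1) -> `|forcing t x (phi i)| <= Q.
  apply: (@finite_bound _ 'I_n1 (fun i M => forall t x, 0 <= t <= T ->
    (forall j, `|x j| <= M1) -> `|forcing t x (phi i)| <= M)).
    by move=> i M M' MM h t x ht hx; exact: le_trans (h t x ht hx) MM.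
  by move=> i; apply: loclip_bounded => //; exact: loclip_forcing.
pose v0 := \sum_i x0 (inl i) ^+ 2.
have v00 : 0 <= v0 by apply: sumr_ge0 => j _; exact: sqr_ge0.
pose C2 := \sum_(i < n1) Q ^+ 2.
have C20 : 0 <= C2 by apply: sumr_ge0 => j _; exact: sqr_ge0.
pose M2 := (v0 + C2 * T) * expR (1 * T).
have M20 : 0 <= M2 by rewrite mulr_ge0 ?expR_ge0// addr_ge0// mulr_ge0// ltW.
exists (M1 + (M2 + 1)); first by rewrite addr_ge0// addr_ge0.
move=> la x hla xx0 dx.
pose w t := \sum_j x t (inr j) ^+ 2; pose v t := \sum_i x t (inl i) ^+ 2.
have dw : derivT T w (fun t => \sum_j 2 * (x t (inr j) * (la t * Gf t (x t) (inr j)))).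
  by apply: derivT_sum => j; apply: derivT_sqr => //; exact: (dx (inr j)).
have dv : derivT T v (fun t => \sum_i 2 * (x t (inl i) * (la t * Gf t (x t) (inl i)))).
  by apply: derivT_sum => j; apply: derivT_sqr => //; exact: (dx (inl j)).
have hw t : 0 <= t <= T -> w t <= w0 + C1 * T.
  move=> ht; have [ww0] : w 0 = w0 by rewrite /w xx0.
  have := gronwall T0 (lexx 0) C10 _ dw _ ht; rewrite ww0 mul0r expR0 mulr1; apply => // {}t {}ht.
  rewrite mul0r add0r; have [l0 l1] := andP (hla t).
  have -> : \sum_j 2 * (x t (inr j) * (la t * Gf t (x t) (inr j))) =
      (2 * la t) *
      - magnetization_form (uf t (x t)) (mf t (x t)) (zf t (x t)) (kf t (x t)) (Hf t (x t)) (mf t (x t)).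
    rewrite (lfun_sum hV _ _ (lfun_magnetization_form _ _ _ _ _) psiV)//.
    by rewrite -sumrN mulr_sumr; apply: eq_bigr => j _ /=; lra.
  apply: le_trans (_ : 2 * la t * (chi0 c / tau c * A) <= _).
    rewrite ler_wpM2l ?mulr_ge0//; apply: le_trans (_ : chi0 c / tau c * s (Thf t (x t)) (Thf t (x t)) <= _).
      by rewrite lerNl -mulNr energy_m.
    rewrite ler_wpM2l ?(ltW r0)//.
    by apply: le_trans (ler_norm _) _; apply: (hA t (fun=> 0)) => // i; rewrite normr0.
  by rewrite /C1 -mulrA ler_wpM2l// ler_piMl// mulr_ge0// ltW.
have hx1 t j : 0 <= t <= T -> `|x t (inr j)| <= M1.
  move=> ht; apply: norm_le_sqr; first by rewrite addr_ge0// mulr_ge0// ltW.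
  apply: le_trans (hw t ht); rewrite /w (bigD1 j)//= lerDl.
  by apply: sumr_ge0 => k _; exact: sqr_ge0.
have hv t : 0 <= t <= T -> v t <= M2.
  move=> ht; have vv0 : v 0 = v0 by rewrite /v xx0.
  have := gronwall T0 ler01 C20 _ dv _ ht; rewrite vv0; apply => // {}t {}ht.
  have [l0 l1] := andP (hla t).
  have -> : \sum_i 2 * (x t (inl i) * (la t * Gf t (x t) (inl i))) =
      (2 * la t) * velocity_form (uf t (x t)) (mf t (x t)) (kf t (x t)) (Hf t (x t)) (uf t (x t)).
    rewrite (lfun_sum hS _ _ (lfun_velocity_form _ _ _ _) phiS)//.
    by rewrite mulr_sumr; apply: eq_bigr => j _ /=; lra.
  apply: le_trans (_ : (2 * la t) * \sum_i `|x t (inl i)| * Q <= _).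
    rewrite ler_wpM2l ?mulr_ge0//; apply: le_trans (energy_u _ _) _.
    apply: ler_sum => i _; apply: le_trans (ler_norm _) _; rewrite normrM ler_wpM2l//.
    (* Zeroing the velocity coordinates leaves the forcing unchanged by conversion and brings the
       state within the radius M1 for which Q was chosen, before any bound on u is known. *)
    pose x' (j : I) := if j is inr _ then x t j else 0.
    apply: (hQ i t x') => //; case=> [j|j] /=; last exact: hx1.
    by rewrite normr0.
  rewrite mul1r /C2 /v -big_split /=.
  apply: le_trans (_ : 2 * \sum_i `|x t (inl i)| * Q <= _).
    rewrite -mulrA ler_wpM2l// ler_piMl//.
    by apply: sumr_ge0 => j _; exact: mulr_ge0.
  rewrite mulr_sumr; apply: ler_sum => i _.
  have := sqr_ge0 (`|x t (inl i)| - Q); rewrite sqrrB real_normK ?num_real//; lra.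
move=> t [i|j] ht.
  apply: le_trans (_ : M2 + 1 <= _); last by rewrite lerDr.
  apply: norm_le_sqr => //; apply: le_trans (hv t ht); rewrite /v (bigD1 i)//= lerDl.
  by apply: sumr_ge0 => k _; exact: sqr_ge0.
by apply: le_trans (hx1 t j ht) _; rewrite lerDl addr_ge0.
Qed.

Lemma b_nu (a : 'I_n5 -> R) v : S v -> b v (\sum_j a j *: el j) = \sum_j a j * b v (el j).
Proof. by move=> hv; rewrite (lfun_sum hL _ _ ((sok_bL ok).2 v hv) elL). Qed.

Definition coords u m (i : I) : R := match i with inl i => s u (phi i) | inr j => s m (psi j) end.

Lemma abstract_existence ui mi : div_kernel ui -> V mi ->
  exists (u du : R -> X) (p : R -> Y) (m dm z k H : R -> X) (ph : R -> Y),
    abstract_solution ui mi u du p m dm z k H ph.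
Proof.
move=> hui hmi.
pose x0 := coords ui mi.
have [M M0 hM] := apriori x0.
have [x [xx0 dx]] := ode_global T0 M0 loclip_Gf hM.
have cx i : contT T (x ^~ i) by exact: (derivT_cont T0 (dx i)).
have cG i : contT T (fun t => Gf t (x t) i) by exact: (loclip_comp T0 (loclip_Gf i) cx).
pose du t := \sum_i Gf t (x t) (inl i) *: phi i.
pose dm t := \sum_j Gf t (x t) (inr j) *: psi j.
pose RUx t := velocity_form (uf t (x t)) (mf t (x t)) (kf t (x t)) (Hf t (x t)).
have lRU t : lfun S s (RUx t) by exact: lfun_velocity_form.
have [nuS nuE] := hnu.
(* The pressure coefficients are the residuals of the momentum equation on the lifted fields [nu],
   which are dual to the basis of L. *)
pose p t := \sum_l (s (du t) (nu l) + -1 * RUx t (nu l)) *: el l.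
have C1u : C1_on T (fun v => Num.sqrt (s v v)) S (fun t => uf t (x t)) du.
  by apply: (C1_sum hS T0) => // i; exact: (dx (inl i)).
have duS t : S (du t) by exact: (sip_sum hS).
exists (fun t => uf t (x t)), du, p, (fun t => mf t (x t)), dm, (fun t => zf t (x t)),
  (fun t => kf t (x t)), (fun t => Hf t (x t)), (fun t => phf t (x t)).
split.
- split; [exact: C1u| | |split].
  + apply: (C0_sum hL T0) => // l; apply: contT_add.
      by have [_ c2 _] := C1u; exact: (C0_contT hS T0 c2).
    apply: contT_mul; first exact: contT_cst.
    exact: (loclip_comp T0 (loclip_velocity_form (nuS l)) cx).
  + by apply: (C1_sum hV T0) => // j; exact: (dx (inr j)).
  + exact: lcomb_C0 zf_comb cx.
  + exact: lcomb_C0 kf_comb cx.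
  + exact: lcomb_C0 Hf_comb cx.
  + exact: lcomb_C0 phf_comb cx.
- rewrite xx0; apply: (null_sym hS hui.1 (ufS _ _)); exact: (bphi.2 ui hui).
- rewrite xx0; apply: (null_sym hV hmi (mfV _ _)); exact: (bpsi.2 mi hmi).
move=> t ht; split.
- move=> v hv; rewrite b_nu//.
  (* v' is the discretely divergence-free part of v, where the equation holds by construction; the
     pressure accounts for the rest. *)
  pose v' := v - \sum_l b v (el l) *: nu l.
  have hl := sip_sum hS (index_enum 'I_n5) (fun l => b v (el l)) nuS.
  have kv' : div_kernel v'.
    split; first exact: (sipB hS).
    move=> r hr; have f2 := (sok_bL ok).1 r hr; have := lfunB f2 hv hl; rewrite /= -/v' => ->.
    have f1 := (sok_bL ok).2 v hv; have f3 := (sok_bL ok).2 _ hl.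
    rewrite (lfun_basis hL bel f1 hr) (lfun_basis hL bel f3 hr) -sumrB big1// => i _.
    rewrite (lfun_sum hS _ _ ((sok_bL ok).1 _ (elL i)) nuS) (bigD1 i)//= nuE eqxx mulr1.
    rewrite big1 ?addr0 ?subrr// => j ji; by rewrite nuE (negbTE ji) mulr0.
  have e1 : s (du t) v' = RUx t v'.
    apply: (riesz sip_kernel bphi _ kv'); apply: lfun_sub (lRU t); by move=> y [].
  have := e1; rewrite (lfunB (lRU t) hv hl) (lfunB (lfun_r hS (duS t)) hv hl).
  rewrite (lfun_sum hS _ _ (lRU t) nuS) (lfun_sum hS _ _ (lfun_r hS (duS t)) nuS) => e2.
  rewrite -/(RUx t) (_ : \sum_j _ = \sum_l b v (el l) * s (du t) (nu l) - \sum_l b v (el l) * RUx t (nu l)).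
    lra.
  by rewrite -sumrB; apply: eq_bigr => j _; lra.
- by move=> r hr; exact: (ufK _ _).2.
- move=> F hF.
  have lRM := lfun_magnetization_form (ufS t (x t)) (mfV t (x t)) (zfU t (x t)) (kfU t (x t))
    (HfV t (x t)).
  have := riesz hV bpsi (lfunZ (-1) lRM) hF.
  by rewrite mulN1r.
- by split=> w hw; [exact: zfE|exact: kfE].
- by split=> [g hg|r hr]; [exact: phfE|exact: HfE].
Qed.

(** Every solution is, up to null vectors, rebuilt from the coordinates of u and m by the same
    formulas, and these coordinates solve the differential equation. This reduces uniqueness to
    [ode_unique]. *)
Lemma abstract_solution_coords ui mi (u du : R -> X) (p : R -> Y) (m dm z k H : R -> X) (ph : R -> Y) :
  abstract_solution ui mi u du p m dm z k H ph ->
  let x t := coords (u t) (m t) in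
  (forall i, derivT T (x ^~ i) (fun t => Gf t (x t) i)) /\
  forall t, 0 <= t <= T -> [/\ eqn (u t) (uf t (x t)), eqn (m t) (mf t (x t)),
    eqn (z t) (zf t (x t)), eqn (k t) (kf t (x t)) & eqn (H t) (Hf t (x t)) /\
    q (ph t - phf t (x t)) (ph t - phf t (x t)) = 0].
Proof.
move=> [[C1u C0p C1m [C0z C0k C0H C0ph]] _ _ sol] x.
have [[uS _] [duS _] _] := C1u; have [[mV _] [dmV _] _] := C1m.
have [zU _] := C0z; have [kU _] := C0k; have [HV _] := C0H; have [phW _] := C0ph.
have [pL _] := C0p.
have [lV bl lo] := hlam.
have E t : 0 <= t <= T -> [/\ eqn (u t) (uf t (x t)), eqn (m t) (mf t (x t)),
    eqn (z t) (zf t (x t)), eqn (k t) (kf t (x t)) & eqn (H t) (Hf t (x t)) /\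
    q (ph t - phf t (x t)) (ph t - phf t (x t)) = 0].
  move=> ht; have [_ divu _ [ez ek] [eH eph]] := sol t ht.
  have Hu := uS t ht; have Hm := mV t ht; have Hz := zU t ht; have Hk := kU t ht.
  have HH := HV t ht; have Hph := phW t ht.
  have eu : eqn (u t) (uf t (x t)) by exact: (bphi.2 (u t)).
  have em : eqn (m t) (mf t (x t)) by exact: (bpsi.2 (m t)).
  have eH' : eqn (H t) (Hf t (x t)).
    (* The difference d is divergence-free. The potential equation makes H t orthogonal to d, the
       choice of [lam] makes the rebuilt field orthogonal to it, so d is orthogonal to itself. *)
    pose d := H t - Hf t (x t); have hd : V d by exact: (sipB hV).
    have bd r : W r -> b d r = 0.
      move=> hr; have f2 := (sok_bW ok).1 r hr.
      have := lfunB f2 HH (HfV t (x t)); rewrite /= -/d => ->.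
      have := eph r hr; have := HfE (x t) ht hr; rewrite (lfun_eq hV f2 Hm (mfV t (x t)) em); lra.
    have s1 : s (H t) d = 0.
      have := eH d hd; rewrite (lfun_basis hW bom ((sok_bW ok).2 d hd) Hph) big1 ?addr0//.
      by move=> i _; rewrite bd ?mulr0.
    have s2 : s (Hf t (x t)) d = 0 by exact: s_lam_ker.
    by rewrite /eqn -/d /d (sipBl hV HH (HfV t (x t)) hd) s1 s2 subrr.
  split=> //; [| |split=> //].
  - apply: (null_basis hU bkap Hz (zfU _ _)) => i; rewrite ez// zfE//.
    apply: (lfun3_eq hS hV hU (sok_Z ok)) => //; rewrite subrr; exact: (sip0l hU (sip_0 hU)).
  - apply: (null_basis hU bkap Hk (kfU _ _)) => i; rewrite ek// kfE//.
    apply: (lfun2_eq hU hV (sok_C ok)) => //; rewrite subrr; exact: (sip0l hU (sip_0 hU)).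
  apply: (null_basis hW bom Hph (phfW _ _)) => i.
  have := eH _ (lV i); have := phfE t (x t) (lV i).
  rewrite (lfun_eq hV (sip_lfunl hV (lV i)) HH (HfV t (x t)) eH').
  have f1 := (sok_bW ok).2 _ (lV i).
  (* Against [lam i] the form b reads the i-th coefficient, so these tests determine the
     potential. *)
  have bE r : W r -> b (lam i) r = q r (om i).
    move=> hr; rewrite (lfun_basis hW bom f1 hr) (bigD1 i)//= bl eqxx mulr1 big1 ?addr0// => j ji.
    by rewrite bl eq_sym (negbTE ji) mulr0.
  by rewrite !bE//; lra.
split=> // i; case: i => [i|j].
  have := C1_derivT hS C1u (phiS i); apply: derivT_eqd => t ht.
  have [eqU _ _ _ _] := sol t ht; have [eu em ez ek [eH eph]] := E t ht.
  rewrite eqU// (bphi.1.1 i).2 ?addr0; last exact: pL.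
  by apply: velocity_form_eq => //; [exact: uS|exact: mV|exact: kU|exact: HV].
have := C1_derivT hV C1m (psiV j); apply: derivT_eqd => t ht.
have [_ _ eqM _ _] := sol t ht; have [eu em ez ek [eH eph]] := E t ht.
rewrite eqM//= mulN1r; congr (- _).
by apply: magnetization_form_eq => //; [exact: uS|exact: mV|exact: zU|exact: kU|exact: HV].
Qed.

Lemma abstract_uniqueness ui mi (u du : R -> X) (p : R -> Y) (m dm z k H : R -> X) (ph : R -> Y)
    (u' du' : R -> X) (p' : R -> Y) (m' dm' z' k' H' : R -> X) (ph' : R -> Y) :
  S ui -> V mi ->
  abstract_solution ui mi u du p m dm z k H ph ->
  abstract_solution ui mi u' du' p' m' dm' z' k' H' ph' ->
  forall t, 0 <= t <= T -> [/\ eqn (u t) (u' t), q (p t - p' t) (p t - p' t) = 0,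
    eqn (m t) (m' t), eqn (z t) (z' t)
    & [/\ eqn (k t) (k' t), eqn (H t) (H' t) & q (ph t - ph' t) (ph t - ph' t) = 0]].
Proof.
move=> hui hmi sol sol'.
have [dx E] := abstract_solution_coords sol.
have [dx' E'] := abstract_solution_coords sol'.
pose x t := coords (u t) (m t); pose x' t := coords (u' t) (m' t).
have [[C1u C0p C1m [C0z C0k C0H C0ph]] u0 m0 eqs] := sol.
have [[C1u' C0p' C1m' [C0z' C0k' C0H' C0ph']] u0' m0' eqs'] := sol'.
have [[uS _] [duS _] _] := C1u; have [[mV _] _ _] := C1m.
have [zU _] := C0z; have [kU _] := C0k; have [HV _] := C0H; have [phW _] := C0ph.
have [[uS' _] [duS' _] _] := C1u'; have [[mV' _] _ _] := C1m'.
have [zU' _] := C0z'; have [kU' _] := C0k'; have [HV' _] := C0H'; have [phW' _] := C0ph'.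
have [pL _] := C0p; have [pL' _] := C0p'.
have T00 : 0 <= (0 : R) <= T by rewrite lexx ltW.
have xx0 : x 0 = x' 0.
  apply/funext => -[i|j] /=.
    by rewrite (null_eq hS (uS _ T00) hui (phiS i) u0) (null_eq hS (uS' _ T00) hui (phiS i) u0').
  by rewrite (null_eq hV (mV _ T00) hmi (psiV j) m0) (null_eq hV (mV' _ T00) hmi (psiV j) m0').
have xx t : 0 <= t <= T -> x t = x' t.
  by move=> ht; apply/funext => i; exact: (ode_unique T0 loclip_Gf xx0 dx dx').
have Q t : 0 <= t <= T -> [/\ eqn (u t) (u' t), eqn (m t) (m' t), eqn (z t) (z' t)
    & [/\ eqn (k t) (k' t), eqn (H t) (H' t) & q (ph t - ph' t) (ph t - ph' t) = 0]].
  move=> ht; have := E' t ht; rewrite -/(x' t) -(xx t ht) => -[eu' em' ez' ek' [eH' eph']].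
  have [eu em ez ek [eH eph]] := E t ht.
  have tr A (hA : sip A s) a a' a'' : A a -> A a' -> A a'' -> eqn a a'' -> eqn a' a'' -> eqn a a'.
    move=> h1 h2 h3 e1 e2; apply: (null_trans hA h1 h3 h2 e1); exact: (null_sym hA h2 h3 e2).
  split; [|..|split].
  - by apply: (tr _ hS _ _ _ _ _ _ eu eu'); [exact: uS|exact: uS'|].
  - by apply: (tr _ hV _ _ _ _ _ _ em em'); [exact: mV|exact: mV'|].
  - by apply: (tr _ hU _ _ _ _ _ _ ez ez'); [exact: zU|exact: zU'|].
  - by apply: (tr _ hU _ _ _ _ _ _ ek ek'); [exact: kU|exact: kU'|].
  - by apply: (tr _ hV _ _ _ _ _ _ eH eH'); [exact: HV|exact: HV'|].
  - have h1 := phW t ht; have h2 := phW' t ht.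
    exact: (null_trans hW h1 (phfW t (x t)) h2 eph (null_sym hW h2 (phfW t (x t)) eph')).
move=> t ht; have [eu em ez [ek eH eph]] := Q t ht; split=> //.
(* Equal velocities have equal time derivatives, also at the end points of [0, T]. Subtracting the
   momentum equations leaves b v (p - p') = 0 for all v, and injectivity applies. *)
have hd := sipB hL (pL t ht) (pL' t ht); apply: (sok_injL ok hd) => v hv.
have f := (sok_bL ok).2 v hv; rewrite (lfunB f (pL t ht) (pL' t ht)).
have d1 := C1_derivT hS C1u hv; have d2 := C1_derivT hS C1u' hv.
have e0 (r : R) : 0 <= r <= T -> s (u' r) v = s (u r) v.
  move=> hr; have [eur _ _ _] := Q r hr; symmetry.
  exact: (null_eq hS (uS r hr) (uS' r hr) hv eur).
have := derivT_eq T0 d1 (derivT_eqf e0 d2) ht.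
have [eqU _ _ _ _] := eqs t ht; have [eqU' _ _ _ _] := eqs' t ht.
rewrite eqU// eqU'// (@velocity_form_eq (u t) (m t) (k t) (H t) (u' t) (m' t) (k' t) (H' t) v)//; [lra|..];
  [exact: uS|exact: mV|exact: kU|exact: HV|exact: uS'|exact: mV'|exact: kU'|exact: HV'].
Qed.

End Scheme.

Section SchemeTheorems.
Variables (R : realType) (T : R) (X Y : lmodType R).
Variables (S U V : set X) (W L : set Y) (s : X -> X -> R) (q : Y -> Y -> R).
Variables (N Tr P Z : X -> X -> X -> R) (G C Dd : X -> X -> R).
Variables (B : X -> X -> X -> X -> R) (b : X -> Y -> R) (Th : R -> Y -> R).
Variable c : constants R.
Hypotheses (T0 : 0 < T) (ok : scheme_ok T S U V W L s q N Tr P Z G C Dd B b Th).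
Hypotheses (fS : findim S s) (fU : findim U s) (fV : findim V s) (fW : findim W q)
  (fL : findim L q).

(** [lifting] is applied twice: to W through V, which yields H and its potential, and to L through
    S, which yields the pressure. *)
Lemma scheme_bases : exists (n1 n2 n3 n4 n5 : nat) (phi : 'I_n1 -> X) (psi : 'I_n2 -> X)
    (kap : 'I_n3 -> X) (om : 'I_n4 -> Y) (el : 'I_n5 -> Y) (lam : 'I_n4 -> X) (nu : 'I_n5 -> X),
  [/\ [/\ obasis (div_kernel S L b) s phi, obasis V s psi & obasis U s kap],
      obasis W q om /\ obasis L q el,
      [/\ forall i, V (lam i), forall i j, b (lam i) (om j) = (i == j)%:R &
        forall x i, V x -> (forall r, W r -> b x r = 0) -> s (lam i) x = 0]
    & (forall i, S (nu i)) /\ forall i j, b (nu i) (el j) = (i == j)%:R].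
Proof.
have fK : findim (div_kernel S L b) s by apply: (findim_sub _ fS) => v [].
have [n1 [phi bphi]] := findim_basis (sip_kernel ok) fK.
have [n2 [psi bpsi]] := findim_basis (sok_V ok) fV.
have [n3 [kap bkap]] := findim_basis (sok_U ok) fU.
have [n4 [om bom]] := findim_basis (sok_W ok) fW.
have [n5 [el bel]] := findim_basis (sok_L ok) fL.
have [n6 [e be]] := findim_basis (sok_S ok) fS.
have [lam hlam] := lifting (sok_V ok) (sok_W ok) bpsi bom (sok_bW ok).1 (sok_bW ok).2 (sok_injW ok).
have [nu [nu1 nu2 _]] := lifting (sok_S ok) (sok_L ok) be bel (sok_bL ok).1 (sok_bL ok).2 (sok_injL ok).
by exists n1, n2, n3, n4, n5, phi, psi, kap, om, el, lam, nu.
Qed.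

Theorem scheme_existence ui mi : positive_constants c -> div_kernel S L b ui -> V mi ->
  exists (u du : R -> X) (p : R -> Y) (m dm z k H : R -> X) (ph : R -> Y),
    abstract_solution T S U V W L s q N Tr P Z G C Dd B b Th c ui mi u du p m dm z k H ph.
Proof.
move=> cpos hu hm.
have [n1 [n2 [n3 [n4 [n5 [phi [psi [kap [om [el [lam [nu]]]]]]]]]]]] := scheme_bases.
move=> [[bphi bpsi bkap] [bom bel] hlam hnu].
exact: (abstract_existence T0 ok bphi bpsi bkap bom bel hlam hnu cpos hu hm).
Qed.

Theorem scheme_uniqueness ui mi (u du : R -> X) (p : R -> Y) (m dm z k H : R -> X) (ph : R -> Y)
    (u' du' : R -> X) (p' : R -> Y) (m' dm' z' k' H' : R -> X) (ph' : R -> Y) :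
  S ui -> V mi ->
  abstract_solution T S U V W L s q N Tr P Z G C Dd B b Th c ui mi u du p m dm z k H ph ->
  abstract_solution T S U V W L s q N Tr P Z G C Dd B b Th c ui mi u' du' p' m' dm' z' k' H' ph' ->
  forall t, 0 <= t <= T ->
    [/\ s (u t - u' t) (u t - u' t) = 0, q (p t - p' t) (p t - p' t) = 0,
    s (m t - m' t) (m t - m' t) = 0, s (z t - z' t) (z t - z' t) = 0
    & [/\ s (k t - k' t) (k t - k' t) = 0, s (H t - H' t) (H t - H' t) = 0
        & q (ph t - ph' t) (ph t - ph' t) = 0]].
Proof.
have [n1 [n2 [n3 [n4 [n5 [phi [psi [kap [om [el [lam [nu]]]]]]]]]]]] := scheme_bases.
move=> [[bphi bpsi bkap] [bom bel] hlam hnu].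
exact: (abstract_uniqueness T0 ok bphi bpsi bkap bom hlam).
Qed.

End SchemeTheorems.

(** * Functionals composed with operators that are linear almost everywhere *)

Section NullLinear.
Variables (R : realType) (V1 V2 V3 : lmodType R).
Variables (A1 : set V1) (A2 : set V2) (A3 : set V3).
Variables (s1 : V1 -> V1 -> R) (s2 : V2 -> V2 -> R) (s3 : V3 -> V3 -> R).
Hypotheses (h2 : sip A2 s2) (h3 : sip A3 s3).

(* Linear up to null vectors: the chosen representatives of weak derivatives are linear
   only almost everywhere. *)
Definition null_linear (W1 W2 : lmodType R) (B1 : set W1) (t1 : W1 -> W1 -> R)
    (B2 : set W2) (t2 : W2 -> W2 -> R) (M : W1 -> W2) :=
  [/\ forall x, B1 x -> B2 (M x),
      forall (a : R) x y, B1 x -> B1 y ->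
        let r := M (a *: x + y) - (a *: M x + M y) in t2 r r = 0
    & forall x, B1 x -> t1 x x = 0 -> t2 (M x) (M x) = 0].

Lemma lfun_comp M l : (forall (a : R) x y, A1 x -> A1 y -> A1 (a *: x + y)) ->
  null_linear A1 s1 A2 s2 M -> lfun A2 s2 l -> lfun A1 s1 (fun x => l (M x)).
Proof.
move=> lin1 [m1 m2 m3] hl; split=> [a x y hx hy|x hx h].
  rewrite -hl.1; [|exact: m1|exact: m1].
  apply: (lfun_eq h2 hl); [by apply: m1; exact: lin1|by apply: (sip_X h2); exact: m1|exact: m2].
by apply: hl.2; [exact: m1|exact: m3].
Qed.

End NullLinear.

Section Instance.
Variables (R : realType) (Om : set (pt R)) (E : elements) (D : discretization R).
Hypothesis oOm : open Om.
Hypothesis bOm : exists r : R, forall x, Om x -> enorm x <= r.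
Hypothesis ok : fe_ok Om E D.
Implicit Types (u v w m k z H F : pt R -> pt R) (f g q : pt R -> R).

Let mO : measurable Om := mOm oOm.
Let sL2 := sip_L2 oOm bOm.
Let sL2v := sip_L2v oOm bOm.
Let hS := ok_S ok.
Let hU := ok_U ok.
Let hV := ok_V ok.

Lemma null_linear_field (X : set (pt R -> pt R)) (M : (pt R -> pt R) -> (pt R -> pt R)) :
  X 0 -> X `<=` L2v Om ->
  (forall (a : R) u v, X u -> X v -> X (a *: u + v)) -> (forall u, X u -> L2v Om (M u)) ->
  (forall (a : R) u v, X u -> X v -> aeq Om (M (a *: u + v)) (a *: M u + M v)) ->
  (forall u v, X u -> X v -> aeq Om u v -> aeq Om (M u) (M v)) ->
  null_linear X (vip Om) (L2v Om) (vip Om) M.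
Proof.
move=> X0 XL Xlin ML Mlin Maeq; split; first exact: ML.
  move=> a u v hu hv; have Lu := ML _ hu; have Lv := ML _ hv; have Luv := ML _ (Xlin a u v hu hv).
  by apply: (vip_nullP oOm bOm Luv (L2v_lin mO a Lu Lv)); exact: Mlin.
move=> u hu h; have e := Maeq u 0 hu X0 (vip_eq0 mO (XL u hu) h).
(* Linearity with a = -1 at u = v = 0 reads M 0 = - M 0 + M 0 almost everywhere. *)
have e0 : aeq Om (M 0) 0.
  have := Mlin (-1) 0 0 X0 X0; rewrite scaler0 addr0 scaleN1r.
  by apply: filterS => x hx Ox; have := hx Ox; rewrite (_ : (- M 0 + M 0) x = - M 0 x + M 0 x) ?addNr.
by apply: (vip_aeq0 oOm bOm); [exact: ML|exact: aeq_trans e e0].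
Qed.

Lemma null_linear_scalar (X : set (pt R -> pt R)) (M : (pt R -> pt R) -> (pt R -> R)) :
  X 0 -> X `<=` L2v Om ->
  (forall (a : R) u v, X u -> X v -> X (a *: u + v)) -> (forall u, X u -> L2 Om (M u)) ->
  (forall (a : R) u v, X u -> X v -> aeq Om (M (a *: u + v)) (a *: M u + M v)) ->
  (forall u v, X u -> X v -> aeq Om u v -> aeq Om (M u) (M v)) ->
  null_linear X (vip Om) (L2 Om) (ip Om) M.
Proof.
move=> X0 XL Xlin ML Mlin Maeq; split; first exact: ML.
  move=> a u v hu hv; have Lu := ML _ hu; have Lv := ML _ hv; have Luv := ML _ (Xlin a u v hu hv).
  by apply: (ip_nullP oOm bOm Luv (L2_lin mO a Lu Lv)); exact: Mlin.
move=> u hu h; have e := Maeq u 0 hu X0 (vip_eq0 mO (XL u hu) h).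
have e0 : aeq Om (M 0) 0.
  have := Mlin (-1) 0 0 X0 X0; rewrite scaler0 addr0 scaleN1r.
  by apply: filterS => x hx Ox; have := hx Ox; rewrite (_ : (- M 0 + M 0) x = - M 0 x + M 0 x) ?addNr.
by apply: (ip_aeq0 oOm bOm); [exact: ML|exact: aeq_trans e e0].
Qed.

Section OneSpace.
Variable X : set (pt R -> pt R).
Hypothesis hX : sip X (vip Om).
Hypothesis Xb : forall v, X v -> vbnd Om v.
Let XL : X `<=` L2v Om. Proof. by move=> v hv; exact: (vbnd_L2v mO (fOm oOm bOm) (Xb hv)). Qed.

Lemma lfun_field M l : null_linear X (vip Om) (L2v Om) (vip Om) M ->
  lfun (L2v Om) (vip Om) l -> lfun X (vip Om) (fun v => l (M v)).
Proof. by move=> hM; apply: (lfun_comp sL2v _ hM); exact: (sip_X hX). Qed.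

Lemma lfun_scalar M l : null_linear X (vip Om) (L2 Om) (ip Om) M ->
  lfun (L2 Om) (ip Om) l -> lfun X (vip Om) (fun v => l (M v)).
Proof. by move=> hM; apply: (lfun_comp sL2 _ hM); exact: (sip_X hX). Qed.

Lemma null_linear_wcurl : X `<=` Hcurl Om -> null_linear X (vip Om) (L2v Om) (vip Om) (wcurl Om).
Proof.
move=> XH; apply: (null_linear_field (sip_0 hX) XL (sip_X hX)).
- by move=> u /XH; exact: wcurl_L2v.
- by move=> a u v /XH hu /XH hv; exact: (wcurl_lin oOm bOm).
- by move=> u v /XH hu /XH hv; exact: (wcurl_aeq oOm bOm).
Qed.

Lemma null_linear_wdiv : X `<=` Hdiv Om -> null_linear X (vip Om) (L2 Om) (ip Om) (wdiv Om).
Proof.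
move=> XH; apply: (null_linear_scalar (sip_0 hX) XL (sip_X hX)).
- by move=> u /XH; exact: wdiv_L2.
- by move=> a u v /XH hu /XH hv; exact: (wdiv_lin oOm bOm).
- by move=> u v /XH hu /XH hv; exact: (wdiv_aeq oOm bOm).
Qed.

Lemma null_linear_crossl w : L2v Om w -> null_linear X (vip Om) (L2v Om) (vip Om) (fun u => crossf u w).
Proof.
move=> hw; apply: (null_linear_field (sip_0 hX) XL (sip_X hX)).
- by move=> u hu; exact: (crossf_L2v oOm (Xb hu) hw).
- by move=> a u v _ _; rewrite crossf_linl; exact: aeq_refl.
- by move=> u v _ _ e; apply: crossf_aeq => //; exact: aeq_refl.
Qed.

Lemma lfun_vipr v : L2v Om v -> lfun X (vip Om) (vip Om v).
Proof. by move=> hv; apply: (lfun_sub XL); exact: (lfun_r sL2v hv). Qed.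

Lemma lfun_cross1 w v : L2v Om w -> L2v Om v -> lfun X (vip Om) (fun u => vip Om (crossf u w) v).
Proof. by move=> hw hv; exact: (lfun_field (null_linear_crossl hw) (sip_lfunl sL2v hv)). Qed.

End OneSpace.

Lemma lfun_cross2 u v : vbnd Om u -> L2v Om v -> lfun (L2v Om) (vip Om) (fun w => vip Om (crossf u w) v).
Proof.
move=> hu hv.
apply: (lfun_comp sL2v (l := fun w => vip Om w v) (sip_X sL2v) _ (sip_lfunl sL2v hv)).
apply: (null_linear_field (sip_0 sL2v) _ (sip_X sL2v)).
- by [].
- by move=> w hw; exact: (crossf_L2v oOm hu hw).
- by move=> a w w' _ _; rewrite crossf_linr; exact: aeq_refl.
- by move=> w w' _ _ e; apply: crossf_aeq => //; exact: aeq_refl.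
Qed.

End Instance.

(** * The finite element scheme *)

Section FiniteElementScheme.
Variables (R : realType) (T : R) (Om : set (pt R)) (E : elements) (D : discretization R).
Variable He : R -> pt R -> pt R.
Hypothesis T0 : 0 < T.
Hypothesis oOm : open Om.
Hypothesis bOm : exists r : R, forall x, Om x -> enorm x <= r.
Hypothesis ok : fe_ok Om E D.
Hypothesis cHe : C0_on T (hdivnorm Om) (Hdiv Om) He.
Implicit Types (u v w m k z H F : pt R -> pt R) (f g q : pt R -> R).

Let mO : measurable Om := mOm oOm.
Let sL2 := sip_L2 oOm bOm.
Let sL2v := sip_L2v oOm bOm.
Let hS := ok_S ok.
Let hU := ok_U ok.
Let hV := ok_V ok.
Let bS := ok_Sb ok.
Let bU := ok_Ub ok.
Let bV := ok_Vb ok.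
Let LS : forall v, Sh Om E D v -> L2v Om v. Proof. by move=> v; exact: (S_L2v oOm bOm ok). Qed.
Let LV : forall v, Vh Om E D v -> L2v Om v. Proof. by move=> v; exact: (V_L2v ok). Qed.

Definition form_N u w v := vip Om (crossf u (wcurl Om w)) v.
(** Plays both P and Z: the forms (v x k, H) and (u x m, w) differ only in the spaces of their
    arguments. *)
Definition form_P v k H := vip Om (crossf v k) H.
Definition form_C w m := vip Om (wcurl Om w) m.
Definition form_D m F := ip Om (wdiv Om m) (wdiv Om F).
Definition form_B m n H F := vip Om (crossf m (crossf n H)) F.
Definition form_b v q := ip Om (wdiv Om v) q.
Definition form_Th t q := ip Om (wdiv Om (He t)) q.

Lemma form_P_lfun3 (X1 X2 X3 : set (pt R -> pt R)) : sip X1 (vip Om) -> sip X2 (vip Om) ->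
  sip X3 (vip Om) -> (forall v, X1 v -> vbnd Om v) -> (forall v, X2 v -> vbnd Om v) ->
  (forall v, X3 v -> vbnd Om v) ->
  lfun3 X1 X2 X3 (vip Om) (vip Om) (vip Om) form_P.
Proof.
move=> h1 h2 h3 b1 b2 b3.
have L1 v : X1 v -> L2v Om v by move=> /b1; exact: (vbnd_L2v mO (fOm oOm bOm)).
have L2 v : X2 v -> L2v Om v by move=> /b2; exact: (vbnd_L2v mO (fOm oOm bOm)).
have L3 v : X3 v -> L2v Om v by move=> /b3; exact: (vbnd_L2v mO (fOm oOm bOm)).
split=> [y z hy hz|x z hx hz|x y hx hy].
- exact: (lfun_cross1 oOm bOm h1 b1 (L2 _ hy) (L3 _ hz)).
- by apply: (lfun_sub (A := L2v Om)) => //; exact: (lfun_cross2 oOm bOm (b1 _ hx) (L3 _ hz)).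
- exact: (lfun_vipr oOm bOm b3 (crossf_L2v oOm (b1 _ hx) (L2 _ hy))).
Qed.

Lemma form_N_lfun3 : lfun3 (Sh Om E D) (Sh Om E D) (Sh Om E D) (vip Om) (vip Om) (vip Om) form_N.
Proof.
have Lc v : Sh Om E D v -> L2v Om (wcurl Om v).
  by move=> /(S_Hcurl oOm bOm ok); exact: wcurl_L2v.
split=> [y z hy hz|x z hx hz|x y hx hy].
- exact: (lfun_cross1 oOm bOm hS bS (Lc _ hy) (LS hz)).
- exact: (lfun_field oOm bOm hS (null_linear_wcurl oOm bOm hS bS (fun v => @S_Hcurl _ _ _ _ oOm bOm ok v))
    (lfun_cross2 oOm bOm (bS hx) (LS hz))).
- exact: (lfun_vipr oOm bOm bS (crossf_L2v oOm (bS hx) (Lc _ hy))).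
Qed.

Lemma form_Tr_lfun3 : lfun3 (Sh Om E D) (Vh Om E D) (Vh Om E D) (vip Om) (vip Om) (vip Om) (trilin Om).
Proof.
have s3 x y : Sh Om E D x -> Vh Om E D y -> lfun (Vh Om E D) (vip Om) (trilin Om x y).
  move=> hx hy; apply: (lfun_of_aeq oOm (sip_0 hV) LV) => [a u v hu hv|u v hu hv e].
    exact: (trilin_linr oOm bOm ok a (bS hx) hy hu hv).
  exact: (trilin_aeq oOm bOm ok (bS hx) hy hu (bS hx) hy hv (aeq_refl _ _) (aeq_refl _ _) e).
split=> [y z hy hz|x z hx hz|]; last exact: s3.
- apply: (lfun_of_aeq oOm (sip_0 hS) LS) => [a u v hu hv|u v hu hv e].
    exact: (trilin_linl oOm ok a (bS hu) (bS hv) hy hz).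
  exact: (trilin_aeq oOm bOm ok (bS hu) hy hz (bS hv) hy hz e (aeq_refl _ _) (aeq_refl _ _)).
(* Antisymmetry in the last two arguments transfers linearity from the third to the second. *)
rewrite (_ : (fun y => _) = fun y => -1 * trilin Om x z y); first exact: lfunZ (s3 _ _ hx hz).
by apply/funext => y; rewrite trilin_anti mulN1r.
Qed.

Lemma form_G_lfun2 : lfun2 (Sh Om E D) (Sh Om E D) (vip Om) (vip Om) (gip Om).
Proof.
have H1 v : Sh Om E D v -> H01v Om v := @ok_S1 _ _ _ _ ok v.
have s1 y : Sh Om E D y -> lfun (Sh Om E D) (vip Om) (gip Om ^~ y).
  move=> hy; apply: (lfun_of_aeq oOm (sip_0 hS) LS) => [a u v hu hv|u v hu hv e].
    exact: (gip_lin oOm bOm a (H1 _ hu) (H1 _ hv) (H1 _ hy)).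
  exact: (gip_aeq oOm bOm (H1 _ hu) (H1 _ hy) (H1 _ hv) (H1 _ hy) e (aeq_refl _ _)).
split=> [y hy|y hy]; first exact: s1.
have e : gip Om y = gip Om ^~ y by apply/funext => x; exact: gip_sym.
exact: (eq_ind_r (lfun (Sh Om E D) (vip Om)) (s1 y hy) e).
Qed.

Lemma form_C_lfun2 : lfun2 (Uh Om E D) (Vh Om E D) (vip Om) (vip Om) form_C.
Proof.
split=> [y hy|x hx].
  exact: (lfun_field oOm bOm hU (null_linear_wcurl oOm bOm hU bU (fun v => @U_Hcurl _ _ _ _ ok v))
    (sip_lfunl sL2v (LV hy))).
exact: (lfun_vipr oOm bOm bV (U_curl_L2v ok hx)).
Qed.

Let nV := null_linear_wdiv oOm bOm hV bV (fun v => @V_Hdiv _ _ _ _ ok v).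
Let nS := null_linear_wdiv oOm bOm hS bS (fun v => @S_Hdiv _ _ _ _ oOm bOm ok v).

Lemma form_D_lfun2 : lfun2 (Vh Om E D) (Vh Om E D) (vip Om) (vip Om) form_D.
Proof.
split=> [y hy|x hx].
  exact: (lfun_scalar oOm bOm hV nV (sip_lfunl sL2 (V_div_L2 ok hy))).
exact: (lfun_scalar oOm bOm hV nV (lfun_r sL2 (V_div_L2 ok hx))).
Qed.

Lemma form_B_lfun4 : lfun4 (Vh Om E D) (Vh Om E D) (Vh Om E D) (Vh Om E D)
  (vip Om) (vip Om) (vip Om) (vip Om) form_B.
Proof.
have xL u v : Vh Om E D u -> Vh Om E D v -> L2v Om (crossf u v).
  by move=> hu hv; exact: (crossf_L2v oOm (bV hu) (LV hv)).
split=> [y z w hy hz hw|x z w hx hz hw|x y w hx hy hw|x y z hx hy hz].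
- exact: (lfun_cross1 oOm bOm hV bV (xL _ _ hy hz) (LV hw)).
- exact: (lfun_field oOm bOm hV (null_linear_crossl oOm bOm hV bV (LV hz))
    (lfun_cross2 oOm bOm (bV hx) (LV hw))).
- suff hM : null_linear (Vh Om E D) (vip Om) (L2v Om) (vip Om) (crossf y).
    exact: (lfun_field oOm bOm hV hM (lfun_cross2 oOm bOm (bV hx) (LV hw))).
  apply: (null_linear_field oOm bOm (sip_0 hV) LV (sip_X hV)).
  + by move=> u hu; exact: xL.
  + by move=> a u v _ _; rewrite crossf_linr; exact: aeq_refl.
  + by move=> u v _ _ e; apply: crossf_aeq => //; exact: aeq_refl.
- exact: (lfun_vipr oOm bOm bV (crossf_L2v oOm (bV hx) (xL _ _ hy hz))).
Qed.

Lemma form_bV_lfun2 : lfun2 (Vh Om E D) (Wh Om D) (vip Om) (ip Om) form_b.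
Proof.
split=> [r hr|v hv].
  exact: (lfun_scalar oOm bOm hV nV (sip_lfunl sL2 (ok_WL2 ok hr))).
apply: (lfun_sub (A := L2 Om)); first by move=> r; exact: (ok_WL2 ok).
exact: (lfun_r sL2 (V_div_L2 ok hv)).
Qed.

Lemma form_bS_lfun2 : lfun2 (Sh Om E D) (Lh Om D) (vip Om) (ip Om) form_b.
Proof.
split=> [r hr|v hv].
  exact: (lfun_scalar oOm bOm hS nS (sip_lfunl sL2 (ok_LL2 ok hr))).
apply: (lfun_sub (A := L2 Om)); first by move=> r; exact: (ok_LL2 ok).
exact: (lfun_r sL2 (wdiv_L2 (S_Hdiv oOm bOm ok hv))).
Qed.

(** Continuity of H_e in the H(div) norm controls the divergence of an increment. This divergence is
    the increment of the chosen divergences only almost everywhere, which suffices under the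
    integral. *)
Lemma form_Th_cont q : L2 Om q -> contT T (fun t => form_Th t q).
Proof.
move=> hq; have [XH hc] := cHe; apply/(contTP T0) => t e ht e0.
have K0 : 0 < snorm Om q + 1 by rewrite ltr_wpDl// sqrtr_ge0.
have [d d0 hd] := hc t _ ht (divr_gt0 e0 K0); exists d => // r hr rt.
have Hr := XH r hr; have Ht := XH t ht.
have Hrt : Hdiv Om (He r - He t).
  by rewrite addrC -scaleN1r; exact: (Hdiv_lin oOm bOm (-1) Ht Hr).
have -> : form_Th r q - form_Th t q = ip Om (wdiv Om (He r - He t)) q.
  by rewrite (addrC (He r)) -(scaleN1r (He t)) (ip_wdiv_lin oOm bOm (-1) Ht Hr hq) mulN1r addrC.
apply: le_trans (sip_cs_sqrt sL2 (wdiv_L2 Hrt) hq) _.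
have := hd r hr rt; rewrite ler_pdivlMr// => h; apply: le_trans h.
apply: le_trans (_ : hdivnorm Om (He r - He t) * snorm Om q <= _).
  rewrite ler_wpM2r ?sqrtr_ge0// ler_sqrt ?lerDr ?vip_ge0//.
  by rewrite addr_ge0 ?vip_ge0 ?ip_ge0.
by rewrite ler_wpM2l ?sqrtr_ge0// lerDl.
Qed.

Lemma fe_scheme_ok : scheme_ok T (Sh Om E D) (Uh Om E D) (Vh Om E D) (Wh Om D) (Lh Om D)
  (vip Om) (ip Om) form_N (trilin Om) form_P form_P (gip Om) form_C form_D form_B form_b form_Th.
Proof.
split.
- exact: hS.
- exact: hU.
- exact: hV.
- exact: (ok_W ok).
- exact: (ok_L ok).
- exact: form_N_lfun3.
- exact: form_Tr_lfun3.
- exact: (form_P_lfun3 hS hU hV bS bU bV).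
- exact: (form_P_lfun3 hS hV hU bS bV bU).
- exact: form_G_lfun2.
- exact: form_C_lfun2.
- exact: form_D_lfun2.
- exact: form_B_lfun4.
- exact: form_bV_lfun2.
- exact: form_bS_lfun2.
- by move=> u v hu hv; exact: (vip_crossf_self oOm bOm).
- by move=> u m hu hm; exact: trilin_self.
- by move=> m v H hm hv hH; exact: (vip_crossf_self oOm bOm).
- by move=> u hu; exact: gip_ge0.
- by move=> m hm; exact: ip_ge0.
(* Every r in W_h is a divergence; testing with a field of divergence r gives (r, r) = 0. *)
- move=> r hr h; have [v hv e] := ok_Wex ok hr.
  have Lr := ok_WL2 ok hr; have Lv := V_div_L2 ok hv.
  by rewrite -(ip_aeq mO Lv Lr Lr Lr e (aeq_refl _ _)); exact: h.
- by move=> r hr h; exact: (ok_Linj ok hr h).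
- by move=> r hr; exact: (form_Th_cont (ok_WL2 ok hr)).
- move=> t ht; apply: (lfun_sub (A := L2 Om)); first by move=> r; exact: (ok_WL2 ok).
  exact: (lfun_r sL2 (wdiv_L2 (cHe.1 t ht))).
Qed.

(** The default value 0 of each [xget] lies in the discrete spaces, so membership holds whether or
    not a decomposition or a projection exists. *)
Lemma Ihd_in_Vh m : Vh Om E D (Ihd Om E D m).
Proof.
rewrite /Ihd; case: xgetP => [w _ [v1 [v2 [_ _ _ ->]]]|_]; last exact: (sip_0 hV).
have hP : Uh Om E D (Phc Om E D v1).
  by rewrite /Phc; case: xgetP => [y _ [[]]//|_]; exact: (sip_0 hU).
have hQ : Vh Om E D (Phd Om E D v2).
  by rewrite /Phd; case: xgetP => [y _ [[]]//|_]; exact: (sip_0 hV).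
by apply: (sipD hV) => //; exact: (ok_Uc ok hP).2.
Qed.

Variables (c : constants R) (u0 m0 : pt R -> pt R).

Definition discrete_solution := abstract_solution T (Sh Om E D) (Uh Om E D) (Vh Om E D) (Wh Om D)
  (Lh Om D) (vip Om) (ip Om) form_N (trilin Om) form_P form_P (gip Om) form_C form_D form_B form_b
  form_Th c (initial_u Om u0 E D) (initial_m Om m0 E D).

(** Stated over plain reals, so that [lra] sees atoms in place of integrals. *)
Let momentumE (a n g p t r e mu : R) :
  a - n + e * g - p - mu * t - mu / 2 * r = 0 <->
  a = - e * g + (mu * t + (mu / 2 * r + n)) + p.
Proof. by split; lra. Qed.

Let magnetizationE (a t x z k d m H B s tau ch be : R) :
  a + t + 2^-1 * x - 2^-1 * z + s * k + s * d + tau * m - ch * H + be * B = 0 <->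
  a = - (2^-1 * x + (- 2^-1 * z + (s * k + (s * d + (tau * m + (- ch * H + (be * B + t))))))).
Proof. by split; lra. Qed.

Hypothesis iu : Sh Om E D (initial_u Om u0 E D).

Lemma sd_solution_discrete X : sd_solution Om T c He u0 m0 E D X -> exists du dm,
  discrete_solution (sd_u X) du (sd_p X) (sd_m X) dm (sd_z X) (sd_k X) (sd_H X) (sd_phi X).
Proof.
move=> [du [dm [[C1u C0p C1m [C0z C0k C0H C0ph]] iu0 im0 eqs]]].
have T00 : 0 <= (0 : R) <= T by rewrite lexx ltW.
have [[uS _] _ _] := C1u; have [[mV _] _ _] := C1m; have [HV _] := C0H.
exists du, dm; split.
- by split; [exact: C1u|exact: C0p|exact: C1m|split; [exact: C0z|exact: C0k|exact: C0H|exact: C0ph]].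
- exact: (vip_nullP oOm bOm (LS (uS _ T00)) (LS iu) iu0).
- exact: (vip_nullP oOm bOm (LV (mV _ T00)) (LV (Ihd_in_Vh m0)) im0).
move=> t ht; have [eu ediv em [ez ek] [eH eph]] := eqs t ht; split.
- move=> v hv; have := eu v hv; rewrite (ip_sym Om (sd_p X t)) => /momentumE h; exact: h.
- exact: ediv.
- move=> F hF; have := em F hF => /magnetizationE h; exact: h.
- split=> w hw; apply/eqP; rewrite -subr_eq0; apply/eqP; first exact: ez.
  by rewrite /form_C (vip_sym Om (wcurl Om w)); exact: ek.
split=> [g hg|r hr]; first by rewrite /form_b (ip_sym Om (wdiv Om g)); exact: eH.
have dH := V_div_L2 ok (HV t ht); have dm' := V_div_L2 ok (mV t ht).
by have := eph r hr; rewrite (sipDl sL2 dH dm' (ok_WL2 ok hr)).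
Qed.

Lemma discrete_sd_solution (u du : R -> pt R -> pt R) (p : R -> pt R -> R)
    (m dm z k H : R -> pt R -> pt R) (ph : R -> pt R -> R) :
  discrete_solution u du p m dm z k H ph ->
  sd_solution Om T c He u0 m0 E D (SdState u p m z k H ph).
Proof.
move=> [[C1u C0p C1m [C0z C0k C0H C0ph]] iu0 im0 eqs].
have T00 : 0 <= (0 : R) <= T by rewrite lexx ltW.
have [[uS _] _ _] := C1u; have [[mV _] _ _] := C1m; have [HV _] := C0H.
exists du, dm; split; first by split; [exact: C1u|exact: C0p|exact: C1m|split].
- exact: (vip_null oOm bOm (LS (uS _ T00)) (LS iu) iu0).
- exact: (vip_null oOm bOm (LV (mV _ T00)) (LV (Ihd_in_Vh m0)) im0).
move=> t ht; have [eu ediv em [ez ek] [eH eph]] := eqs t ht; split.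
- move=> v hv; rewrite (ip_sym Om (sd_p _ t)); apply/momentumE; exact: (eu v hv).
- exact: ediv.
- move=> F hF; apply/magnetizationE; exact: (em F hF).
- split=> w hw; apply/eqP; rewrite subr_eq0; apply/eqP; first exact: ez.
  by rewrite (vip_sym Om (sd_m _ t)); exact: ek.
split=> [g hg|r hr]; first by rewrite (ip_sym Om (sd_phi _ t)); exact: eH.
have dH := V_div_L2 ok (HV t ht); have dm' := V_div_L2 ok (mV t ht).
by rewrite (sipDl sL2 dH dm' (ok_WL2 ok hr)); exact: eph.
Qed.

(** The initial velocity has to lie in [Khs], because the divergence constraint of the scheme is
    also imposed at t = 0. *)
Lemma sd_exists : positive_constants c -> Khs Om E D (initial_u Om u0 E D) ->
  exists X, sd_solution Om T c He u0 m0 E D X.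
Proof.
move=> cpos hu; have [u [du [p [m [dm [z [k [H [ph sol]]]]]]]]] :=
  scheme_existence T0 fe_scheme_ok (ok_Sf ok) (ok_Uf ok) (ok_Vf ok) (ok_Wf ok) (ok_Lf ok)
    cpos hu (Ihd_in_Vh m0).
by exists (SdState u p m z k H ph); exact: (discrete_sd_solution sol).
Qed.

Lemma sd_unique X Y : sd_solution Om T c He u0 m0 E D X -> sd_solution Om T c He u0 m0 E D Y ->
  sd_eq Om T X Y.
Proof.
move=> /sd_solution_discrete [du [dm solX]] /sd_solution_discrete [du' [dm' solY]] t ht.
have [e1 e2 e3 e4 [e5 e6 e7]] := scheme_uniqueness T0 fe_scheme_ok (ok_Sf ok) (ok_Uf ok) (ok_Vf ok)
  (ok_Wf ok) (ok_Lf ok) iu (Ihd_in_Vh m0) solX solY ht.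
have [[[[uX _] _ _] [pX _] [[mX _] _ _] [[zX _] [kX _] [HX _] [phX _]]] _ _ _] := solX.
have [[[[uY _] _ _] [pY _] [[mY _] _ _] [[zY _] [kY _] [HY _] [phY _]]] _ _ _] := solY.
split.
- exact: (vip_null oOm bOm (LS (uX t ht)) (LS (uY t ht)) e1).
- exact: (ip_null oOm bOm (ok_LL2 ok (pX t ht)) (ok_LL2 ok (pY t ht)) e2).
- exact: (vip_null oOm bOm (LV (mX t ht)) (LV (mY t ht)) e3).
- exact: (vip_null oOm bOm (U_L2v ok (zX t ht)) (U_L2v ok (zY t ht)) e4).
split.
- exact: (vip_null oOm bOm (U_L2v ok (kX t ht)) (U_L2v ok (kY t ht)) e5).
- exact: (vip_null oOm bOm (LV (HX t ht)) (LV (HY t ht)) e6).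
- exact: (ip_null oOm bOm (ok_WL2 ok (phX t ht)) (ok_WL2 ok (phY t ht)) e7).
Qed.

End FiniteElementScheme.

Theorem theorem3p4 (R : realType) (Om : set (pt R)) (T : R)
    (c : constants R) (l : nat) (E : elements) (hs : set R)
    (D : R -> discretization R)
    (He : R -> (pt R) -> (pt R))
    (u0 m0 : (pt R) -> (pt R)) :
  good_domain Om -> 0 < T -> positive_constants c ->
  fe_family Om l E hs D ->
  H1_Hdiv T Om He ->
  (forall t, 0 < t <= T -> H0div Om (He t)) ->
  H01v Om u0 -> {within closure Om, continuous u0} ->
  H0div Om m0 ->
  (forall h, hs h -> Khs Om E (D h) (initial_u Om u0 E (D h))) ->
  (forall h, hs h -> exists X, sd_solution Om T c He u0 m0 E (D h) X) /\
  (forall h0 M0 : R, 0 < h0 -> 0 < M0 ->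
     (forall h u m t, hs h -> 0 < h <= h0 ->
        aux_solution Om T c He u0 m0 E (D h) u m -> 0 <= t <= T ->
        (aux_size Om E (D h) u m t <= M0%:E)%E) ->
     forall h, hs h -> 0 < h <= h0 ->
       (exists X, sd_solution Om T c He u0 m0 E (D h) X) /\
       (forall X Y, sd_solution Om T c He u0 m0 E (D h) X ->
          sd_solution Om T c He u0 m0 E (D h) Y -> sd_eq Om T X Y)).
Proof.
move=> dom T0 cpos fam [_ cHe _] _ _ _ _ iu.
have oOm := dom_open dom; have bOm := dom_bounded dom.
have [c2 c20 hinf] := fam_A2 fam.
have ok h : hs h -> fe_ok Om E (D h).
  move=> hh; exact: (fe_okP oOm bOm (fam_mesh fam hh) (fam_pwL fam hh) (fam_pwW fam hh)
    (fam_A1 fam hh) c20 (hinf h hh)).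
have ex h : hs h -> exists X, sd_solution Om T c He u0 m0 E (D h) X.
  by move=> hh; exact: (sd_exists T0 oOm bOm (ok h hh) cHe m0 (iu h hh).1 cpos (iu h hh)).
split=> [|h0 M0 _ _ _ h hh _]; first exact: ex.
split; first exact: ex.
by move=> X Y; exact: (sd_unique T0 oOm bOm (ok h hh) cHe (iu h hh).1).
Qed.
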